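(* There exists an algorithm with the following guarantees. Given the full description of a Bayes net $Q$ over $\{0,1\}^n$ of degree at most $d$ which is $(c,C)$-balanced and $\gamma$-non-degenerate (with respect to its structure and degree $d$), for $c=\widetilde\Omega(1/\sqrt n)$ and $C=\widetilde\Omega(d\epsilon^2/\sqrt n)$, a parameter $\epsilon\in(0,1]$, and sample access to a distribution $P$ promised to be a Bayes net of degree at most $d$ whose skeleton has no more edges than $Q$'s, the algorithm takes $O\big(2^{d/2}\sqrt n/\epsilon^2+(2^d+d\log n)/\gamma^2\big)$ samples from $P$, runs in time $O(n)^{d+3}(1/\gamma^2+1/\epsilon^2)$, and distinguishes with probability at least $2/3$ between (i) $P=Q$ and (ii) $\|P-Q\|_1>\epsilon$.
   Context: A Bayes net with structure $\mathcal{S}$ (a DAG on $[n]$, topologically sorted; degree means maximum in-degree) is a distribution on $\{0,1\}^n$ with $\Pr[X_i=1\mid X_1,\dots,X_{i-1}]$ depending only on $X_{\Pi(i)}$, $\Pi(i)$ the parents of $i$. Parental configuration $\Pi_{i,a}$: event $X_{\Pi(i)}=a$; $p_{i,a}=\Pr[X_i=1\mid\Pi_{i,a}]$. $(c,C)$-balanced: $p_{i,a}\in[c,1-c]$ and $\Pr[\Pi_{i,a}]\ge C$ for all $(i,a)$. The skeleton of a Bayes net is the undirected graph underlying its DAG. $d_{\mathrm{TV}}(P,Q)=\frac12\|P-Q\|_1$. For a distribution $P$ on $\{0,1\}^n$, nodes $i,j$ and a set $S$, $X_i,X_j$ are $\gamma$-far from independent conditioned on $X_S$ if for every distribution $Q'$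 with $d_{\mathrm{TV}}(P,Q')<\gamma$, $X_i$ and $X_j$ are not independent conditioned on $X_S$ under $Q'$. A Bayes net $P$ is $\gamma$-non-degenerate with respect to structure $\mathcal{S}$ and degree $d$ if for any nodes $X_i,X_j$ and any set $S$ of nodes with $|S|\le d$, $i,j\notin S$, satisfying one of: (i) $X_i$ is a parent of $X_j$; (ii) $S$ contains a node $X_k$ that is a child of both $X_i$ and $X_j$; (iii) $X_i$ is a grandparent of $X_j$ and some child of $X_i$ that is a parent of $X_j$ is not in $S$; (iv) $X_i,X_j$ have a common parent not in $S$ (all relations in $\mathcal{S}$), it holds that $X_i$ and $X_j$ are $\gamma$-far from independent conditioned on $X_S$. *)

(* Defs.v *)
From HB Require Import structures.
From mathcomp Require Export all_boot all_order all_algebra all_fingroup.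
From mathcomp Require Export boolp reals exp.
Set Implicit Arguments.
Unset Strict Implicit.
Unset Printing Implicit Defensive.
Import Order.TTheory GRing.Theory Num.Theory.
Local Open Scope ring_scope.

(** * Distributions on the hypercube *)

Definition bits (n : nat) := {ffun 'I_n -> bool}.

Record distr (R : realType) (n : nat) := Distr {
  pmf :> bits n -> R;
  pmf_ge0 : forall x, 0 <= pmf x;
  pmf_sum1 : \sum_x pmf x = 1 }.

Section Distributions.
Variables (R : realType) (n : nat).
Implicit Types (P Q : distr R n) (E F : {set bits n}) (T : {set 'I_n}).

Definition Pr P E : R := \sum_(x in E) P x.

Definition cPr P E F : R := Pr P (E :&: F) / Pr P F.

Definition l1 P Q : R := \sum_x `|P x - Q x|.

Definition dTV P Q : R := l1 P Q / 2.

(* The event X_i = b. *)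
Definition coord (i : 'I_n) (b : bool) : {set bits n} := [set y : bits n | y i == b].

(* The event X_T = x_T; only the coordinates of x in T matter. *)
Definition cyl T (x : bits n) : {set bits n} :=
  [set y : bits n | [forall j in T, y j == x j]].

Definition cond_indep P (i j : 'I_n) T : Prop :=
  forall (a b : bool) (x : bits n), Pr P (cyl T x) != 0 ->
    cPr P (coord i a :&: coord j b) (cyl T x) =
    cPr P (coord i a) (cyl T x) * cPr P (coord j b) (cyl T x).

Definition far_from_indep (gamma : R) P (i j : 'I_n) T : Prop :=
  forall P', dTV P P' < gamma -> ~ cond_indep P' i j T.

End Distributions.

(** * Bayes nets *)

Definition edge n (pa : 'I_n -> {set 'I_n}) : rel 'I_n := fun i j => i \in pa j.

Record dag (n : nat) := Dag {
  parents :> 'I_n -> {set 'I_n};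
  dag_acyclic : forall p : seq 'I_n, path.cycle (edge parents) p -> p = [::] }.

Section BayesNets.
Variables (R : realType) (n : nat).
Implicit Types (G : dag n) (P : distr R n).

Definition degree G : nat := \max_(i < n) #|parents G i|.

Definition skeleton G : {set {set 'I_n}} :=
  [set [set e.1; e.2] | e in [set e : 'I_n * 'I_n | e.1 \in parents G e.2]].

(* [s i] is the position of node i in the ordering. *)
Definition topological G (s : {perm 'I_n}) : Prop :=
  forall i j, j \in parents G i -> (s j < s i)%N.

Definition preds (s : {perm 'I_n}) (i : 'I_n) : {set 'I_n} :=
  [set j | (s j < s i)%N].

(* The DAG need not be sorted by the labels 0, ..., n-1 of its nodes, since two
   nets on the same labelled variables may only be sortable by different
   orderings. *)
Definition bayes_net G P : Prop :=
  exists2 s : {perm 'I_n}, topological G s &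
    forall (i : 'I_n) (x y : bits n),
      (forall j, j \in parents G i -> x j = y j) ->
      Pr P (cyl (preds s i) x) != 0 -> Pr P (cyl (preds s i) y) != 0 ->
      cPr P (coord i true) (cyl (preds s i) x) =
      cPr P (coord i true) (cyl (preds s i) y).

(* A parental configuration of i is given by any a : bits n, only the
   coordinates of a in [parents G i] being relevant. *)
Definition par_config G (i : 'I_n) (a : bits n) : {set bits n} :=
  cyl (parents G i) a.

Definition cond_param G P (i : 'I_n) (a : bits n) : R :=
  cPr P (coord i true) (par_config G i a).

Definition balanced G P (c C : R) : Prop :=
  forall (i : 'I_n) (a : bits n),
    c <= cond_param G P i a <= 1 - c /\ C <= Pr P (par_config G i a).

Definition linked G (T : {set 'I_n}) (i j : 'I_n) : Prop :=
  [\/ i \in parents G j,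
      (exists2 k, k \in T & (i \in parents G k) && (j \in parents G k)),
      (exists2 k, k \notin T & (i \in parents G k) && (k \in parents G j)) |
      (exists2 k, k \notin T & (k \in parents G i) && (k \in parents G j))].

Definition nondegenerate G P (d : nat) (gamma : R) : Prop :=
  forall (i j : 'I_n) (T : {set 'I_n}),
    i != j -> (#|T| <= d)%N -> i \notin T -> j \notin T ->
    linked G T i j -> far_from_indep gamma P i j T.

End BayesNets.

(** * Randomized real-RAM programs with sample access

    A machine has an array of natural numbers and an array of real numbers,
    both indirectly addressable.  Natural numbers support addition, truncated
    subtraction and halving, but not unit-cost multiplication; real numbers
    support exact field operations and comparison, but no rounding.  Programs
    contain no real constants other than casts of natural numbers, so that one
    finite program serves all inputs without hidden advice. *)

Inductive nexp : Type :=
  | NConst of nat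
  | NGet of nexp
  | NAdd of nexp & nexp
  | NSub of nexp & nexp
  | NHalf of nexp.

Inductive rexp : Type :=
  | RNat of nexp
  | RGet of nexp
  | RAdd of rexp & rexp
  | RSub of rexp & rexp
  | RMul of rexp & rexp
  | RDiv of rexp & rexp.

Inductive bexp : Type :=
  | BLeN of nexp & nexp
  | BLeR of rexp & rexp
  | BNot of bexp
  | BAnd of bexp & bexp.

Inductive prog : Type :=
  | Skip
  | SetN of nexp & nexp     (* address, value *)
  | SetR of nexp & rexp     (* address, value *)
  | Flip of nexp            (* store a fair coin toss *)
  | Sample of nexp          (* store the n bits of a fresh sample *)
  | Seq of prog & prog
  | If of bexp & prog & prog
  | While of bexp & prog.

Section Semantics.
Variables (R : realType) (n : nat).

Record state := State {
  nmem : nat -> nat;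
  rmem : nat -> R;
  clock : nat;
  drawn : nat;       (* samples used so far *)
  flipped : nat }.   (* coins used so far *)

Fixpoint neval (e : nexp) (st : state) : nat :=
  match e with
  | NConst k => k
  | NGet e1 => nmem st (neval e1 st)
  | NAdd e1 e2 => neval e1 st + neval e2 st
  | NSub e1 e2 => neval e1 st - neval e2 st
  | NHalf e1 => (neval e1 st)./2
  end%N.

Fixpoint reval (e : rexp) (st : state) : R :=
  match e with
  | RNat e1 => (neval e1 st)%:R
  | RGet e1 => rmem st (neval e1 st)
  | RAdd e1 e2 => reval e1 st + reval e2 st
  | RSub e1 e2 => reval e1 st - reval e2 st
  | RMul e1 e2 => reval e1 st * reval e2 st
  | RDiv e1 e2 => reval e1 st / reval e2 st
  end.

Fixpoint beval (e : bexp) (st : state) : bool :=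
  match e with
  | BLeN e1 e2 => (neval e1 st <= neval e2 st)%N
  | BLeR e1 e2 => reval e1 st <= reval e2 st
  | BNot e1 => ~~ beval e1 st
  | BAnd e1 e2 => beval e1 st && beval e2 st
  end.

Definition upd (T : Type) (m : nat -> T) (a : nat) (v : T) : nat -> T :=
  fun k => if k == a then v else m k.

Definition write_bits (m : nat -> nat) (a : nat) (x : bits n) : nat -> nat :=
  fun k => if (a <= k)%N then
             if insub (k - a)%N is Some i then nat_of_bool (x i) else m k
           else m k.

Definition tick (st : state) : state :=
  State (nmem st) (rmem st) (clock st).+1 (drawn st) (flipped st).

(* Big-step execution on a stream xs of samples and a stream rs of coins.
   Expressions have a size fixed by the program, so evaluating one is charged
   O(1), whereas reading a sample is charged n. *)
Inductive exec (xs : nat -> bits n) (rs : nat -> bool) :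
    prog -> state -> state -> Prop :=
  | ExecSkip st : exec xs rs Skip st (tick st)
  | ExecSetN a e st :
      exec xs rs (SetN a e) st
        (State (upd (nmem st) (neval a st) (neval e st)) (rmem st)
               (clock st).+1 (drawn st) (flipped st))
  | ExecSetR a e st :
      exec xs rs (SetR a e) st
        (State (nmem st) (upd (rmem st) (neval a st) (reval e st))
               (clock st).+1 (drawn st) (flipped st))
  | ExecFlip a st :
      exec xs rs (Flip a) st
        (State (upd (nmem st) (neval a st) (nat_of_bool (rs (flipped st))))
               (rmem st) (clock st).+1 (drawn st) (flipped st).+1)
  | ExecSample a st :
      exec xs rs (Sample a) st
        (State (write_bits (nmem st) (neval a st) (xs (drawn st))) (rmem st)
               (clock st + n.+1)%N (drawn st).+1 (flipped st))
  | ExecSeq p q st st1 st2 :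
      exec xs rs p st st1 -> exec xs rs q st1 st2 ->
      exec xs rs (Seq p q) st st2
  | ExecIf b p q st st1 :
      exec xs rs (if beval b st then p else q) (tick st) st1 ->
      exec xs rs (If b p q) st st1
  | ExecWhileEnd b p st :
      ~~ beval b st -> exec xs rs (While b p) st (tick st)
  | ExecWhileStep b p st st1 st2 :
      beval b st -> exec xs rs p (tick st) st1 ->
      exec xs rs (While b p) st1 st2 ->
      exec xs rs (While b p) st st2.

Definition verdict (st : state) : bool := nmem st 0%N != 0%N.

Definition halts_within (A : prog) (st : state) (m t : nat) : Prop :=
  forall xs rs, exists2 st1, exec xs rs A st st1 &
    (drawn st1 <= m)%N && (clock st1 <= t)%N.

Definition tape (T : Type) (dflt : T) (m : nat) (w : 'I_m -> T) : nat -> T :=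
  fun k => if insub k is Some i then w i else dflt.

(* The probability that A halts with verdict b, over m independent samples from
   P and t independent fair coins.  It is meaningful when [halts_within A st m t]
   holds, since then the default continuation of the tapes is never read. *)
Definition verdict_prob (A : prog) (st : state) (P : distr R n) (m t : nat)
    (b : bool) : R :=
  \sum_(xs : {ffun 'I_m -> bits n})
    \sum_(rs : {ffun 'I_t -> bool} |
        `[< exists2 st1, exec (tape [ffun=> false] xs) (tape false rs) A st st1
                       & verdict st1 = b >])
      (\prod_(k < m) P (xs k)) / 2 ^+ t.

End Semantics.

(** * Description of the known Bayes net as a machine input *)

Section Input.
Variables (R : realType) (n : nat).
Implicit Types (G : dag n) (Q : distr R n).

(* The configuration of the parents of i encoded by [code]: its r-th binary
   digit is the value of the r-th smallest parent of i. *)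
Definition decode_config G (i : 'I_n) (code : nat) : bits n :=
  [ffun j : 'I_n => odd (code %/ 2 ^ #|[set l in parents G i | (l < j)%N]|)%N].

(* n, d, and then the row-major adjacency matrix, with entry 1 at row i and
   column j when j is a parent of i. *)
Definition input_nat (d : nat) G (k : nat) : nat :=
  match k with
  | 0 => n
  | 1 => d
  | k'.+2 =>
      match (insub (k' %/ n)%N : option 'I_n),
            (insub (k' %% n)%N : option 'I_n) with
      | Some i, Some j => nat_of_bool (j \in parents G i)
      | _, _ => 0
      end
  end%N.

(* eps, gamma, and then one row of length 2^d for each node i, with p_{i,a} at
   the index encoding a; a row repeats itself if i has fewer than d parents. *)
Definition input_real (d : nat) G Q (eps gamma : R) (k : nat) : R :=
  match k with
  | 0 => eps
  | 1 => gamma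
  | k'.+2 =>
      if (insub (k' %/ 2 ^ d)%N : option 'I_n) is Some i
      then cond_param G Q i (decode_config G i (k' %% 2 ^ d)%N)
      else 0
  end.

Definition input (d : nat) G Q (eps gamma : R) : state R :=
  State (input_nat d G) (input_real d G Q eps gamma) 0 0 0.

End Input.

(* Main.v *)
(* Every pair i, j that is linked in S relative to a set T of at most d nodes is
   tested for dependence given X_T on a first batch of samples, by the plug-in
   estimate of the sum over z of |p11 p00 - p10 p01| / p, where p, p00, ..., p11
   are the probabilities of X_T = z and of its four refinements by X_i and X_j.
   Nondegeneracy bounds this sum from below for Q, since otherwise replacing Q by
   its conditional product would give a close distribution under which X_i and
   X_j are independent given X_T.  If P passes, then its own structure has the
   skeleton and the colliders of S, because it has no more edges; reversing
   covered edges one at a time shows that P factors over S as well.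

   For two nets over S, the Hellinger distance and the relative entropy give
   |P - Q|^2 <= 4 V in l1 norm, with V the sum over the parental configurations
   (i, a) of Pr_P(a) (p_a - q_a)^2 / (q_a (1 - q_a)).  A second batch estimates
   every Pr_P(a) up to a factor 2, rejecting if some configuration is too rare,
   and a third one forms an unbiased U-statistic for a quantity between V / 2 and
   2 V.  Along a topological ordering the deviations X_i - p_{i,a} are martingale
   differences, hence uncorrelated, which controls the variance. *)

Require Import Defs.
From mathcomp Require sequences.
From mathcomp Require Import ring lra zify.
Set Implicit Arguments.
Unset Strict Implicit.
Unset Printing Implicit Defensive.
Import Order.TTheory GRing.Theory Num.Theory.
Local Open Scope ring_scope.
Local Notation expR := sequences.expR.

(** * Factorizations over a structure *)

Section Factorizations.
Variables (R : realType) (n : nat).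
Implicit Types (x y : bits n) (D : {set 'I_n}) (f g : bits n -> R).

(** [P] is not assumed balanced, so its conditional probabilities may be 0, 1 or undefined. Hence
    factorizations are expressed by normalized kernels ([factors]), and the only parameters in
    denominators are those of [Q]. The dependence statistic is 1-Lipschitz for the l1 norm, so it
    inherits the error of an empirical marginal on [4 * 2 ^ d] cells: the union bound over sets of
    cells costs [2 ^ d], the one over the [n ^ (d + 2)] tuples costs [d * log n], whence the [gamma]
    term of the sample size. The other term is the noise of the U-statistic when [P = Q]: of order
    [m * sqrt N] for the [N = n * 2 ^ d] table entries, against a threshold of order
    [m ^ 2 * eps ^ 2]. For far [P] the variance also grows with [V]; the bound on [c] keeps
    [m * V * c] large, and the bound on [C] makes all expected counts under [Q] exceed a multiple of
    [d + log n], enough for all counts to be accurate at once. As the machine neither multiplies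
    naturals nor rounds, powers and sample sizes are reached by counting; the tester is written in a
    structured language with an exact cost semantics, then compiled. *)

Definition flip (i : 'I_n) x : bits n :=
  [ffun k => if k == i then ~~ x k else x k].

Lemma flipE i x k : flip i x k = if k == i then ~~ x k else x k.
Proof. by rewrite ffunE. Qed.

Lemma flipK i : involutive (flip i).
Proof.
by move=> x; apply/ffunP => k; rewrite !flipE; case: eqP => _; rewrite ?negbK.
Qed.

Lemma flipC i j x : flip i (flip j x) = flip j (flip i x).
Proof. by apply/ffunP => k; rewrite !flipE; case: eqP; case: eqP. Qed.

Lemma sum_flip i f : \sum_x f (flip i x) = \sum_x f x.
Proof.
rewrite [RHS](reindex_inj (can_inj (flipK i))); exact: eq_bigr.
Qed.

Definition dep (D : {set 'I_n}) (f : bits n -> R) :=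
  forall x y, (forall k, k \in D -> x k = y k) -> f x = f y.

Lemma depS D D' f : D \subset D' -> dep D f -> dep D' f.
Proof. by move=> /subsetP sub df x y xy; apply: df => k /sub /xy. Qed.

Lemma dep_flip D f i x : i \notin D -> dep D f -> f (flip i x) = f x.
Proof.
move=> iD df; apply: df => k kD; rewrite flipE; case: eqP => // ki.
by rewrite ki (negbTE iD) in kD.
Qed.

Lemma depM D f g : dep D f -> dep D g -> dep D (fun x => f x * g x).
Proof. by move=> df dg x y xy; rewrite (df x y) // (dg x y). Qed.

(** Normalized kernels take the place of conditional probabilities, which are undefined on parental
    configurations of probability zero. Summing a kernel over the value of its own node is the
    two-term sum over [x] and [flip i x]. *)
Definition factors (pa : 'I_n -> {set 'I_n}) (P : bits n -> R)
    (phi : 'I_n -> bits n -> R) :=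
  [/\ forall i x, 0 <= phi i x, forall i, dep (i |: pa i) (phi i),
      forall i x, phi i x + phi i (flip i x) = 1
    & forall x, P x = \prod_i phi i x].

Section SumOut.
Variables (pa : 'I_n -> {set 'I_n}) (s : {perm 'I_n}).
Variables (P : bits n -> R) (phi : 'I_n -> bits n -> R).
Hypothesis topo : forall i j, j \in pa i -> (s j < s i)%N.
Hypothesis fac : factors pa P phi.

Definition before (p : nat) : {set 'I_n} := [set k | (s k < p)%N].

Definition prefix_prod (p : nat) x := \prod_(i | (s i < p)%N) phi i x.

Lemma phi_dep_before p i : (s i < p)%N -> dep (before p) (phi i).
Proof.
case: fac => _ dphi _ _ ip; apply: depS (dphi i).
apply/subsetP => k; rewrite !inE => /orP[/eqP -> //|/topo ki].
exact: ltn_trans ki ip.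
Qed.

Lemma prefix_prod_dep p : dep (before p) (prefix_prod p).
Proof. by move=> x y xy; apply: eq_bigr => i ip; apply: (phi_dep_before ip). Qed.

Lemma prefix_prodS (i : 'I_n) x :
  prefix_prod (s i).+1 x = prefix_prod (s i) x * phi i x.
Proof.
rewrite /prefix_prod (bigD1 i) //= mulrC; congr (_ * _).
apply: eq_bigl => j; rewrite ltnS leq_eqVlt.
have -> : (s j == s i :> nat) = (j == i) by rewrite val_eqE (inj_eq perm_inj).
by case: eqP => [->|_]; rewrite ?ltnn ?andbT //= andbF.
Qed.

Lemma sum_halves (j : 'I_n) f g : (forall x, f (flip j x) = f x) ->
  \sum_x f x * g x = 2^-1 * \sum_x f x * (g x + g (flip j x)).
Proof.
move=> fj; have e : \sum_x f x * g x = \sum_x f x * g (flip j x).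
  by rewrite -(sum_flip j (fun x => f x * g x)); apply: eq_bigr => x _; rewrite fj.
have -> : \sum_x f x * (g x + g (flip j x)) = (\sum_x f x * g x) * 2.
  by rewrite mulrDr mulr1 [X in _ = _ + X]e -big_split; apply: eq_bigr => x _ /=; rewrite mulrDr.
by rewrite mulrCA mulVf ?mulr1 // pnatr_eq0.
Qed.

(** Node [j] is summed out by pairing [x] with [flip j x]. The sums still range over the whole cube,
    so a coordinate that has disappeared leaves a factor 1/2. *)
Lemma sum_prefixS (j : 'I_n) f : dep (before (s j)) f ->
  \sum_x prefix_prod (s j).+1 x * f x = 2^-1 * \sum_x prefix_prod (s j) x * f x.
Proof.
move=> df; have jn : j \notin before (s j) by rewrite inE ltnn.
rewrite (eq_bigr (fun x => (prefix_prod (s j) x * f x) * phi j x)); last first.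
  by move=> x _; rewrite prefix_prodS mulrAC.
rewrite (@sum_halves j (fun x => prefix_prod (s j) x * f x)) => [|x]; last first.
  by rewrite /= (dep_flip x jn df) (dep_flip x jn (@prefix_prod_dep _)).
by congr (_ * _); apply: eq_bigr => x _; case: fac => _ _ -> _; rewrite mulr1.
Qed.

(** The nodes at positions from [p] on are summed out, last one first. The constant is a power of
    1/2; it is left existential because the sums to which this is applied vanish. *)
Lemma sum_out p f : (p <= n)%N -> dep (before p) f ->
  exists c : R, \sum_x P x * f x = c * \sum_x prefix_prod p x * f x.
Proof.
move=> pn; rewrite -(subKn pn); elim: (n - p)%N (leq_subr p n) => {pn p} [|k IH] kn df.
  exists 1; rewrite mul1r; apply: eq_bigr => x _; congr (_ * _).
  by case: fac => _ _ _ ->; apply: eq_bigl => i; rewrite subn0 ltn_ord.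
have kn' : (n - k.+1 < n)%N by lia.
pose j := (s^-1%g) (Ordinal kn').
have sj : s j = (n - k.+1)%N :> nat by rewrite permKV.
have [|c ->] := IH (ltnW kn).
  by apply: depS df; apply/subsetP => i; rewrite !inE; lia.
exists (c / 2); rewrite -mulrA; congr (_ * _).
by rewrite (_ : (n - k)%N = (s j).+1); [rewrite sum_prefixS ?sj | lia].
Qed.

(* The conditional probability that coordinate i is 1, given its parents. *)
Definition par_prob (i : 'I_n) x : R := phi i (if x i then x else flip i x).

Lemma par_prob_flip i x : par_prob i (flip i x) = par_prob i x.
Proof. by rewrite /par_prob flipE eqxx flipK; case: (x i). Qed.

Lemma phiE i x : phi i x = if x i then par_prob i x else 1 - par_prob i x.
Proof.
rewrite /par_prob; case: (x i) => //; have [_ _ h _] := fac.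
by rewrite -(h i x) addrK.
Qed.

Lemma par_prob_dep i : i \notin pa i -> dep (pa i) (par_prob i).
Proof.
move=> ipa x y xy; rewrite /par_prob; case: fac => _ d _ _; apply: d => k.
rewrite !inE => /orP[/eqP ->|kp].
  by case xi: (x i); case yi: (y i); rewrite ?flipE ?eqxx ?xi ?yi.
have ki : (k == i) = false by apply: contraNF ipa => /eqP ki; rewrite -{1}ki.
case: (x i); case: (y i); rewrite /= ?flipE ?ki; exact: xy.
Qed.

Lemma pa_irr i : i \notin pa i.
Proof. by apply/negP => /topo; rewrite ltnn. Qed.

Lemma par_prob_ge0 i x : 0 <= par_prob i x.
Proof. by case: fac => h _ _ _; exact: h. Qed.

Lemma par_prob_le1 i x : par_prob i x <= 1.
Proof.
have := phiE i (if x i then flip i x else x).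
case: fac => p0 _ _ _; case xi: (x i); rewrite ?flipE ?eqxx ?xi /= ?par_prob_flip.
  by move=> e; have := p0 i (flip i x); rewrite e subr_ge0.
by move=> e; have := p0 i x; rewrite e subr_ge0.
Qed.

(** Once the later nodes are summed out, the terms at [x] and [flip j x] cancel:
    [p * (1 - p) - (1 - p) * p = 0], where [p] depends on the parents alone. The local Markov
    property, the chi-square identity and the orthogonality of the noise of distinct nodes all come
    from this. *)
Lemma martingale (j : 'I_n) f : dep (before (s j)) f ->
  \sum_x P x * (f x * ((x j)%:R - par_prob j x)) = 0.
Proof.
move=> df; have jn : j \notin before (s j) by rewrite inE ltnn.
have pdep : dep (before (s j)) (par_prob j).
  by apply: depS (par_prob_dep (pa_irr j)); apply/subsetP => k /topo; rewrite inE.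
have sub : before (s j) \subset before (s j).+1.
  by apply/subsetP => k; rewrite !inE; lia.
have [|c ->] := @sum_out (s j).+1 (fun x => f x * ((x j)%:R - par_prob j x)) (ltn_ord _).
  move=> x y xy; have xy' k : k \in before (s j) -> x k = y k.
    by move=> /(subsetP sub); apply: xy.
  by rewrite (df x y) // (pdep x y) // (xy j) // inE.
rewrite (eq_bigr (fun x => (prefix_prod (s j) x * f x) *
    (phi j x * ((x j)%:R - par_prob j x)))) => [|x _]; last first.
  by rewrite prefix_prodS; ring.
rewrite (@sum_halves j (fun x => prefix_prod (s j) x * f x)) => [|x]; last first.
  by rewrite /= (dep_flip x jn df) (dep_flip x jn (@prefix_prod_dep _)).
rewrite big1 ?mulr0 // => x _; rewrite !phiE par_prob_flip !flipE eqxx.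
by case: (x j) => /=; ring.
Qed.

End SumOut.
End Factorizations.

(** * From the Markov property of a Bayes net to a factorization into kernels *)

Section BayesNetFactors.
Variables (R : realType) (n : nat).
Implicit Types (P : distr R n) (x y : bits n) (E F : {set bits n}).

Lemma in_cyl (T : {set 'I_n}) x y : reflect (forall j, j \in T -> y j = x j) (y \in cyl T x).
Proof.
rewrite inE; apply: (iffP forallP) => h j.
  by move=> jT; have := h j; rewrite jT => /eqP.
by apply/implyP => /h ->.
Qed.

Lemma Pr_ge0 P E : 0 <= Pr P E.
Proof. by apply: sumr_ge0 => x _; apply: pmf_ge0. Qed.

Lemma PrE P E : Pr P E = \sum_x P x * (x \in E)%:R.
Proof.
rewrite /Pr [LHS]big_mkcond /=; apply: eq_bigr => x _.
by case: (x \in E); rewrite ?mulr1 ?mulr0.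
Qed.

Lemma Pr_coord P (i : 'I_n) b E :
  Pr P (coord i b :&: E) + Pr P (coord i (~~ b) :&: E) = Pr P E.
Proof.
rewrite !PrE -big_split; apply: eq_bigr => x _ /=; rewrite !inE -mulrDr.
by case: (x i); case: b; case: (x \in E); rewrite /= ?addr0 ?add0r.
Qed.

Lemma subset_Pr P E F : E \subset F -> Pr P E <= Pr P F.
Proof.
move=> /subsetP sub; rewrite !PrE; apply: ler_sum => x _.
apply: ler_wpM2l; first exact: pmf_ge0.
by case xE: (x \in E); [rewrite (sub _ xE) | rewrite ler0n].
Qed.

Lemma Pr_setT P : Pr P setT = 1.
Proof. by rewrite -(pmf_sum1 P) /Pr; apply: eq_bigl => x; rewrite inE. Qed.

Section Chain.
Variables (G : dag n) (P : distr R n) (s : {perm 'I_n}).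
Hypothesis topo : topological G s.
Hypothesis markov : forall (i : 'I_n) x y,
  (forall j, j \in parents G i -> x j = y j) ->
  Pr P (cyl (preds s i) x) != 0 -> Pr P (cyl (preds s i) y) != 0 ->
  cPr P (coord i true) (cyl (preds s i) x) =
  cPr P (coord i true) (cyl (preds s i) y).

(** A history of positive probability that agrees with [x] on the parents of [i]. The choice depends
    on [x] only through those parents, which gives [net_factor] the right scope; the Markov property
    makes the choice harmless. *)
Let rep (i : 'I_n) x : option (bits n) :=
  [pick y : bits n | [forall j in parents G i, y j == x j] && (Pr P (cyl (preds s i) y) != 0)].

(* Where the parental configuration has probability zero, the factor is arbitrary. *)
Definition net_factor (i : 'I_n) x : R :=
  if rep i x is Some y then cPr P (coord i (x i)) (cyl (preds s i) y) else 2^-1.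

Let prefix p x := Pr P (cyl (before s p) x).

Lemma cPr_coord (i : 'I_n) b E : Pr P E != 0 ->
  cPr P (coord i (~~ b)) E = 1 - cPr P (coord i b) E.
Proof.
move=> E0; rewrite /cPr; apply: (mulIf E0).
by rewrite mulrBl !mulfVK // mul1r -(Pr_coord P i b E) addrAC subrr add0r.
Qed.

Lemma prefixS i x : prefix (s i).+1 x = prefix (s i) x * net_factor i x.
Proof.
have E : cyl (before s (s i).+1) x = coord i (x i) :&: cyl (before s (s i)) x.
  apply/setP => y; rewrite in_setI; apply/in_cyl/andP => [h|[yi /in_cyl h] j].
    split; first by rewrite inE h ?inE.
    by apply/in_cyl => j; rewrite inE => js; apply: h; rewrite inE; lia.
  rewrite inE ltnS leq_eqVlt (_ : (s j == s i :> nat) = (j == i)); last first.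
    by rewrite val_eqE (inj_eq perm_inj).
  by case/orP => [/eqP ->|js]; [apply/eqP; rewrite inE in yi | apply: h; rewrite inE].
have [p0|p0] := eqVneq (prefix (s i) x) 0.
  rewrite p0 mul0r; apply/eqP; rewrite eq_le Pr_ge0 andbT -p0 /prefix E.
  by rewrite subset_Pr // subsetIr.
rewrite /net_factor /rep; case: pickP => [y /andP[/forallP xy y0]|/(_ x)]; last first.
  by rewrite /= p0 andbT => /forallP; case=> j; rewrite eqxx implybT.
have e : cPr P (coord i (x i)) (cyl (preds s i) y) =
         cPr P (coord i (x i)) (cyl (preds s i) x).
  have et : cPr P (coord i true) (cyl (preds s i) y) =
            cPr P (coord i true) (cyl (preds s i) x).
    by apply: markov => // j jp; have := xy j; rewrite jp => /eqP.
  by case: (x i) => //; rewrite -[false]/(~~ true) !cPr_coord ?et.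
by rewrite e /cPr mulrC mulfVK // /prefix E.
Qed.

Lemma net_factors : factors G P net_factor.
Proof.
split=> [i x|i x y xy|i x|x].
- rewrite /net_factor; case: (rep i x) => [y|]; last by rewrite invr_ge0 ler0n.
  by rewrite divr_ge0 ?Pr_ge0.
- rewrite /net_factor (_ : rep i x = rep i y) ?(xy i) ?setU11 //.
  apply: eq_pick => z; congr (_ && _); apply/eq_forallb => j.
  by case jp: (j \in parents G i) => //=; rewrite xy // inE jp orbT.
- rewrite /net_factor (_ : rep i (flip i x) = rep i x); last first.
    apply: eq_pick => z; congr (_ && _); apply/eq_forallb => j.
    case jp: (j \in parents G i) => //=; rewrite flipE; case: (j =P i) => // ji.
    by have := topo jp; rewrite ji ltnn.
  rewrite flipE eqxx /rep; case: pickP => [y /andP[_ y0]|_].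
    by rewrite cPr_coord // addrC subrK.
  by field.
have pre p : (p <= n)%N -> prefix p x = \prod_(i | (s i < p)%N) net_factor i x.
  elim: p => [_|p IH pn].
    rewrite big_pred0 // /prefix -(Pr_setT P); congr (Pr P _).
    by apply/setP => y; rewrite in_setT; apply/in_cyl => j; rewrite inE.
  pose i := (s^-1%g) (Ordinal pn).
  have si : s i = p :> nat by rewrite permKV.
  rewrite -[X in prefix X.+1]si prefixS si IH 1?ltnW // [RHS](bigD1 i) ?si //= mulrC.
  congr (_ * _); apply: eq_bigl => j; rewrite ltnS [in RHS]leq_eqVlt.
  have -> : (s j == p :> nat) = (j == i) by rewrite -si val_eqE (inj_eq perm_inj).
  by case: eqP => [->|_]; rewrite ?si ?ltnn ?andbT //= andbF.
have := pre n (leqnn _); rewrite (eq_bigl xpredT) => [<-|i]; last by rewrite ltn_ord.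
rewrite /prefix /Pr (big_pred1 x) // => y /=; apply/in_cyl/eqP => [h|-> //].
by apply/ffunP => j; apply: h; rewrite inE ltn_ord.
Qed.

End Chain.

Lemma bayes_net_factors (G : dag n) P : bayes_net G P ->
  exists2 s : {perm 'I_n}, topological G s & exists phi, factors G P phi.
Proof. by case=> s ts mk; exists s => //; exists (net_factor G P s); apply: net_factors. Qed.

End BayesNetFactors.

(** * Markov equivalence of orderings of a common skeleton *)

Section MarkovEquivalence.
Variables (R : realType) (n : nat) (P : bits n -> R).
Variable adj : rel 'I_n.
Hypothesis adj_sym : symmetric adj.
Hypothesis adj_irr : irreflexive adj.
Implicit Types s t : {perm 'I_n}.

Definition orient s (j : 'I_n) : {set 'I_n} := [set i | adj i j && (s i < s j)%N].

Definition collider s (i j k : 'I_n) := (s i < s k)%N && (s j < s k)%N.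

(** The colliders compared are the unshielded ones (v-structures), which for a common skeleton are
    the classical criterion of Markov equivalence. *)
Definition same_colliders s t := forall i j k, i != j -> ~~ adj i j ->
  adj i k -> adj j k -> collider s i j k = collider t i j k.

Lemma eq_factors pa pa' phi : (forall i, pa i = pa' i) ->
  factors pa P phi -> factors pa' P phi.
Proof. by move=> e [h1 h2 h3 h4]; split=> // i; rewrite -e. Qed.

(** Bayes' rule for the edge from [v] to [u]: [m] is the kernel of [u] once [v] is summed out, and
    [v] receives its posterior given [u]. Where [m] is 0 the posterior is undefined, and 1/2 keeps
    the kernel normalized. *)
Definition covered_factor (phi : 'I_n -> bits n -> R) (v u k : 'I_n) (x : bits n) : R :=
  let m := phi v x * phi u x + phi v (flip v x) * phi u (flip v x) in
  if k == u then m else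
  if k == v then if m == 0 then 2^-1 else phi v x * phi u x / m else phi k x.

Lemma reverse_covered_edge (pa pa' : 'I_n -> {set 'I_n}) phi (v u : 'I_n) : v != u ->
  v \notin pa v -> u \notin pa u -> u \notin pa v ->
  pa u = v |: pa v -> pa' u = pa v -> pa' v = u |: pa v ->
  (forall k, k != u -> k != v -> pa' k = pa k) ->
  factors pa P phi -> factors pa' P (covered_factor phi v u).
Proof.
move=> vu vv uu uv pau pau' pav' pak [ge0 dphi norm Pphi].
have uneq : (u == v) = false by rewrite eq_sym (negbTE vu).
have dv : dep (v |: pa v) (phi v) by exact: dphi.
have du : dep (u |: (v |: pa v)) (phi u) by rewrite -pau; exact: dphi.
have vfu x : phi v (flip u x) = phi v x.
  by apply: dep_flip dv; rewrite !inE negb_or uv uneq.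
pose m x := phi v x * phi u x + phi v (flip v x) * phi u (flip v x).
have m_ge0 x : 0 <= m x by rewrite addr_ge0 ?mulr_ge0.
have mflip x : m (flip v x) = m x by rewrite /m flipK addrC.
(* [m] is invariant under [flip v], so [x] and [y] may be assumed to agree at [v]. *)
have md : dep (u |: pa v) m.
  have key (x y : bits n) : x v = y v -> (forall k, k \in u |: pa v -> x k = y k) -> m x = m y.
    move=> xv xy; have xy' k : k \in u |: (v |: pa v) -> x k = y k.
      by rewrite !inE => /or3P[/eqP -> | /eqP -> // | kv]; apply: xy; rewrite !inE ?eqxx ?kv ?orbT.
    have xy'' k : k \in v |: pa v -> x k = y k by move=> kk; apply: xy'; rewrite inE kk orbT.
    have fl k : x k = y k -> flip v x k = flip v y k by rewrite !flipE => ->.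
    by rewrite /m (dv x y) // (du x y) // (dv (flip v x) (flip v y)) ?(du (flip v x) (flip v y)) //
      => k kk; apply: fl; auto.
  move=> x y xy; have [xv|xv] := boolP (x v == y v); first by apply: key => //; apply/eqP.
  rewrite -(mflip y); apply: key => [|k kk].
    by rewrite flipE eqxx; case: (x v) (y v) xv => [] [].
  rewrite flipE; case: eqP => [kv|_]; last exact: xy.
  by move: kk; rewrite kv !inE (negbTE vu) (negbTE vv).
have norm_m x : m x + m (flip u x) = 1.
  rewrite /m (flipC v u) !vfu addrACA -!mulrDr !norm !mulr1.
  exact: norm.
split=> [i x|i|i x|x].
- rewrite /covered_factor -/(m x); do 2 (case: eqP => // _); case: eqP => // _.
    by rewrite invr_ge0 ler0n.
  by rewrite divr_ge0 ?mulr_ge0.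
- have [->|iu] := eqVneq i u.
    rewrite pau' => x y xy; rewrite /covered_factor eqxx; exact: md.
  have [->|iv] := eqVneq i v; last first.
    rewrite pak // => x y xy; rewrite /covered_factor (negbTE iu) (negbTE iv); exact: dphi.
  rewrite pav' => x y xy; rewrite /covered_factor (negbTE vu) eqxx -/(m x) -/(m y).
  rewrite (md x y) => [|k kk]; last by apply: xy; rewrite inE kk orbT.
  rewrite (dv x y) ?(du x y) // => k kk; apply: xy; move: kk; rewrite !inE.
    by case/or3P=> ->; rewrite ?orbT.
  by case/orP=> ->; rewrite ?orbT.
- have [->|iu] := eqVneq i u.
    rewrite /covered_factor eqxx; exact: norm_m.
  have [->|iv] := eqVneq i v; last by rewrite /covered_factor (negbTE iu) (negbTE iv).
  rewrite /covered_factor (negbTE vu) eqxx -/(m x) -/(m (flip v x)) mflip.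
  case: eqP => [_|/eqP m0]; first by field.
  by rewrite -mulrDl mulfV.
rewrite Pphi (bigD1 u) //= (bigD1 v) //= [RHS](bigD1 u) //= [X in _ = _ * X](bigD1 v) //= !mulrA.
congr (_ * _); last first.
  by apply: eq_bigr => k /andP[ku kv]; rewrite /covered_factor (negbTE ku) (negbTE kv).
rewrite /covered_factor !eqxx (negbTE vu) -/(m x); case: eqP => [m0|/eqP m0]; last first.
  by rewrite mulrCA mulfV // mulr1 mulrC.
rewrite m0 mul0r; apply/eqP; rewrite mulrC eq_le mulr_ge0 // andbT.
by rewrite -m0 /m lerDl mulr_ge0.
Qed.

Definition inversions s t : {set 'I_n * 'I_n} :=
  [set e | (t e.1 < t e.2)%N && (s e.2 < s e.1)%N].

(* Sorting the ordering t into the ordering s by swapping first descents only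
   ever reverses covered edges: the elements of t up to a first descent
   (v, u) are increasing for s, so that v comes last among them in s. *)
Lemma factors_equiv s t phi : same_colliders s t ->
  factors (orient t) P phi -> exists phi', factors (orient s) P phi'.
Proof.
move: {2}#|_| (erefl #|inversions s t|) => N.
elim/ltn_ind: N t phi => N IH t phi eN col fac.
have [inv0|[[v0 u0]]] := set_0Vmem (inversions s t).
  exists phi; apply: eq_factors fac => j; apply/setP => i; rewrite !inE.
  case aij: (adj i j) => //=; have ij : i != j.
    by apply/eqP => e; rewrite e adj_irr in aij.
  have sij : s i != s j :> nat by rewrite val_eqE (inj_eq perm_inj).
  have tij : t i != t j :> nat by rewrite val_eqE (inj_eq perm_inj).
  have := in_set0 (i, j); rewrite -inv0 inE /= => /negbT e1.
  have := in_set0 (j, i); rewrite -inv0 inE /= => /negbT e2; lia.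
rewrite inE /= => /andP[tvu0 svu0].
pose bad u := [exists v, (t v < t u)%N && (s u < s v)%N].
have bad0 : bad u0 by apply/existsP; exists v0; rewrite tvu0.
case: (arg_minnP (fun u => nat_of_ord (t u)) bad0) => u /existsP[w /andP[twu swu]] umin.
have tu0 : (0 < t u)%N by lia.
have tun : ((t u).-1 < n)%N by have := ltn_ord (t u); lia.
pose v := (t^-1%g) (Ordinal tun).
have tv : t u = (t v).+1 :> nat by rewrite permKV /= prednK.
have injE (q : {perm 'I_n}) (a b : 'I_n) : (q a == q b :> nat) = (a == b) by rewrite val_eqE (inj_eq (@perm_inj _ q)).
(* By minimality of [u] there is no descent up to [v] in [t], so [v] is last for [s] among the nodes
   up to [v] in [t]. *)
have vmax k : (t k <= t v)%N -> (s k <= s v)%N.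
  move=> tk; rewrite leqNgt; apply/negP => svk.
  have : ~~ bad v by apply/negP => /umin; rewrite tv ltnn.
  case/existsP; exists k; rewrite svk andbT ltn_neqAle tk andbT injE.
  by apply/eqP => e; rewrite e ltnn in svk.
have svu : (s u < s v)%N by apply: leq_trans swu (vmax _ _); rewrite -ltnS -tv.
have vu : v != u by apply/eqP => e; rewrite e ltnn in svu.
have between k : k != v -> k != u -> ((t k < t v)%N = (t k < t u)%N).
  by rewrite -(injE t k v) -(injE t k u) tv; lia.
pose t' := (tperm v u * t)%g.
have t'v : t' v = t u by rewrite permM tpermL.
have t'u : t' u = t v by rewrite permM tpermR.
have t'k k : k != v -> k != u -> t' k = t k.
  by move=> kv ku; rewrite permM tpermD // eq_sym.
have ordE a b : (a, b) != (u, v) -> (a, b) != (v, u) -> (t' a < t' b)%N = (t a < t b)%N.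
  have t'E c : t' c = (if c == v then t u else if c == u then t v else t c) :> nat.
    by case: (c =P v) => [->|/eqP cv]; [|case: (c =P u) => [->|/eqP cu]]; rewrite ?t'v ?t'u ?t'k.
  rewrite !xpair_eqE !t'E -(injE t a v) -(injE t a u) -(injE t b v) -(injE t b u) tv.
  by repeat case: ifP; lia.
have ltnSSn k : (k.+1 < k)%N = false by lia.
have neq_adj a b : adj a b -> a != b by apply: contraTneq => ->; rewrite adj_irr.
(* Otherwise [w'] and [u] would form an unshielded collider at [v] for [s], whereas for [t] the node
   [u] comes after [v]. *)
have children w' : adj w' v -> (t w' < t v)%N -> adj v u -> adj w' u.
  move=> aw tw avu; apply/negPn/negP => nwu.
  have w'u : w' != u by apply/eqP => e; rewrite e tv ltnSSn in tw.
  have := col w' u v w'u nwu aw; rewrite (adj_sym u) => /(_ avu).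
  have sw : (s w' < s v)%N.
    by rewrite ltn_neqAle vmax ?(ltnW tw) // andbT injE neq_adj.
  by rewrite /collider svu sw tw tv ltnSSn.
have col' : same_colliders s t'.
  move=> i j k ij nij ik jk; rewrite col // /collider.
  have nuv a b : adj a b -> ~~ ((a == u) && (b == v)) -> ~~ ((a == v) && (b == u)) ->
    (t' a < t' b)%N = (t a < t b)%N by move=> _ ? ?; apply: ordE.
  have key i' j' : i' != j' -> ~~ adj i' j' -> adj i' k -> adj j' k -> i' = v -> k = u ->
    (t i' < t k)%N && (t j' < t k)%N = (t' i' < t' k)%N && (t' j' < t' k)%N.
    move=> i'j' nij' ik' jk' ev eu; subst i' k; rewrite t'v t'u tv ltnSn ltnSSn /=.
    by have := col v j' u i'j' nij' ik' jk'; rewrite /collider tv ltnSn ltnNge (ltnW svu) /= => <-.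
  have key2 i' j' : i' != j' -> ~~ adj i' j' -> adj i' k -> adj j' k -> i' = u -> k = v ->
    (t i' < t k)%N && (t j' < t k)%N = (t' i' < t' k)%N && (t' j' < t' k)%N.
    move=> i'j' nij' ik' jk' eu ev; subst i' k; rewrite t'v t'u tv ltnSn ltnSSn /=; apply/esym/negbTE/negP.
    have j'v : j' != v := neq_adj _ _ jk'.
    have j'u : j' != u by rewrite eq_sym.
    rewrite t'k // -tv -between // => tj.
    by move: nij'; rewrite adj_sym children // adj_sym.
  have [/andP[/eqP iv /eqP ku]|n1] := boolP ((i == v) && (k == u)); first exact: key.
  have [/andP[/eqP iv /eqP ku]|n2] := boolP ((i == u) && (k == v)); first exact: key2.
  have [/andP[/eqP iv /eqP ku]|n3] := boolP ((j == v) && (k == u)).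
    by rewrite andbC [RHS]andbC; apply: key => //; rewrite 1?eq_sym 1?adj_sym.
  have [/andP[/eqP iv /eqP ku]|n4] := boolP ((j == u) && (k == v)).
    by rewrite andbC [RHS]andbC; apply: key2 => //; rewrite 1?eq_sym 1?adj_sym.
  by rewrite !nuv.
have less : (#|inversions s t'| < N)%N.
  rewrite -eN; apply/proper_card/properP; split.
    apply/subsetP => [[a b]]; rewrite !inE /= => /andP[tab sab].
    rewrite sab andbT -ordE //; apply/eqP => [[ea eb]]; subst a b.
      by move: sab; rewrite ltnNge (ltnW svu).
    by move: tab; rewrite t'u t'v tv ltnSSn.
  exists (v, u); rewrite !inE /= ?tv ?ltnS ?leqnn ?svu //.
  by rewrite t'v t'u tv ltnSSn.
have or_k k : k != u -> k != v -> orient t' k = orient t k.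
  move=> ku kv; apply/setP => i; rewrite !inE ordE // xpair_eqE negb_and ?ku ?kv ?orbT //.
(* If the two nodes are not adjacent, the swap orients every edge as before and the kernels are
   kept. *)
have [avu|navu] := boolP (adj v u); last first.
  have {}fac : factors (orient t') P phi.
    apply: eq_factors fac => k; apply/setP => i; rewrite !inE.
    case aik: (adj i k) => //=; rewrite ordE //; apply: contraNneq navu => -[<- <-] //.
    by rewrite adj_sym.
  exact: (IH _ less t' phi).
apply: (IH _ less t' (covered_factor phi v u)) => //.
(* The edge is covered: [children] puts the parents of [v] among those of [u], and another parent of
   [u] not adjacent to [v] would form with [v] a collider at [u] that [s] lacks. *)
have pau : orient t u = v |: orient t v.
  apply/setP => z; rewrite !inE; have [->|zv] := eqVneq z v; first by rewrite avu tv ltnSn.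
  have [->|zu] := eqVneq z u; first by rewrite ltnn adj_irr /= tv [in RHS]ltnSSn andbF.
  rewrite between //= ; case tz: (t z < t u)%N; rewrite ?andbF // !andbT.
  apply/idP/idP => az; last by apply: children => //; rewrite between.
  apply/negPn/negP => nzv; have vz : v != z by rewrite eq_sym.
  have nvz : ~~ adj v z by rewrite adj_sym.
  have := col v z u vz nvz avu az; rewrite /collider tz tv ltnSn /= ltnNge (ltnW svu) //.
apply: reverse_covered_edge fac => //; rewrite ?inE ?adj_irr //.
- by rewrite tv ltnSSn andbF.
- apply/setP => z; rewrite !inE t'u; have [->|zv] := eqVneq z v.
    by rewrite t'v tv ltnSSn andbF adj_irr.
  have [->|zu] := eqVneq z u; first by rewrite adj_irr /= tv ltnSSn andbF.
  by have := congr1 (fun A : {set 'I_n} => z \in A) pau; rewrite !inE (negbTE zv) /= t'k // between.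
- apply/setP => z; rewrite !inE t'v; have [->|zv] := eqVneq z v.
    by rewrite t'v ltnn (negbTE vu) adj_irr.
  have [->|zu] := eqVneq z u; first by rewrite t'u adj_sym avu tv ltnSn.
  by rewrite t'k //= between.
Qed.

End MarkovEquivalence.

(** * Identifying the structure *)

Section Structure.
Variables (R : realType) (n : nat).
Implicit Types (P : distr R n) (G : dag n) (x y : bits n) (E F : {set bits n}).

Lemma cond_indep_sym P (i j : 'I_n) T : cond_indep P i j T -> cond_indep P j i T.
Proof. by move=> ci a b x x0; rewrite setIC ci // mulrC. Qed.

Section LocalMarkov.
Variables (pa : 'I_n -> {set 'I_n}) (s : {perm 'I_n}) (P : distr R n).
Variable phi : 'I_n -> bits n -> R.
Hypothesis topo : forall i j, j \in pa i -> (s j < s i)%N.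
Hypothesis fac : factors pa P phi.

(** The martingale identity applied to the indicator of [F], an event decided before [j] on which
    the parental configuration is constant. *)
Lemma Pr_par_prob (j : 'I_n) F x :
  F \subset cyl (pa j) x -> dep (before s (s j)) (fun y => (y \in F)%:R : R) ->
  Pr P (coord j true :&: F) = par_prob phi j x * Pr P F.
Proof.
move=> /subsetP sub dF; apply/eqP; rewrite -subr_eq0; apply/eqP.
rewrite -[RHS](martingale topo fac dF) !PrE mulr_sumr -sumrB; apply: eq_bigr => y _.
rewrite !inE; case yF: (y \in F); rewrite ?andbF ?mulr0 ?mul0r ?mulr0 ?subr0 //.
rewrite (par_prob_dep fac (pa_irr topo j) (_ : forall k, _ -> y k = x k)).
  by case: (y j) => /=; ring.
by move=> k kp; exact: (in_cyl _ _ _ (sub _ yF)).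
Qed.

Lemma dep_cyl_pa (j : 'I_n) x :
  dep (before s (s j)) (fun y => (y \in cyl (pa j) x)%:R : R).
Proof.
move=> y z yz; congr (nat_of_bool _)%:R; apply/in_cyl/in_cyl => h k kp.
  by rewrite -yz ?h // inE topo.
by rewrite yz ?h // inE topo.
Qed.

(** Both [E] and its intersection with the event on [X_i] are decided before [j], and on both the
    conditional probability of [X_j = 1] is the same kernel value [par_prob phi j x]. *)
Lemma local_markov (i j : 'I_n) : (s i < s j)%N -> cond_indep P i j (pa j).
Proof.
move=> sij a b x x0; set E := cyl _ _ in x0 *.
have dE : dep (before s (s j)) (fun y => (y \in E)%:R : R) by exact: dep_cyl_pa.
have dF : dep (before s (s j)) (fun y => (y \in coord i a :&: E)%:R : R).
  move=> y z yz; have := dE y z yz; rewrite !in_setI.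
  rewrite ![_ \in coord _ _]inE (yz i) ?inE //.
  by case: (z i == a).
have keyt : cPr P (coord i a :&: coord j true) E =
    cPr P (coord i a) E * cPr P (coord j true) E.
  rewrite /cPr [coord i a :&: coord j _]setIC -setIA !(@Pr_par_prob j _ x) ?subsetIr //.
  by field.
have eb b' : coord i a :&: coord j (~~ b') :&: E = coord j (~~ b') :&: (coord i a :&: E).
  by rewrite [coord i a :&: coord j _]setIC -setIA.
case: b => //; rewrite -[false]/(~~ true) cPr_coord // mulrBr mulr1 -keyt.
rewrite /cPr eb -mulrBl; congr (_ / _).
rewrite [coord i a :&: coord j true]setIC -setIA.
by rewrite -(Pr_coord P j true (coord i a :&: E)) addrAC subrr add0r.
Qed.

End LocalMarkov.

Definition adjacent G : rel 'I_n := fun i j => (i \in parents G j) || (j \in parents G i).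

Lemma dag_irr G i : i \notin parents G i.
Proof. by apply/negP => ii; have := @dag_acyclic n G [:: i]; rewrite /= andbT => /(_ ii). Qed.

Lemma skeletonP G (i j : 'I_n) : i != j -> ([set i; j] \in skeleton G) = adjacent G i j.
Proof.
move=> ij; apply/imsetP/orP => [[[a b]]|[ij'|ij']].
- rewrite inE /= => ab e.
  have ea : (i == a) || (i == b) by have := set21 i j; rewrite e !inE.
  have eb : (j == a) || (j == b) by have := set22 i j; rewrite e !inE.
  case/orP: ea ij => /eqP ->; case/orP: eb => /eqP ->; rewrite ?eqxx //; by [left | right].
- by exists (i, j); rewrite ?inE.
- by exists (j, i); rewrite ?inE //= setUC.
Qed.

(* The hypotheses force T to have the skeleton and the colliders of S. *)
Lemma structure_factors (S T : dag n) P d : bayes_net T P -> (degree T <= d)%N ->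
  (#|skeleton T| <= #|skeleton S|)%N -> (exists s, topological S s) ->
  (forall (i j : 'I_n) (A : {set 'I_n}), i != j -> (#|A| <= d)%N -> i \notin A -> j \notin A ->
     linked S A i j -> ~ cond_indep P i j A) ->
  exists phi, factors S P phi.
Proof.
move=> /bayes_net_factors[t topoT [phi facT]] degT skST [s topoS] H.
have paT j : (#|parents T j| <= d)%N.
  by apply: leq_trans degT; exact: (leq_bigmax (F := fun j => #|parents T j|)).
have ltT i j : i \in parents T j -> (t i < t j)%N by exact: topoT.
(* Non-adjacent nodes of [T] are independent given the parents of the later one, a set of at most
   [d] nodes; [H] excludes this for a linked pair, in either order of the two nodes. *)
have ci i j : (t i < t j)%N -> i \notin parents T j ->
    ~ linked S (parents T j) i j /\ ~ linked S (parents T j) j i.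
  move=> tij iT; have ij : i != j by apply: contraTneq tij => ->; rewrite ltnn.
  have c := local_markov topoT facT tij.
  split=> l; first by apply: (H i j _ ij) l c; rewrite ?dag_irr.
  by apply: (H j i _ _ _ _ _ l (cond_indep_sym c)); rewrite 1?eq_sym ?dag_irr.
have neqt (i j : 'I_n) : i != j -> (t i < t j)%N || (t j < t i)%N.
  by move=> ij; rewrite -neq_ltn; apply: contraNneq ij => /val_inj /perm_inj ->.
have sub i j : i \in parents S j -> adjacent T i j.
  move=> ij; have ineqj : i != j by apply: contraTneq ij => ->; rewrite dag_irr.
  apply/negPn/negP; rewrite negb_or => /andP[n1 n2].
  case/orP: (neqt _ _ ineqj) => tt.
    by have [h _] := ci i j tt n1; apply: h; apply: Or41.
  by have [_ h] := ci j i tt n2; apply: h; apply: Or41.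
have skE : skeleton S = skeleton T.
  apply/eqP; rewrite eqEcard skST andbT; apply/subsetP => A /imsetP[[a b]].
  rewrite inE /= => ab ->; rewrite skeletonP ?sub //.
  by apply: contraTneq ab => ->; rewrite dag_irr.
have adjE i j : adjacent S i j = adjacent T i j.
  have [->|ij] := eqVneq i j; first by rewrite /adjacent !(negbTE (dag_irr _ _)).
  by rewrite -!skeletonP // skE.
have adj_sym G : symmetric (adjacent G) by move=> i j; rewrite /adjacent orbC.
have adj_irr G : irreflexive (adjacent G) by move=> i; rewrite /adjacent orbb (negbTE (dag_irr _ _)).
have orE (G : dag n) (u : {perm 'I_n}) : topological G u ->
    forall j, parents G j = orient (adjacent G) u j.
  move=> tu j; apply/setP => i; rewrite inE /adjacent.
  case ij: (i \in parents G j) => /=; first by rewrite tu.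
  by case ji: (j \in parents G i) => //=; rewrite ltnNge ltnW ?tu.
have orST j : orient (adjacent T) t j = orient (adjacent S) t j.
  by apply/setP => i; rewrite !inE adjE.
have facT' : factors (orient (adjacent S) t) P phi.
  by apply: eq_factors facT => j; rewrite (orE _ _ topoT) orST.
suff col : same_colliders (adjacent S) s t.
  have [phi' fac'] := factors_equiv (adj_sym S) (adj_irr S) col facT'.
  by exists phi'; apply: eq_factors fac' => j; rewrite (orE _ _ topoS).
have key i j k : (t i < t j)%N -> ~~ adjacent S i j -> adjacent S i k -> adjacent S j k ->
    collider s i j k = collider t i j k.
  move=> tij nij ik jk; have iT : i \notin parents T j.
    by move: nij; rewrite adjE negb_or => /andP[].
  have [l1 l2] := ci i j tij iT.
  have pS a b : adjacent S a b -> (a \in parents S b) = (s a < s b)%N.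
    by move=> ab; rewrite (orE _ _ topoS) inE ab.
  have pT a b : adjacent S a b -> (a \in parents T b) = (t a < t b)%N.
    by move=> ab; rewrite (orE _ _ topoT) orST inE ab.
  have kj : adjacent S k j by rewrite adj_sym.
  have ki : adjacent S k i by rewrite adj_sym.
  have neq a b : adjacent S a b -> a != b by apply: contraTneq => ->; rewrite adj_irr.
  apply/idP/idP => /andP[h1 h2].
    (* If [k] were a parent of [j] in [T], conditioning on this common child in [S] would be the
       second case of [linked]. So [k] comes after [j] in [t], hence after [i]. *)
    have kT : k \notin parents T j.
      by apply/negP => kT; apply: l1; apply: Or42; exists k; rewrite // !pS // h1 h2.
    rewrite pT // -leqNgt in kT; apply/andP.
    have tjk : (t j < t k)%N by have := neqt _ _ (neq _ _ jk); rewrite [X in _ || X]ltnNge kT orbF.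
    by split=> //; apply: ltn_trans tij _.
  have kT : k \notin parents T j by rewrite pT // -leqNgt ltnW.
  (* Here [k] follows [j] in [t], so it lies outside the conditioning set; a chain or a fork at [k]
     in [S] would be the third or fourth case of [linked]. *)
  apply/negPn/negP; rewrite negb_and => h.
  have neqs (a b : 'I_n) : a != b -> (s a < s b)%N || (s b < s a)%N.
    by move=> ab; rewrite -neq_ltn; apply: contraNneq ab => /val_inj /perm_inj ->.
  have := neqs _ _ (neq _ _ ik); have := neqs _ _ (neq _ _ jk).
  rewrite -!pS // in h *; case jk': (j \in parents S k) h => /=; case ik': (i \in parents S k) => //=.
  - by move=> _ _ ki'; apply: l2; apply: Or43; exists k; rewrite // jk'.
  - by move=> _ kj' _; apply: l1; apply: Or43; exists k; rewrite // ik'.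
  - by move=> _ kj' ki'; apply: l1; apply: Or44; exists k; rewrite // ki' kj'.
move=> i j k ij nij ik jk; case/orP: (neqt _ _ ij) => tt; first exact: key.
by rewrite /collider andbC [RHS]andbC; apply: key => //; rewrite adj_sym.
Qed.

End Structure.

(** * Independent samples and tail bounds *)

Section Tapes.
Variables (R : realType) (X : finType) (P : X -> R) (x0 : X).
Hypothesis P_ge0 : forall x, 0 <= P x.
Hypothesis P_sum1 : \sum_x P x = 1.
Implicit Types (w : nat -> X) (f g : (nat -> X) -> R) (h : X -> R).

Definition mean h : R := \sum_x P x * h x.

Lemma eq_mean h h' : h =1 h' -> mean h = mean h'.
Proof. by move=> e; apply: eq_bigr => x _; rewrite e. Qed.

Lemma meanD h h' : mean (fun x => h x + h' x) = mean h + mean h'.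
Proof. by rewrite -big_split; apply: eq_bigr => x _; rewrite /= mulrDr. Qed.

Lemma meanZ c h : mean (fun x => c * h x) = c * mean h.
Proof. by rewrite /mean mulr_sumr; apply: eq_bigr => x _; rewrite mulrCA. Qed.

Lemma meanZr c h : mean (fun x => h x * c) = mean h * c.
Proof. by rewrite mulrC -meanZ; apply: eq_mean => x; rewrite mulrC. Qed.

Lemma mean_sum (I : finType) (Q : pred I) (F : I -> X -> R) :
  mean (fun x => \sum_(i | Q i) F i x) = \sum_(i | Q i) mean (F i).
Proof.
by rewrite /mean exchange_big; apply: eq_bigr => x _; rewrite mulr_sumr.
Qed.

Lemma mean_cst c : mean (fun=> c) = c.
Proof. by rewrite /mean -mulr_suml P_sum1 mul1r. Qed.

Lemma le_mean h h' : (forall x, h x <= h' x) -> mean h <= mean h'.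
Proof. by move=> le; apply: ler_sum => x _; apply: ler_wpM2l. Qed.

Lemma mean_ge0 h : (forall x, 0 <= h x) -> 0 <= mean h.
Proof. by move=> ge; apply: sumr_ge0 => x _; apply: mulr_ge0. Qed.

(* The part of the tape that has not been drawn is constantly x0. *)
Fixpoint Ex (m : nat) (f : (nat -> X) -> R) : R :=
  if m is k.+1 then Ex k (fun w => mean (fun x => f (upd w k x))) else f (fun=> x0).

Lemma eq_Ex m f g : f =1 g -> Ex m f = Ex m g.
Proof.
elim: m f g => [|m IH] f g e /=; first exact: e.
by apply: IH => w; apply: eq_mean => x; apply: e.
Qed.

Lemma ExD m f g : Ex m (fun w => f w + g w) = Ex m f + Ex m g.
Proof.
elim: m f g => [|m IH] f g //=.
by rewrite -IH; apply: eq_Ex => w; rewrite meanD.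
Qed.

Lemma ExZ m c f : Ex m (fun w => c * f w) = c * Ex m f.
Proof.
elim: m f => [|m IH] f //=.
by rewrite -IH; apply: eq_Ex => w; rewrite meanZ.
Qed.

Lemma Ex_cst m c : Ex m (fun=> c) = c.
Proof. by elim: m => [|m IH] //=; rewrite -[RHS]IH; apply: eq_Ex => w; rewrite mean_cst. Qed.

Lemma Ex_sum m (I : finType) (Q : pred I) (F : I -> (nat -> X) -> R) :
  Ex m (fun w => \sum_(i | Q i) F i w) = \sum_(i | Q i) Ex m (F i).
Proof.
elim: m F => [|m IH] F //=.
by rewrite -IH; apply: eq_Ex => w; rewrite mean_sum.
Qed.

Lemma le_Ex m f g : (forall w, f w <= g w) -> Ex m f <= Ex m g.
Proof.
elim: m f g => [|m IH] f g le //=.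
by apply: IH => w; apply: le_mean => x.
Qed.

Definition cat (a : nat) (w w' : nat -> X) : nat -> X :=
  fun k => if (k < a)%N then w k else w' (k - a)%N.

(** Fubini for consecutive batches: the later batch can be analyzed with the earlier one fixed. *)
Lemma Ex_cat a b f : Ex (a + b) f = Ex a (fun w => Ex b (fun w' => f (cat a w w'))).
Proof.
elim: b f => [|b IH] f.
  rewrite addn0 /=; elim: a f => [|a IH] f /=.
    by congr f; apply/funext => k.
  rewrite IH; apply: eq_Ex => w; apply: eq_mean => x; congr f; apply/funext => k.
  rewrite /cat /upd; case: eqP => [->|ka]; rewrite ?ltnSn //.
  by have -> : (k < a.+1)%N = (k < a)%N by lia.
rewrite addnS /= IH; apply: eq_Ex => w; apply: eq_Ex => w'; apply: eq_mean => x.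
congr f; apply/funext => k; rewrite /cat /upd; case: eqP => [->|kab].
  by rewrite ltnNge leq_addr /= addKn eqxx.
by case: ltnP => // ak; case: eqP => // kb; lia.
Qed.

Lemma Ex_prod m h : Ex m (fun w => \prod_(k < m) h (w k)) = mean h ^+ m.
Proof.
elim: m => [|m IH] /=; first by rewrite big_ord0.
rewrite exprS -IH -ExZ; apply: eq_Ex => w; rewrite -meanZr; apply: eq_mean => x.
rewrite big_ord_recr /= mulrC {1}/upd eqxx; congr (_ * _); apply: eq_bigr => k _.
by rewrite /upd ltn_eqF.
Qed.

Lemma sum_ffun_recr m (F : ('I_m -> X) -> X -> R) :
  \sum_(xs : {ffun 'I_m.+1 -> X}) F (fun k => xs (widen_ord (leqnSn m) k)) (xs ord_max)
  = \sum_(ys : {ffun 'I_m -> X}) \sum_x F ys x.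
Proof.
pose dec (xs : {ffun 'I_m.+1 -> X}) : {ffun 'I_m -> X} * X :=
  ([ffun k => xs (widen_ord (leqnSn m) k)], xs ord_max).
pose enc (p : {ffun 'I_m -> X} * X) : {ffun 'I_m.+1 -> X} :=
  [ffun k : 'I_m.+1 => if insub (k : nat) is Some j then p.1 j else p.2].
have encK : cancel enc dec.
  move=> [ys x]; rewrite /dec /enc; congr pair.
    apply/ffunP => k; rewrite !ffunE /=; case: insubP => [j _ jk|]; last by rewrite ltn_ord.
    by congr (ys _); apply: val_inj.
  by rewrite ffunE insubF //= ltnn.
have decK : cancel dec enc.
  move=> xs; apply/ffunP => k; rewrite /dec /enc !ffunE /=; case: insubP => [j _ jk|].
    by rewrite ffunE; congr (xs _); apply: val_inj.
  by move=> km; congr (xs _); apply: val_inj => /=; have := ltn_ord k; lia.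
rewrite pair_big (reindex enc) /=; last by exists dec => p _; rewrite ?encK ?decK.
apply: eq_bigr => p _; have := encK p; rewrite /dec => e; have [e1 e2] := (f_equal fst e, f_equal snd e).
rewrite /= in e1 e2; rewrite e2; congr F; apply/funext => k.
by have := congr1 (fun g : {ffun 'I_m -> X} => g k) e1; rewrite ffunE.
Qed.

(** Identifies the recursive expectation with the sum over finite tapes that occurs in
    [verdict_prob]; undrawn positions hold [x0] in both. *)
Lemma Ex_tape m f :
  Ex m f = \sum_(xs : {ffun 'I_m -> X}) (\prod_(k < m) P (xs k)) * f (tape x0 xs).
Proof.
elim: m f => [|m IH] f /=.
  have all0 (xs : {ffun 'I_0 -> X}) : tape x0 xs = fun=> x0.
    by apply/funext => k; rewrite /tape insubF.
  have c1 : #|{ffun 'I_0 -> X}| = 1%N by rewrite card_ffun card_ord expn0.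
  rewrite (eq_bigr (fun=> f (fun=> x0))) => [|xs _]; last by rewrite big_ord0 mul1r all0.
  by rewrite sumr_const [#|_|]c1.
rewrite IH.
pose F (ys : 'I_m -> X) (x : X) :=
  (\prod_(k < m) P (ys k)) * P x * f (upd (tape x0 ys) m x).
transitivity (\sum_(ys : {ffun 'I_m -> X}) \sum_x F ys x).
  apply: eq_bigr => ys _; rewrite /mean mulr_sumr; apply: eq_bigr => x _.
  by rewrite mulrA.
rewrite -sum_ffun_recr; apply: eq_bigr => xs _; rewrite /F big_ord_recr /=.
congr (_ * f _); apply/funext => k; rewrite /upd /tape.
case: eqP => [->|km].
  by case: insubP => [j _ jm|]; [congr (xs _); apply: val_inj | rewrite ltnSn].
case: insubP => [j _ jk|kn].
  by case: insubP => [i _ ik|]; [congr (xs _); apply: val_inj; rewrite /= jk ik |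
    have := ltn_ord j; rewrite jk; lia].
by case: insubP => // i ki; lia.
Qed.

End Tapes.

(** * Chernoff and Hoeffding bounds for counts *)

Section Concentration.
Variables (R : realType) (X : finType) (P : X -> R) (x0 : X).
Hypothesis P_ge0 : forall x, 0 <= P x.
Hypothesis P_sum1 : \sum_x P x = 1.
Implicit Types (w : nat -> X) (b : pred X).
Local Notation mean := (mean P).
Local Notation Ex := (Ex P x0).

Lemma expR_quad (y : R) : `|y| <= 1/4 -> expR y <= 1 + y + y ^+ 2.
Proof.
rewrite ler_norml => /andP[y1 y2].
have [y0|y0] := lerP y 0.
  have h : 0 < 1 - y by lra.
  have -> : expR y = (expR (- y))^-1 by rewrite expRN invrK.
  have le : 1 - y <= expR (- y) by exact: expR_ge1Dx.
  apply: (@le_trans _ _ (1 - y)^-1); first by rewrite lef_pV2 ?posrE // (lt_le_trans h).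
  by rewrite -div1r ler_pdivrMr //; nra.
(* For positive [y] the bound [(1 - y)^-1] is too large, since
   [(1 - y) * (1 + y + y ^+ 2) = 1 - y ^+ 3]; halving the exponent gives [(1 - y / 2) ^- 2], which
   suffices up to 1/4. *)
have h : 0 < 1 - y/2 by lra.
have -> : expR y = ((expR (- (y/2))) ^+ 2)^-1.
  by rewrite -expRM_natl -expRN; congr expR; field.
have le : (1 - y/2) <= expR (- (y/2)) by exact: expR_ge1Dx.
apply: (@le_trans _ _ ((1 - y/2) ^+ 2)^-1).
  rewrite lef_pV2 ?posrE ?exprn_gt0 ?expR_gt0 //.
  by rewrite lerXn2r ?nnegrE ?expR_ge0 // ltW.
by rewrite -div1r ler_pdivrMr ?exprn_gt0 //; nra.
Qed.

Definition count b (m : nat) w : nat := \sum_(k < m) b (w k).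

Lemma markov_exp m (l a : R) (Z : (nat -> X) -> R) (E : pred (nat -> X)) :
  (forall w, E w -> a <= l * Z w) ->
  Ex m (fun w => (E w)%:R) <= expR (- a) * Ex m (fun w => expR (l * Z w)).
Proof.
move=> EZ; rewrite -ExZ; apply: le_Ex => // w; rewrite -expRD.
case Ew: (E w); last by rewrite expR_ge0.
by rewrite -[leLHS]expR0 ler_expR addrC subr_ge0 EZ.
Qed.

Lemma mean_bool01 b : 0 <= mean (fun x => (b x)%:R) <= 1.
Proof.
apply/andP; split; first by apply: mean_ge0 => // x; apply: ler0n.
by rewrite -[leRHS](mean_cst P_sum1); apply: le_mean => // x; case: (b x).
Qed.

Lemma mgf_count m b (l : R) : `|l| <= 1/4 ->
  Ex m (fun w => expR (l * (count b m w)%:R)) <=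
  expR (m%:R * mean (fun x => (b x)%:R) * (l + l ^+ 2)).
Proof.
move=> l1; set p := mean _.
have p01 := mean_bool01 b; rewrite -/p in p01.
have -> : Ex m (fun w => expR (l * (count b m w)%:R)) =
    mean (fun x => expR (l * (b x)%:R)) ^+ m.
  rewrite -(Ex_prod P x0); apply: eq_Ex => w.
  by rewrite -expR_sum -mulr_sumr /count natr_sum.
rewrite -mulrA expRM_natl; apply: lerXn2r; rewrite ?nnegrE ?expR_ge0 //.
  by apply: mean_ge0 => // x; apply: expR_ge0.
have -> : mean (fun x => expR (l * (b x)%:R)) = 1 + p * (expR l - 1).
  rewrite -[X in X + _](mean_cst P_sum1) /p -meanZr -meanD; apply: eq_mean => x.
  by case: (b x); rewrite /= ?mulr1n ?mulr0n ?mulr1 ?mulr0 ?mul0r ?expR0; ring.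
apply: (le_trans _ (expR_ge1Dx _)); rewrite lerD2l.
by apply: ler_wpM2l; [case/andP: p01 | have := expR_quad l1; lra].
Qed.

(** Exponential moments at -1/4 and 1/4: with [mp = m * p] the exponents are [mp / 8 - 3 * mp / 16]
    and [- mp / 2 + 5 * mp / 16], both at most [- mp / 16], and [mp >= T / 4]. *)
Lemma chernoff_within m b (T p : R) : 0 <= T -> p = mean (fun x => (b x)%:R) ->
  T / 4 <= m%:R * p ->
  Ex m (fun w => (~~ (m%:R * p / 2 <= (count b m w)%:R <= 2 * (m%:R * p)))%:R)
    <= 2 * expR (- (T / 64)).
Proof.
move=> T0 pE big; have p01 := mean_bool01 b; rewrite -pE in p01.
have mp0 : 0 <= m%:R * p by rewrite mulr_ge0 //; case/andP: p01.
apply: (@le_trans _ _ (Ex m (fun w => ((count b m w)%:R < m%:R * p / 2)%R%:R) +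
                       Ex m (fun w => (2 * (m%:R * p) < (count b m w)%:R)%R%:R))).
  rewrite -ExD; apply: le_Ex => // w; set c := (count b m w)%:R.
  rewrite negb_and -!ltNge.
  by case: (c < m%:R * p / 2); case: (_ < c); rewrite /= ?mulr0n ?mulr1n; lra.
have l14 : `|(-(1/4) : R)| <= 1/4 by rewrite normrN ger0_norm; lra.
have l14' : `|(1/4 : R)| <= 1/4 by rewrite ger0_norm; lra.
have e2 (e : R) : 2 * e = e + e by ring.
rewrite [leRHS]e2; apply: lerD.
  apply: le_trans (@markov_exp m (-(1/4)) (- (m%:R * p / 8))
    (fun w => (count b m w)%:R) _ _) _ => [w|]; first by move=> /=; lra.
  apply: le_trans (ler_wpM2l (expR_ge0 _) (mgf_count m b l14)) _.
  by rewrite -expRD ler_expR -pE; lra.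
apply: le_trans (@markov_exp m (1/4) (m%:R * p / 2)
  (fun w => (count b m w)%:R) _ _) _ => [w|]; first by move=> /=; lra.
apply: le_trans (ler_wpM2l (expR_ge0 _) (mgf_count m b l14')) _.
by rewrite -expRD ler_expR -pE; lra.
Qed.

(** Designed for an unknown [P], under which a configuration may be arbitrarily rare: if
    [m * p < T / 4] the count is unlikely to reach [T], and otherwise it is accurate. *)
Lemma chernoff_count m b (T p : R) : 0 <= T -> p = mean (fun x => (b x)%:R) ->
  Ex m (fun w => (~~ (((count b m w)%:R < T) ||
      (m%:R * p / 2 <= (count b m w)%:R <= 2 * (m%:R * p))))%:R)
    <= 2 * expR (- (T / 64)).
Proof.
move=> T0 pE; have p01 := mean_bool01 b; rewrite -pE in p01.
have mp0 : 0 <= m%:R * p by rewrite mulr_ge0 //; case/andP: p01.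
have [large|small] := lerP (T / 4) (m%:R * p).
  apply: le_trans (chernoff_within T0 pE large); apply: le_Ex => // w.
  by rewrite negb_or ler_nat; case: (~~ (_ < T)).
have l14' : `|(1/4 : R)| <= 1/4 by rewrite ger0_norm; lra.
apply: le_trans (@markov_exp m (1/4) (T / 4) (fun w => (count b m w)%:R) _ _) _ => [w|].
  by rewrite negb_or -leNgt => /andP[/= ? _]; lra.
apply: le_trans (ler_wpM2l (expR_ge0 _) (mgf_count m b l14')) _.
rewrite -expRD -pE; apply: (@le_trans _ _ (expR (- (T / 64)))).
  by rewrite ler_expR; lra.
by rewrite ler_peMl ?expR_ge0 // ler1n.
Qed.

(** Exponential moment at [t / 2]: the quadratic bound costs at most [t ^+ 2 / 4] per sample against
    a gain of [t ^+ 2 / 2]. *)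
Lemma hoeffding_count m b (t p : R) : 0 <= t <= 1/2 -> p = mean (fun x => (b x)%:R) ->
  Ex m (fun w => (m%:R * (p + t) <= (count b m w)%:R)%R%:R) <= expR (- (m%:R * t ^+ 2 / 4)).
Proof.
move=> /andP[t0 t1] pE; have /andP[p0 p1] := mean_bool01 b; rewrite -pE in p0 p1.
have l14 : `|t / 2| <= 1/4 by rewrite ger0_norm; lra.
have quad x : expR (t / 2 * ((b x)%:R - p)) <= 1 + t / 2 * ((b x)%:R - p) + t ^+ 2 / 4.
  apply: le_trans (expR_quad _) _.
    rewrite normrM ger0_norm ?divr_ge0 //; apply: (@le_trans _ _ (t / 2 * 1)); last by lra.
    apply: ler_wpM2l; first by lra.
    by case: (b x); rewrite /= ?mulr1n ?mulr0n ler_norml; apply/andP; split; lra.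
  have e : (t / 2) ^+ 2 = t ^+ 2 / 4 by field.
  rewrite lerD2l exprMn e; apply: ler_piMr; first by nra.
  by case: (b x); rewrite /= ?mulr1n ?mulr0n; nra.
apply: le_trans (@markov_exp m (t / 2) (m%:R * t ^+ 2 / 2)
  (fun w => (count b m w)%:R - m%:R * p) _ _) _ => [w|].
  by move=> /= h; nra.
have -> : expR (- (m%:R * t ^+ 2 / 4)) =
    expR (- (m%:R * t ^+ 2 / 2)) * expR (m%:R * (t ^+ 2 / 4)).
  by rewrite -expRD; congr expR; field.
apply: ler_wpM2l; first exact: expR_ge0.
have -> : Ex m (fun w => expR (t / 2 * ((count b m w)%:R - m%:R * p))) =
    mean (fun x => expR (t / 2 * ((b x)%:R - p))) ^+ m.
  rewrite -(Ex_prod P x0); apply: eq_Ex => w; rewrite -expR_sum -mulr_sumr sumrB /count natr_sum.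
  by rewrite sumr_const card_ord mulr_natl.
rewrite expRM_natl; apply: lerXn2r; rewrite ?nnegrE ?expR_ge0 //.
  by apply: mean_ge0 => // x; apply: expR_ge0.
apply: (le_trans _ (expR_ge1Dx _)).
apply: le_trans (le_mean P_ge0 quad) _.
rewrite !meanD meanZ !mean_cst // meanD mean_cst // -pE.
by lra.
Qed.

End Concentration.

(** * The U-statistic *)

Section UStatistic.
Variables (R : realType) (X : finType) (P : X -> R) (x0 : X).
Hypothesis P_ge0 : forall x, 0 <= P x.
Hypothesis P_sum1 : \sum_x P x = 1.
Local Notation mean := (mean P).
Local Notation Ex := (Ex P x0).
Variables (A : finType) (wt : A -> R).
Implicit Types (w : nat -> X) (g : A -> X -> R).

Definition tsum (h : X -> R) (t : nat) w : R := \sum_(s < t) h (w s).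

(** A U-statistic of order two with kernel [\sum_a wt a * g a x * g a y], summed over pairs of
    samples. Grouping the pairs by their later member lets one pass with partial sums compute it. *)
Definition ustat g (t : nat) w : R :=
  \sum_(s < t) \sum_a wt a * (g a (w s) * tsum (g a) s w).

Lemma tsum_upd h t w m x : (t <= m)%N -> tsum h t (upd w m x) = tsum h t w.
Proof.
move=> tm; apply: eq_bigr => s _; rewrite /upd ltn_eqF //.
exact: leq_trans (ltn_ord s) tm.
Qed.

Lemma tsumS h t w : tsum h t.+1 w = tsum h t w + h (w t).
Proof. by rewrite /tsum big_ord_recr. Qed.

Lemma ustat_upd g t w m x : (t <= m)%N -> ustat g t (upd w m x) = ustat g t w.
Proof.
move=> tm; apply: eq_bigr => s _; apply: eq_bigr => a _.
have sm := leq_trans (ltn_ord s) tm.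
by rewrite tsum_upd 1?ltnW // /upd ltn_eqF.
Qed.

Lemma ustatS g t w : ustat g t.+1 w = ustat g t w + \sum_a wt a * (g a (w t) * tsum (g a) t w).
Proof. by rewrite /ustat big_ord_recr. Qed.

Lemma Ex_tsumM h h' m : mean h = 0 -> mean h' = 0 ->
  Ex m (fun w => tsum h m w * tsum h' m w) = m%:R * mean (fun x => h x * h' x).
Proof.
move=> h0 h0'; elim: m => [|m IH].
  by rewrite /= /tsum !big_ord0 !mul0r.
rewrite /= mulrSr mulrDl mul1r -IH -[X in _ + X](Ex_cst x0 P_sum1 m) -ExD.
apply: eq_Ex => w.
rewrite (@eq_mean _ _ P _ (fun x => tsum h m w * tsum h' m w + (tsum h m w * h' x +
   (tsum h' m w * h x + h x * h' x)))) => [|x]; last first.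
  by rewrite !tsumS !tsum_upd // /upd eqxx; ring.
by rewrite !meanD !meanZ h0 h0' !mulr0 !add0r mean_cst.
Qed.

(** The second moment of the kernel of [ustat] at two independent samples, expanded over pairs of
    indices. *)
Definition cov_form g : R :=
  \sum_a \sum_b wt a * wt b * mean (fun x => g a x * g b x) ^+ 2.

Lemma cov_form_ge0 g : (forall a, 0 <= wt a) -> 0 <= cov_form g.
Proof.
move=> w0; apply: sumr_ge0 => a _; apply: sumr_ge0 => b _.
by rewrite mulr_ge0 ?sqr_ge0 // mulr_ge0.
Qed.

Lemma sqr_suml (F : A -> R) : (\sum_a F a) ^+ 2 = \sum_a \sum_b F a * F b.
Proof.
rewrite expr2 mulr_suml; apply: eq_bigr => a _; by rewrite mulr_sumr.
Qed.

(** For centered [g] the increments are martingale differences, so their second moments add up: the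
    increment at time [t] contributes [t * cov_form g]. *)
Lemma Ex_ustat_sq g m : (forall a, mean (g a) = 0) ->
  Ex m (fun w => ustat g m w ^+ 2) = 'C(m, 2)%:R * cov_form g.
Proof.
move=> g0; elim: m => [|m IH].
  by rewrite /= /ustat big_ord0 expr0n mul0r.
pose K w x := \sum_a wt a * (g a x * tsum (g a) m w).
have e : Ex m.+1 (fun w => ustat g m.+1 w ^+ 2) =
    Ex m (fun w => ustat g m w ^+ 2 + mean (fun x => K w x ^+ 2)).
  rewrite [LHS]/=; apply: eq_Ex => w.
  rewrite (@eq_mean _ _ P _ (fun x => ustat g m w ^+ 2 +
    ((2 * ustat g m w) * K w x + K w x ^+ 2))) => [|x].
    rewrite !meanD meanZ mean_cst //; congr (_ + _).
    rewrite (_ : mean (K w) = 0) ?mulr0 ?add0r // mean_sum big1 // => a _.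
    by rewrite meanZ meanZr g0 mul0r mulr0.
  rewrite ustatS ustat_upd // (_ : \sum_a _ = K w x); first by ring.
  by apply: eq_bigr => a _; rewrite tsum_upd // /upd eqxx.
rewrite e ExD IH binS bin1 natrD mulrDl; congr (_ + _).
have e2 w : mean (fun x => K w x ^+ 2) =
    \sum_a \sum_b (wt a * wt b * mean (fun x => g a x * g b x)) *
       (tsum (g a) m w * tsum (g b) m w).
  rewrite (@eq_mean _ _ P _ (fun x => \sum_a \sum_b
      (wt a * wt b * (tsum (g a) m w * tsum (g b) m w)) * (g a x * g b x))) => [|x].
    rewrite mean_sum; apply: eq_bigr => a _; rewrite mean_sum; apply: eq_bigr => b _.
    by rewrite meanZ; ring.
  by rewrite sqr_suml; apply: eq_bigr => a _; apply: eq_bigr => b _; ring.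
rewrite (eq_Ex _ x0 m e2) Ex_sum /cov_form mulr_sumr; apply: eq_bigr => a _.
rewrite Ex_sum mulr_sumr; apply: eq_bigr => b _.
by rewrite ExZ Ex_tsumM //; ring.
Qed.

(** The Hoeffding decomposition: a degenerate U-statistic, a linear statistic and the mean. *)
Lemma ustat_hoeffding g (mu : A -> R) t w :
  ustat g t w = ustat (fun a x => g a x - mu a) t w
    + (t%:R - 1) * tsum (fun x => \sum_a wt a * mu a * (g a x - mu a)) t w
    + t%:R * (t%:R - 1) / 2 * \sum_a wt a * mu a ^+ 2.
Proof.
have tsumB a s : tsum (g a) s w = tsum (fun x => g a x - mu a) s w + s%:R * mu a.
  by rewrite /tsum sumrB sumr_const card_ord mulr_natl subrK.
elim: t => [|t IH]; first by rewrite /ustat /tsum !big_ord0; ring.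
have tl s : tsum (fun x => \sum_a wt a * mu a * (g a x - mu a)) s w =
   \sum_a wt a * mu a * tsum (fun x => g a x - mu a) s w.
  by rewrite /tsum exchange_big; apply: eq_bigr => a _; rewrite mulr_sumr.
rewrite !ustatS IH tsumS -[t.+1%:R]natr1.
have -> : \sum_a wt a * (g a (w t) * tsum (g a) t w) =
   \sum_a wt a * ((g a (w t) - mu a) * tsum (fun x => g a x - mu a) t w)
   + t%:R * (\sum_a wt a * mu a * (g a (w t) - mu a))
   + \sum_a wt a * mu a * tsum (fun x => g a x - mu a) t w
   + t%:R * \sum_a wt a * mu a ^+ 2.
  rewrite !mulr_sumr -!big_split; apply: eq_bigr => a _ /=; rewrite tsumB; ring.
by rewrite -tl; field.
Qed.

Lemma ustat_variance g (mu : A -> R) m : (forall a, 0 <= wt a) ->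
  (forall a, mean (g a) = mu a) ->
  Ex m (fun w => (ustat g m w - m%:R * (m%:R - 1) / 2 * \sum_a wt a * mu a ^+ 2) ^+ 2)
  <= m%:R ^+ 2 * cov_form (fun a x => g a x - mu a)
     + 2 * m%:R ^+ 3 * mean (fun x => (\sum_a wt a * mu a * (g a x - mu a)) ^+ 2).
Proof.
move=> w0 gmu; pose gc a x := g a x - mu a.
pose l x := \sum_a wt a * mu a * gc a x; rewrite -/gc -/l.
have gc0 a : mean (gc a) = 0.
  by rewrite /gc meanD gmu (mean_cst P_sum1) subrr.
have l0 : mean l = 0.
  by rewrite /l mean_sum big1 // => a _; rewrite meanZ gc0 mulr0.
apply: (@le_trans _ _ (Ex m (fun w => 2 * ustat gc m w ^+ 2 +
   (2 * (m%:R - 1) ^+ 2) * (tsum l m w * tsum l m w)))).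
  apply: le_Ex => // w; rewrite (ustat_hoeffding g mu) -/gc -/l.
  set a := ustat _ _ _; set b := tsum _ _ _; set c := _ / 2 * _.
  by have := sqr_ge0 (a - (m%:R - 1) * b); nra.
rewrite ExD !ExZ Ex_tsumM // Ex_ustat_sq // mulrA; apply: lerD.
  apply: ler_wpM2r; first exact: cov_form_ge0.
  rewrite -natrM -natrX ler_nat mulnC; apply: (@leq_trans (m * m.-1)).
    by rewrite bin2 muln2 -[leqRHS](odd_double_half (m * m.-1)) leq_addl.
  by rewrite -mulnn leq_mul2l leq_pred orbT.
rewrite (_ : mean (fun x => l x * l x) = mean (fun x => l x ^+ 2)); last exact: eq_mean.
rewrite mulrA; apply: ler_wpM2r; first by apply: mean_ge0 => // x; exact: sqr_ge0.
have [->|m0] := posnP m; first by rewrite mulr0 exprS mul0r mulr0.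
have m1 : 1 <= m%:R :> R by rewrite ler1n.
have : (m%:R - 1) ^+ 2 <= m%:R ^+ 2 :> R by nra.
by move=> h; rewrite -mulrA [X in _ <= 2 * X]exprSr; nra.
Qed.

End UStatistic.

(** * The two variance terms, from abstract bounds on weights, noise and gaps *)

Section VarianceBound.
Variables (R : realType) (X : finType) (P : X -> R).
Hypothesis P_ge0 : forall x, 0 <= P x.
Hypothesis P_sum1 : \sum_x P x = 1.
Local Notation mean := (mean P).
(** In the application [a] is a node with a parental configuration, [I a] its indicator and [pi a]
    its probability, [e a] the noise of the node there and [v a] the second moment of that noise,
    [delta a] the gap of the two parameters, [chi a] the inverse variance under [Q], bounded by [r];
    and [1 / t] is a lower bound on the probabilities. *)
Variables (A : finType) (wt pi v delta chi : A -> R) (I e : A -> X -> R) (r t : R).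
Hypothesis wt_ge0 : forall a, 0 <= wt a.
Hypothesis I01 : forall a x, I a x = 0 \/ I a x = 1.
Hypothesis EI : forall a, mean (I a) = pi a.
Hypothesis Ee : forall a, mean (e a) = 0.
Hypothesis Eee : forall a b, a != b -> mean (fun x => e a x * e b x) = 0.
Hypothesis Ee2 : forall a, mean (fun x => e a x * e a x) = v a.
Hypothesis chi_ge0 : forall a, 0 <= chi a.
Hypothesis chi_le : forall a, chi a <= r.
Hypothesis wv_le : forall a, wt a * v a <= 2 + 2 * (`|delta a| * chi a).
Hypothesis wv_le_r : forall a, wt a * v a <= r.
Hypothesis wpi_le : forall a, wt a * pi a * delta a ^+ 2 <= 2 * (chi a * delta a ^+ 2).
Hypothesis chi_pi : forall a, chi a * delta a ^+ 2 <= t * (pi a * (chi a * delta a ^+ 2)).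
Hypothesis t_ge0 : 0 <= t.
Hypothesis r_ge0 : 0 <= r.

Let V := \sum_a pi a * (chi a * delta a ^+ 2).

Lemma pi_ge0 a : 0 <= pi a.
Proof. by rewrite -EI; apply: mean_ge0 => // x; case: (I01 a x) => ->; rewrite ?lexx ?ler01. Qed.

Lemma sum_chi_le : \sum_a chi a * delta a ^+ 2 <= t * V.
Proof. by rewrite /V mulr_sumr; apply: ler_sum => a _; apply: chi_pi. Qed.

Lemma V_ge0 : 0 <= V.
Proof.
by apply: sumr_ge0 => a _; rewrite mulr_ge0 ?pi_ge0 // mulr_ge0 ?sqr_ge0.
Qed.

Lemma v_ge0 a : 0 <= v a.
Proof. by rewrite -Ee2; apply: mean_ge0 => // x; rewrite -expr2 sqr_ge0. Qed.

Lemma I_sq a x : I a x * I a x = I a x.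
Proof. by case: (I01 a x) => ->; rewrite ?mul0r ?mul1r. Qed.

(** Bessel's inequality for [I a] against the orthogonal family [e]. Since [wt b * v b <= r], the
    factor [wt b / r] stands in for [1 / v b], and no division by a vanishing variance occurs. *)
Lemma bessel a : \sum_b wt b * mean (fun x => I a x * e b x) ^+ 2 <= r * pi a.
Proof.
have [r0|r0] := eqVneq r 0.
  rewrite r0 mul0r; apply: sumr_le0 => b _.
  have : wt b * v b = 0.
    by apply: le_anti; rewrite -{1}r0 wv_le_r mulr_ge0 ?v_ge0.
  move/eqP; rewrite mulf_eq0 => /orP[/eqP ->|/eqP v0]; first by rewrite mul0r.
  have : mean (fun x => I a x * e b x) = 0.
    (* With [v b = 0] the second moment of [I a + s * e b] is affine in [s] and nonnegative, which
       forces its slope to vanish. *)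
    have key (s : R) : 0 <= pi a + 2 * s * mean (fun x => I a x * e b x).
      have : 0 <= mean (fun x => (I a x + s * e b x) ^+ 2).
        by apply: mean_ge0 => // x; exact: sqr_ge0.
      rewrite (@eq_mean _ _ P _ (fun x => I a x + (2 * s * (I a x * e b x) +
          s ^+ 2 * (e b x * e b x)))) => [|x].
        by rewrite !meanD !meanZ EI Ee2 v0 mulr0 addr0.
      by rewrite sqrrD [I a x ^+ 2]expr2 I_sq; ring.
    set M := mean _ in key *; have [->//|M0] := eqVneq M 0.
    have := key (- (pi a + 1) / (2 * M)).
    rewrite (_ : pi a + _ = -1) ?oppr_ge0 ?ler10 //.
    by field.
  by move=> ->; rewrite expr0n mulr0.
have rp : 0 < r by rewrite lt_def r0.
pose b_ b := mean (fun x => I a x * e b x).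
pose c b := b_ b * wt b / r.
have : 0 <= mean (fun x => (I a x - \sum_b c b * e b x) ^+ 2).
  by apply: mean_ge0 => // x; exact: sqr_ge0.
rewrite (@eq_mean _ _ P _ (fun x => I a x + (- 2 * (\sum_b c b * (I a x * e b x)) +
    \sum_b \sum_b' (c b * c b') * (e b x * e b' x)))) => [|x]; last first.
  rewrite sqrrB expr2 I_sq -addrA sqr_suml; congr (_ + _); congr (_ + _).
    rewrite mulNr; congr (- _); rewrite mulr_natl; congr (_ *+ _).
    by rewrite mulr_sumr; apply: eq_bigr => b _; ring.
  by apply: eq_bigr => b _; apply: eq_bigr => b' _; ring.
rewrite !meanD meanZ EI !mean_sum.
have -> : \sum_b mean (fun x => c b * (I a x * e b x)) = \sum_b c b * b_ b.
  by apply: eq_bigr => b _; rewrite meanZ.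
have -> : \sum_b mean (fun x => \sum_b' (c b * c b') * (e b x * e b' x)) =
    \sum_b c b ^+ 2 * v b.
  apply: eq_bigr => b _; rewrite mean_sum (bigD1 b) //= big1 ?addr0 => [|b' bb'].
    by rewrite meanZ Ee2 expr2.
  by rewrite meanZ Eee ?mulr0 // eq_sym.
have c2 : \sum_b c b ^+ 2 * v b <= \sum_b c b * b_ b.
  apply: ler_sum => b _; rewrite /c -subr_ge0.
  rewrite (_ : _ - _ = b_ b ^+ 2 * wt b / r ^+ 2 * (r - wt b * v b)); last by field.
  apply: mulr_ge0; last by rewrite subr_ge0 wv_le_r.
  by rewrite mulr_ge0 ?invr_ge0 ?sqr_ge0 // mulr_ge0 ?sqr_ge0 ?wt_ge0.
have -> : \sum_b wt b * mean (fun x => I a x * e b x) ^+ 2 = r * \sum_b c b * b_ b.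
  rewrite mulr_sumr; apply: eq_bigr => b _; rewrite /c -/(b_ b); field.
  by rewrite gt_eqF.
by move=> h; apply: ler_wpM2l => //; lra.
Qed.

Let g a x := e a x + delta a * I a x.
Let gc a x := g a x - delta a * pi a.

Lemma gcE a x : gc a x = e a x + delta a * (I a x - pi a).
Proof. by rewrite /gc /g; ring. Qed.

(** The covariance of two indicators lies between [- pi a * pi b] and the smaller probability, so
    its absolute value is at most each of the two probabilities. *)
Lemma I_cov a b : mean (fun x => (I a x - pi a) * (I b x - pi b)) ^+ 2 <= pi a * pi b.
Proof.
have -> : mean (fun x => (I a x - pi a) * (I b x - pi b)) =
    mean (fun x => I a x * I b x) - pi a * pi b.
  rewrite (@eq_mean _ _ P _ (fun x => I a x * I b x + (- pi b * I a x +
     (- pi a * I b x + pi a * pi b)))) => [|x]; last by ring.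
  by rewrite !meanD !meanZ !EI mean_cst //; ring.
set m := mean _.
have m0 : 0 <= m.
  by apply: mean_ge0 => // x; case: (I01 a x) => ->; case: (I01 b x) => ->; rewrite ?mul0r ?mulr0 ?mulr1 ?lexx ?ler01.
have le1 c : pi c <= 1.
  rewrite -(mean_cst P_sum1 1) -EI; apply: le_mean => // x.
  by case: (I01 c x) => ->; rewrite ?ler01.
have ma : m <= pi a.
  rewrite -EI; apply: le_mean => // x.
  by case: (I01 a x) => ->; case: (I01 b x) => ->; rewrite ?mul0r ?mulr0 ?mulr1 ?lexx ?ler01.
have mb : m <= pi b.
  rewrite -EI; apply: le_mean => // x.
  by case: (I01 a x) => ->; case: (I01 b x) => ->; rewrite ?mul0r ?mulr0 ?mulr1 ?lexx ?ler01.
have := pi_ge0 a; have := pi_ge0 b; have := le1 a; have := le1 b.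
move: (pi a) (pi b) m0 ma mb => p q m0 mp mq q1 p1 q0 p0.
have [h|h] := lerP 0 (m - p * q).
  have : m - p * q <= p by nra.
  have : m - p * q <= q by nra.
  by move=> ? ?; rewrite expr2; apply: ler_pM.
have h1 : 0 <= p * q - m by lra.
have h2 : p * q - m <= p by nra.
have h3 : p * q - m <= q by nra.
by rewrite -sqrrN opprB expr2; apply: ler_pM.
Qed.

Lemma wtpid_sum : \sum_a wt a * pi a * delta a ^+ 2 <= 2 * (t * V).
Proof.
apply: (@le_trans _ _ (2 * \sum_a chi a * delta a ^+ 2)).
  by rewrite mulr_sumr; apply: ler_sum => a _; apply: wpi_le.
by apply: ler_wpM2l; rewrite ?ler0n ?sum_chi_le.
Qed.

Lemma wtpid_ge0 a : 0 <= wt a * pi a * delta a ^+ 2.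
Proof. by rewrite mulr_ge0 ?sqr_ge0 // mulr_ge0 ?pi_ge0. Qed.

(** From [(2 + 2 * x) ^ 2 <= 8 + 8 * x ^ 2] with [x = |delta a| * chi a], one factor [chi a] being
    bounded by [r]. *)
Lemma diag_bound : \sum_a (wt a * v a) ^+ 2 <= 8 * #|A|%:R + 8 * (r * (t * V)).
Proof.
apply: (@le_trans _ _ (\sum_a (8 + 8 * (r * (chi a * delta a ^+ 2))))).
  apply: ler_sum => a _; apply: (@le_trans _ _ ((2 + 2 * (`|delta a| * chi a)) ^+ 2)).
    apply: lerXn2r; rewrite ?nnegrE ?wv_le //; first by rewrite mulr_ge0 ?v_ge0.
    by rewrite addr_ge0 // mulr_ge0 // mulr_ge0.
  have := chi_le a; have := chi_ge0 a; rewrite -[delta a ^+ 2]real_normK ?num_real //.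
  move: (`|_|) (normr_ge0 (delta a)) (chi a) => d d0 c c0 cr.
  have : c * (c * d ^+ 2) <= r * (c * d ^+ 2).
    by apply: ler_wpM2r => //; rewrite mulr_ge0 ?sqr_ge0.
  by have := sqr_ge0 (1 - d * c); nra.
rewrite big_split /= sumr_const -[8 *+ _]mulr_natr lerD2l -!mulr_sumr.
apply: ler_wpM2l => //; apply: ler_wpM2l => //; exact: sum_chi_le.
Qed.

(** A covariance of two [gc] has four parts, and squaring costs a factor 4. The noise part is
    diagonal, the two cross parts are bounded by [bessel], and the covariance of indicators by
    [I_cov], after which its double sum is a square. *)
Lemma cov_form_bound : cov_form P wt gc <=
  32 * #|A|%:R + 48 * (r * (t * V)) + 16 * (t * V) ^+ 2.
Proof.
pose B a b := mean (fun x => I a x * e b x).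
pose J a b := mean (fun x => (I a x - pi a) * (I b x - pi b)).
have covE a b : mean (fun x => gc a x * gc b x) =
    mean (fun x => e a x * e b x) + delta a * B a b + delta b * B b a
    + delta a * delta b * J a b.
  rewrite (@eq_mean _ _ P _ (fun x => e a x * e b x + (delta a * (I a x * e b x) +
    (delta b * (I b x * e a x) + (delta a * delta b * ((I a x - pi a) * (I b x - pi b)) +
    (- (delta a * pi a) * e b x + - (delta b * pi b) * e a x)))))) => [|x].
    by rewrite !meanD !meanZ !Ee !mulr0 !addr0 !addrA.
  by rewrite !gcE; ring.
pose T a b := wt a * wt b * (delta a ^+ 2 * B a b ^+ 2).
pose D a b := wt a * wt b * mean (fun x => e a x * e b x) ^+ 2.
pose Q a b := (wt a * pi a * delta a ^+ 2) * (wt b * pi b * delta b ^+ 2).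
have ww a b : 0 <= wt a * wt b by rewrite mulr_ge0.
apply: (@le_trans _ _ (\sum_a \sum_b (4 * D a b + (4 * T a b + (4 * T b a + 4 * Q a b))))).
  apply: ler_sum => a _; apply: ler_sum => b _; rewrite covE.
  apply: (@le_trans _ _ (wt a * wt b * (4 * mean (fun x => e a x * e b x) ^+ 2 +
     4 * (delta a * B a b) ^+ 2 + 4 * (delta b * B b a) ^+ 2 +
     4 * (delta a * delta b * J a b) ^+ 2))).
    apply: ler_wpM2l => //; set m := mean _.
    move: m (delta a * B a b) (delta b * B b a) (delta a * delta b * J a b) => x y z u.
    have := sqr_ge0 (x - y); have := sqr_ge0 (x - z); have := sqr_ge0 (x - u).
    have := sqr_ge0 (y - z); have := sqr_ge0 (y - u); have := sqr_ge0 (z - u).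
    by nra.
  have JQ : wt a * wt b * (delta a * delta b * J a b) ^+ 2 <= Q a b.
    rewrite exprMn /Q (_ : _ * _ * (_ * _ * _) = wt a * wt b * ((delta a * delta b) ^+ 2 *
      (pi a * pi b))); last by ring.
    by do 2 (apply: ler_wpM2l; rewrite ?sqr_ge0 //); exact: I_cov.
  rewrite /D /T; move: JQ; rewrite !exprMn [wt b * wt a]mulrC; lra.
have sumT : \sum_a \sum_b T a b <= 2 * (r * (t * V)).
  apply: (@le_trans _ _ (r * \sum_a wt a * pi a * delta a ^+ 2)).
    rewrite mulr_sumr; apply: ler_sum => a _.
    rewrite (_ : \sum_b T a b = (wt a * delta a ^+ 2) *
        \sum_b wt b * mean (fun x => I a x * e b x) ^+ 2).
      apply: (@le_trans _ _ ((wt a * delta a ^+ 2) * (r * pi a))); last by lra.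
      by apply: ler_wpM2l (bessel a); rewrite mulr_ge0 ?sqr_ge0.
    by rewrite mulr_sumr; apply: eq_bigr => b _; rewrite /T /B; ring.
  by rewrite mulrCA; apply: ler_wpM2l => //; exact: wtpid_sum.
have sumD : \sum_a \sum_b D a b <= 8 * #|A|%:R + 8 * (r * (t * V)).
  apply: le_trans diag_bound; rewrite le_eqVlt; apply/orP; left; apply/eqP.
  apply: eq_bigr => a _; rewrite (bigD1 a) //= big1 ?addr0 => [|b ba].
    by rewrite /D Ee2; ring.
  by rewrite /D Eee ?expr0n ?mulr0 // eq_sym.
have sumQ : \sum_a \sum_b Q a b <= (2 * (t * V)) ^+ 2.
  rewrite -sqr_suml lerXn2r ?nnegrE ?wtpid_sum ?sumr_ge0 // => [a _|].
    exact: wtpid_ge0.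
  by rewrite !mulr_ge0 ?V_ge0.
have -> : \sum_a \sum_b (4 * D a b + (4 * T a b + (4 * T b a + 4 * Q a b))) =
  4 * (\sum_a \sum_b D a b) + 4 * (\sum_a \sum_b T a b) +
  4 * (\sum_a \sum_b T a b) + 4 * (\sum_a \sum_b Q a b).
  rewrite [X in _ + _ + 4 * X + _]exchange_big /= !mulr_sumr -!big_split.
  apply: eq_bigr => a _ /=; rewrite !mulr_sumr -!big_split; apply: eq_bigr => b _ /=.
  by rewrite !addrA.
by nra.
Qed.

(** The linear statistic is noise [L] plus a centered combination [F] of indicators. [L] has
    orthogonal terms; [F] is at most [2 * (t * V)] and has mean at most [2 * V], and the product
    bounds its second moment. *)
Lemma linear_bound :
  mean (fun x => (\sum_a wt a * (delta a * pi a) * gc a x) ^+ 2) <=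
  4 * (r * V) + 8 * (t * V ^+ 2).
Proof.
pose F x := \sum_a wt a * pi a * delta a ^+ 2 * I a x.
pose L x := \sum_a wt a * (delta a * pi a) * e a x.
pose EF := \sum_a wt a * pi a * delta a ^+ 2 * pi a.
have EFE : mean F = EF.
  by rewrite /F mean_sum; apply: eq_bigr => a _; rewrite meanZ EI.
have lE x : \sum_a wt a * (delta a * pi a) * gc a x = L x + (F x - EF).
  by rewrite /L /F /EF -sumrB -big_split; apply: eq_bigr => a _ /=; rewrite gcE; ring.
have F0 x : 0 <= F x.
  by apply: sumr_ge0 => a _; rewrite mulr_ge0 ?wtpid_ge0 //; case: (I01 a x) => ->; rewrite ?lexx ?ler01.
have EF2V : EF <= 2 * V.
  rewrite /EF /V mulr_sumr; apply: ler_sum => a _.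
  rewrite [leRHS](_ : _ = 2 * (chi a * delta a ^+ 2) * pi a); last by ring.
  by apply: ler_wpM2r; rewrite ?pi_ge0.
have EF0 : 0 <= EF by rewrite -EFE; apply: mean_ge0.
have Fle x : F x <= 2 * (t * V).
  apply: le_trans wtpid_sum; apply: ler_sum => a _.
  by rewrite ler_piMr ?wtpid_ge0 //; case: (I01 a x) => ->; rewrite ?ler01.
have V0 := V_ge0; have tV0 : 0 <= t * V by rewrite mulr_ge0.
have EF2 : mean (fun x => F x ^+ 2) <= 4 * (t * V ^+ 2).
  apply: (@le_trans _ _ (mean (fun x => (2 * (t * V)) * F x))).
    by apply: le_mean => // x; rewrite expr2; apply: ler_wpM2r.
  by rewrite meanZ EFE; nra.
have EL2 : mean (fun x => L x ^+ 2) <= 2 * (r * V).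
  have -> : mean (fun x => L x ^+ 2) = \sum_a (wt a * (delta a * pi a)) ^+ 2 * v a.
    rewrite (@eq_mean _ _ P _ (fun x => \sum_a \sum_b (wt a * (delta a * pi a)) *
       (wt b * (delta b * pi b)) * (e a x * e b x))) => [|x]; last first.
      by rewrite sqr_suml; apply: eq_bigr => a _; apply: eq_bigr => b _; ring.
    rewrite mean_sum; apply: eq_bigr => a _; rewrite mean_sum (bigD1 a) //= big1.
      by rewrite addr0 meanZ Ee2 expr2.
    by move=> b ba; rewrite meanZ Eee ?mulr0 // eq_sym.
  rewrite /V !mulr_sumr; apply: ler_sum => a _.
  rewrite (_ : _ * v a = (wt a * v a) * ((wt a * pi a * delta a ^+ 2) * pi a)); last by ring.
  rewrite [leRHS](_ : _ = r * (2 * (chi a * delta a ^+ 2) * pi a)); last by ring.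
  have p0 := pi_ge0 a; apply: ler_pM => //; first by rewrite mulr_ge0 ?v_ge0.
    by rewrite mulr_ge0 ?wtpid_ge0.
  by apply: ler_wpM2r.
apply: (@le_trans _ _ (mean (fun x => 2 * L x ^+ 2 +
   (2 * F x ^+ 2 + (-(4 * EF) * F x + 2 * EF ^+ 2))))).
  apply: le_mean => // x; rewrite lE.
  by have := sqr_ge0 (L x - (F x - EF)); nra.
rewrite !meanD !meanZ mean_cst // EFE; nra.
Qed.

End VarianceBound.

(** * From the l1 distance to the chi-square divergence of two nets *)

Section Divergence.
Variables (R : realType) (n : nat).
Implicit Types (P Q : distr R n).

Lemma ln_prod (I : finType) (F : I -> R) : (forall i, 0 < F i) ->
  ln (\prod_i F i) = \sum_i ln (F i).
Proof.
move=> F0; suff [] : 0 < \prod_i F i /\ ln (\prod_i F i) = \sum_i ln (F i) by [].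
apply: (big_ind2 (fun a b => 0 < a /\ ln a = b)) => [|a b c d [a0 <-] [c0 <-]|i _].
- by rewrite ln1.
- by rewrite lnM ?posrE // mulr_gt0.
- by [].
Qed.

Lemma ln_le_subr1 (y : R) : 0 < y -> ln y <= y - 1.
Proof. by move=> y0; have := @le_ln1Dx R (y - 1); rewrite subrKC; apply; lra. Qed.

(** With [a] and [b] the square roots of [P x] and [Q x], [ln (P x / Q x) = - 2 * ln (b / a)] is at
    least [2 * (1 - b / a)], which bounds the squared Hellinger sum [H] by the entropy. *)
Lemma l1_sq_le_entropy P Q : (forall x, 0 < Q x) ->
  l1 P Q ^+ 2 <= 4 * \sum_x P x * ln (P x / Q x).
Proof.
move=> Q0; pose H := \sum_x (Num.sqrt (P x) - Num.sqrt (Q x)) ^+ 2.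
have sq x : Num.sqrt (P x) ^+ 2 = P x by rewrite sqr_sqrtr ?pmf_ge0.
have sqQ x : Num.sqrt (Q x) ^+ 2 = Q x by rewrite sqr_sqrtr ?pmf_ge0.
have HKL : H <= \sum_x P x * ln (P x / Q x).
  suff : 0 <= \sum_x (P x * ln (P x / Q x) - (Num.sqrt (P x) - Num.sqrt (Q x)) ^+ 2
      + (Q x - P x)).
    rewrite big_split /= !sumrB !pmf_sum1 subrr addr0 subr_ge0 //.
  apply: sumr_ge0 => x _; have [P0|P0] := eqVneq (P x) 0.
    by rewrite P0 sqrtr0 mul0r; have := sqQ x; nra.
  have {}P0 : 0 < P x by rewrite lt_def P0 pmf_ge0.
  set a := Num.sqrt _; set b := Num.sqrt _.
  have a0 : 0 < a by rewrite sqrtr_gt0.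
  have b0 : 0 < b by rewrite sqrtr_gt0.
  have -> : P x / Q x = (b / a) ^- 1 * (b / a)^-1.
    by rewrite -sq -sqQ -/a -/b expr1; field; rewrite !gt_eqF.
  have ba : 0 < b / a by rewrite divr_gt0.
  rewrite expr1 lnM ?posrE ?invr_gt0 // lnV ?posrE //.
  have := ln_le_subr1 ba; set l := ln _ => hl.
  rewrite -sq -sqQ -/a -/b.
  have h : a ^+ 2 * l <= b * a - a ^+ 2.
    have -> : b * a - a ^+ 2 = a ^+ 2 * (b / a - 1) by field; rewrite gt_eqF.
    by apply: ler_wpM2l; rewrite ?sqr_ge0.
  by rewrite sqrrB; nra.
suff h : l1 P Q ^+ 2 <= 4 * H by apply: le_trans h _; rewrite ler_pM2l.
have [l0|l0] := eqVneq (l1 P Q) 0.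
  by rewrite l0 expr0n mulr_ge0 // sumr_ge0 // => x _; exact: sqr_ge0.
have {}l0 : 0 < l1 P Q by rewrite lt_def l0 sumr_ge0.
set L := l1 P Q in l0 *.
(* Young's inequality weighted by [L] itself plays the part of Cauchy-Schwarz: summed up it reads
   [L <= 2 * H / L + L / 2]. *)
have : L <= \sum_x (2 / L * (Num.sqrt (P x) - Num.sqrt (Q x)) ^+ 2 + L / 4 * (P x + Q x)).
  apply: ler_sum => x _.
  have -> : P x - Q x = (Num.sqrt (P x) - Num.sqrt (Q x)) * (Num.sqrt (P x) + Num.sqrt (Q x)).
    by rewrite -subr_sqr sq sqQ.
  have := (sqrtr_ge0 (P x), sqrtr_ge0 (Q x)); have := (sq x, sqQ x).
  move: (Num.sqrt (P x)) (Num.sqrt (Q x)) => a b [<- <-] [a0 b0].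
  rewrite normrM [`|a + b|]ger0_norm ?addr_ge0 //.
  rewrite -[(a - b) ^+ 2]real_normK ?num_real //; set c := `|a - b|.
  have c0 : 0 <= c by exact: normr_ge0.
  have h1 : (a + b) ^+ 2 <= 2 * (a ^+ 2 + b ^+ 2) by have := sqr_ge0 (a - b); nra.
  apply: (@le_trans _ _ (2 / L * c ^+ 2 + L / 8 * (a + b) ^+ 2)); last by nra.
  rewrite -subr_ge0 (_ : _ - _ = 2 / L * (c - L / 4 * (a + b)) ^+ 2); last first.
    by field; rewrite gt_eqF.
  by rewrite mulr_ge0 ?sqr_ge0 // divr_ge0 // ltW.
rewrite big_split /= -!mulr_sumr -/H big_split /= !pmf_sum1 => h.
have : L * L <= L * (2 / L * H + L / 4 * (1 + 1)) by rewrite ler_pM2l.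
rewrite (_ : L * (2 / L * H + L / 4 * (1 + 1)) = 2 * H + L ^+ 2 / 2).
  by rewrite expr2; lra.
by field; rewrite gt_eqF.
Qed.

Section ChiSquare.
Variables (pa : 'I_n -> {set 'I_n}) (s : {perm 'I_n}) (P Q : distr R n).
Variables phi psi : 'I_n -> bits n -> R.
Hypothesis topo : forall i j, j \in pa i -> (s j < s i)%N.
Hypothesis facP : factors pa P phi.
Hypothesis facQ : factors pa Q psi.
Hypothesis psi01 : forall i x, 0 < par_prob psi i x < 1.

Lemma psi_gt0 i x : 0 < psi i x.
Proof. by rewrite (phiE facQ); have /andP[? ?] := psi01 i x; case: (x i); rewrite ?subr_gt0. Qed.

(** [ln y <= y - 1] is applied node by node. Given the parents of [i], the mean of
    [phi i / psi i - 1] is exactly the chi-square term of [i]. *)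
Lemma l1_sq_le_chi : l1 P Q ^+ 2 <= 4 * \sum_x P x * (\sum_i
  (par_prob phi i x - par_prob psi i x) ^+ 2 / (par_prob psi i x * (1 - par_prob psi i x))).
Proof.
have Q0 x : 0 < Q x by case: facQ => _ _ _ ->; apply: prodr_gt0 => i _; exact: psi_gt0.
apply: le_trans (l1_sq_le_entropy P Q0) _; rewrite ler_pM2l ?ltr0n //.
apply: (@le_trans _ _ (\sum_x \sum_i P x * (phi i x / psi i x - 1))).
  apply: ler_sum => x _; rewrite -mulr_sumr; have [P0|P0] := eqVneq (P x) 0.
    by rewrite P0 !mul0r.
  apply: ler_wpM2l; first exact: pmf_ge0.
  have [ph0 _ _ PE] := facP; have [_ _ _ QE] := facQ.
  have phip i : 0 < phi i x.
    rewrite lt_def ph0 andbT; apply: contraNneq P0 => e.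
    by rewrite PE (bigD1 i) //= e mul0r.
  have r0 i : 0 < phi i x / psi i x by rewrite divr_gt0 ?psi_gt0.
  rewrite PE QE -prodf_div ln_prod //; apply: ler_sum => i _.
  exact: ln_le_subr1.
rewrite exchange_big [leRHS](_ : _ = \sum_i \sum_x P x *
  ((par_prob phi i x - par_prob psi i x) ^+ 2 / (par_prob psi i x * (1 - par_prob psi i x)))).
  rewrite le_eqVlt; apply/orP; left; apply/eqP; apply: eq_bigr => i _.
  (* The likelihood ratio at value 1 minus that at value 0: [phi i / psi i - 1] is the chi-square
     term plus [a] times the deviation of [X_i], and the latter product has mean 0. *)
  pose a x := par_prob phi i x / par_prob psi i x - (1 - par_prob phi i x) / (1 - par_prob psi i x).
  have da : dep (before s (s i)) a.
    have sub : pa i \subset before s (s i) by apply/subsetP => k /topo; rewrite inE.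
    have d1 := depS sub (par_prob_dep facP (pa_irr topo i)).
    have d2 := depS sub (par_prob_dep facQ (pa_irr topo i)).
    by move=> x y xy; rewrite /a (d1 x y) // (d2 x y).
  rewrite -[RHS]add0r -[X in X + _](martingale topo facP da) -big_split; apply: eq_bigr => x _.
  rewrite /= -mulrDr; congr (_ * _); rewrite (phiE facP) (phiE facQ) /a.
  have /andP[q0 q1] := psi01 i x.
  have q2 : 1 - par_prob psi i x != 0 by rewrite gt_eqF // subr_gt0.
  have q3 : par_prob psi i x != 0 by rewrite gt_eqF.
  by case: (x i) => /=; field; rewrite q2 q3.
rewrite exchange_big; apply: eq_bigr => x _; rewrite mulr_sumr; exact: eq_bigr.
Qed.

End ChiSquare.
End Divergence.

(** * A measure of conditional dependence *)

Section IndependenceStatistic.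
Variable R : realType.

Definition det_ratio (a b c d : R) : R := `|a * b - c * d| / (a + b + c + d).

(** The signed quotient [(a * b - c * d) / (a + b + c + d)] has difference quotients in [a] between
    0 and 1, and absolute values can only shrink differences. *)
Lemma det_ratio_lip1 (a a' b c d : R) : 0 <= a -> 0 <= a' -> 0 <= b -> 0 <= c -> 0 <= d ->
  `|det_ratio a b c d - det_ratio a' b c d| <= `|a - a'|.
Proof.
suff key (x y b' c' d' : R) : 0 <= x -> x < y -> 0 <= b' -> 0 <= c' -> 0 <= d' ->
    `|det_ratio x b' c' d' - det_ratio y b' c' d'| <= y - x.
  move=> a0 a0' b0 c0 d0; have [aa|aa|<-] := ltgtP a a'.
  - by rewrite [leRHS]distrC [leRHS]ger0_norm ?subr_ge0 ?(ltW aa) //; exact: key.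
  - by rewrite distrC [leRHS]ger0_norm ?subr_ge0 ?(ltW aa) //; exact: key.
  - by rewrite !subrr normr0.
move=> {a a' b c d} x0 xy b0 c0 d0; rewrite /det_ratio.
set s := x + b' + c' + d'; have sy : y + b' + c' + d' = s + (y - x) by rewrite /s; ring.
rewrite sy; have [s0|s0] := eqVneq s 0.
  have [-> -> -> ->] : [/\ x = 0, b' = 0, c' = 0 & d' = 0] by rewrite /s in s0; split; lra.
  rewrite !(mulr0, mul0r, subr0, normr0, sub0r, normrN) //; lra.
have {}s0 : 0 < s by rewrite lt_def s0 /s !addr_ge0.
have s1 : 0 < s + (y - x) by lra.
have -> : `|x * b' - c' * d'| / s = `|(x * b' - c' * d') / s|.
  by rewrite normrM normfV (gtr0_norm s0).
have -> : `|y * b' - c' * d'| / (s + (y - x)) = `|(y * b' - c' * d') / (s + (y - x))|.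
  by rewrite normrM normfV (gtr0_norm s1).
apply: le_trans (ler_dist_dist _ _) _.
have e : (y * b' - c' * d') / (s + (y - x)) - (x * b' - c' * d') / s =
   (y - x) * ((b' * (b' + c' + d') + c' * d') / (s * (s + (y - x)))).
  rewrite /s in s0 s1 *; field; rewrite !gt_eqF //=; lra.
rewrite distrC e; set q := _ / (s * _).
have q0 : 0 <= q.
  apply: divr_ge0; last by rewrite mulr_ge0 // ltW.
  by rewrite addr_ge0 // mulr_ge0 // !addr_ge0.
have q1 : q <= 1.
  by rewrite ler_pdivrMr ?mulr_gt0 // mul1r /s; nra.
have d0' : 0 <= y - x by lra.
have h : 0 <= (y - x) * q by exact: mulr_ge0.
by rewrite (ger0_norm h) ler_piMr.
Qed.

Lemma det_ratio_sym12 a b c d : det_ratio a b c d = det_ratio b a c d.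
Proof. by rewrite /det_ratio [a * b]mulrC [a + b]addrC. Qed.

Lemma det_ratio_swap a b c d : det_ratio a b c d = det_ratio c d a b.
Proof. by rewrite /det_ratio distrC; congr (_ / _); ring. Qed.

Lemma det_ratio_lip (a b c d a' b' c' d' : R) :
  0 <= a -> 0 <= b -> 0 <= c -> 0 <= d -> 0 <= a' -> 0 <= b' -> 0 <= c' -> 0 <= d' ->
  `|det_ratio a b c d - det_ratio a' b' c' d'| <=
  `|a - a'| + `|b - b'| + `|c - c'| + `|d - d'|.
Proof.
move=> a0 b0 c0 d0 a0' b0' c0' d0'.
have h1 := @det_ratio_lip1 a a' b c d a0 a0' b0 c0 d0.
have h2 := @det_ratio_lip1 b b' a' c d b0 b0' a0' c0 d0.
have h3 := @det_ratio_lip1 c c' d a' b' c0 c0' d0 a0' b0'.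
have h4 := @det_ratio_lip1 d d' c' a' b' d0 d0' c0' a0' b0'.
rewrite ![det_ratio _ a' c d]det_ratio_sym12 in h2.
rewrite ![det_ratio _ d a' b']det_ratio_swap in h3.
rewrite ![det_ratio _ c' a' b']det_ratio_sym12 ![det_ratio c' _ a' b']det_ratio_swap in h4.
set x := det_ratio a b c d in h1 *; set y := det_ratio a' b c d in h1 h2.
set z := det_ratio a' b' c d in h2 h3; set u := det_ratio a' b' c' d in h3 h4.
have -> : x - det_ratio a' b' c' d' = (x - y) + (y - z) + (z - u) + (u - det_ratio a' b' c' d') by ring.
by do 3 (apply: le_trans (ler_normD _ _) _; apply: lerD => //).
Qed.

Variable Z : finType.
Implicit Types q : Z * bool * bool -> R.

Definition dep_stat q : R := \sum_z
  det_ratio (q (z, true, true)) (q (z, false, false)) (q (z, true, false)) (q (z, false, true)).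

Lemma sum_ZBB (V : nmodType) (F : Z * bool * bool -> V) :
  \sum_p F p = \sum_z (F (z, true, true) + F (z, false, false) +
                       F (z, true, false) + F (z, false, true)).
Proof.
rewrite (eq_bigr (fun p : Z * bool * bool => F (p.1.1, p.1.2, p.2))); last by case=> [[]].
rewrite -(pair_big xpredT xpredT (fun p b => F (p.1, p.2, b))) /=.
rewrite -(pair_big xpredT xpredT (fun z a => \sum_b F (z, a, b))) /=.
apply: eq_bigr => z _; rewrite !big_bool /= -!addrA; congr (_ + _).
by rewrite addrA addrC.
Qed.

Lemma dep_stat_lip q q' : (forall p, 0 <= q p) -> (forall p, 0 <= q' p) ->
  `|dep_stat q - dep_stat q'| <= \sum_p `|q p - q' p|.
Proof.
move=> q0 q0'; rewrite sum_ZBB /dep_stat -sumrB; apply: le_trans (ler_norm_sum _ _ _) _.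
by apply: ler_sum => z _; apply: det_ratio_lip.
Qed.

(** Homogeneity lets the tester apply the statistic to raw counts, without dividing by the number of
    samples. *)
Lemma dep_statZ k q : 0 <= k -> dep_stat (fun p => k * q p) = k * dep_stat q.
Proof.
move=> k0; rewrite /dep_stat mulr_sumr; apply: eq_bigr => z _; rewrite /det_ratio.
have [->|kn0] := eqVneq k 0; first by rewrite !mul0r subrr normr0 mul0r.
rewrite -!mulrDr (_ : _ - _ = k * (k * (q (z, true, true) * q (z, false, false) -
   q (z, true, false) * q (z, false, true)))); last by ring.
by rewrite !normrM (ger0_norm k0) invfM; move: (_ + _ + _ + _)^-1 => i; field.
Qed.

End IndependenceStatistic.

(** * The marginal of two nodes and a coded conditioning set, exact and empirical *)

Section CodedMarginal.
Variables (R : realType) (n : nat) (Z : finType).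
Variables (i j : 'I_n) (T : {set 'I_n}) (code : bits n -> Z).
Hypothesis code_eq : forall x y, (code x == code y) = [forall k in T, x k == y k].
Hypothesis ij : i != j.
Hypothesis iT : i \notin T.
Hypothesis jT : j \notin T.
Implicit Types (P Q : distr R n) (x y : bits n).

Definition cell x : Z * bool * bool := (code x, x i, x j).

Definition marg (P : bits n -> R) (p : Z * bool * bool) : R := \sum_x P x * (cell x == p)%:R.

Lemma marg_ge0 P p : 0 <= marg P p.
Proof. by apply: sumr_ge0 => x _; rewrite mulr_ge0 ?pmf_ge0. Qed.

Lemma sum_marg (P : bits n -> R) (F : Z * bool * bool -> R) :
  \sum_x P x * F (cell x) = \sum_p marg P p * F p.
Proof.
under [RHS]eq_bigr do rewrite /marg mulr_suml.
rewrite exchange_big; apply: eq_bigr => x _ /=.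
rewrite (bigD1 (cell x)) //= eqxx mulr1 big1 ?addr0 // => p px.
by rewrite eq_sym (negbTE px) mulr0 mul0r.
Qed.

Lemma in_cyl_code x y : (y \in cyl T x) = (code y == code x).
Proof. by rewrite inE code_eq. Qed.

Lemma Pr_cyl2 P x a b : Pr P (coord i a :&: coord j b :&: cyl T x) = marg P (code x, a, b).
Proof.
rewrite PrE; apply: eq_bigr => y _; rewrite !in_setI in_cyl_code !inE /cell !xpair_eqE.
by congr (_ * (_ : bool)%:R); rewrite andbC andbA.
Qed.

Lemma Pr_cyl_i P x a : Pr P (coord i a :&: cyl T x) =
  marg P (code x, a, true) + marg P (code x, a, false).
Proof.
rewrite -!Pr_cyl2 -(Pr_coord P j true); congr (_ + _).
  by rewrite setIA [coord j _ :&: _]setIC.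
by rewrite setIA [coord j _ :&: _]setIC.
Qed.

Lemma Pr_cyl_j P x b : Pr P (coord j b :&: cyl T x) =
  marg P (code x, true, b) + marg P (code x, false, b).
Proof. by rewrite -!Pr_cyl2 -(Pr_coord P i true) !setIA. Qed.

Lemma Pr_cyl_sum P x : Pr P (cyl T x) =
  marg P (code x, true, true) + marg P (code x, false, false) +
  marg P (code x, true, false) + marg P (code x, false, true).
Proof. by rewrite -(Pr_coord P i true) !Pr_cyl_i /=; ring. Qed.

(** The case [a = b = true] suffices: [p11 * p = (p11 + p10) * (p11 + p01)] amounts to
    [p11 * p00 = p10 * p01]. *)
Lemma cond_indep_dep_stat P : cond_indep P i j T -> dep_stat (marg P) = 0.
Proof.
move=> ci; apply: big1 => z _; rewrite /det_ratio.
set s := _ + _ + _ + _; have [s0|s0] := eqVneq s 0; first by rewrite s0 invr0 mulr0.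
have [x xz] : exists x, code x = z.
  apply: contra_neqP s0 => nz; rewrite /s /marg.
  have m0 a b : \sum_x P x * (cell x == (z, a, b))%:R = 0.
    apply: big1 => x _; case: eqP => [e|_]; last by rewrite mulr0.
    by case: nz; exists x; case: e.
  by rewrite !m0 !addr0.
have := ci true true x; rewrite /cPr Pr_cyl2 Pr_cyl_i Pr_cyl_j Pr_cyl_sum xz -/s => /(_ s0).
move: (marg P (z, true, true)) (marg P (z, false, false)) (marg P (z, true, false))
  (marg P (z, false, true)) @s s0 => a b c d s s0.
move/(congr1 (fun u => u * (s * s))).
have -> : a / s * (s * s) = a * s by field.
have -> : (a + c) / s * ((a + d) / s) * (s * s) = (a + c) * (a + d) by field.
move=> h; have -> : a * b - c * d = 0 by rewrite /s in h; lra.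
by rewrite normr0 mul0r.
Qed.

Lemma dep_stat_le1 P : dep_stat (marg P) <= 1.
Proof.
have -> : 1 = \sum_p marg P p.
  rewrite -(pmf_sum1 P) -[RHS](eq_bigr _ (fun p _ => mulr1 (marg P p))).
  by rewrite -(sum_marg P (fun=> 1)); apply: eq_bigr => x _; rewrite mulr1.
rewrite sum_ZBB; apply: ler_sum => z _; rewrite /det_ratio.
move: (marg_ge0 P (z, true, true)) (marg_ge0 P (z, false, false))
      (marg_ge0 P (z, true, false)) (marg_ge0 P (z, false, true)).
move: (marg P (z, true, true)) (marg P (z, false, false)) (marg P (z, true, false))
  (marg P (z, false, true)) => a b c d a0 b0 c0 d0.
have [s0|s0] := eqVneq (a + b + c + d) 0; first by rewrite s0 invr0 mulr0.
have {}s0 : 0 < a + b + c + d by rewrite lt_def s0 !addr_ge0.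
by rewrite ler_pdivrMr // ler_norml; apply/andP; split; nra.
Qed.

Section Projection.
Variables (Q : distr R n).
Hypothesis Q_gt0 : forall x, 0 < Q x.

Let q := marg Q.
Let tot z := q (z, true, true) + q (z, false, false) + q (z, true, false) + q (z, false, true).
Let prd (p : Z * bool * bool) : R :=
  (q (p.1.1, p.1.2, true) + q (p.1.1, p.1.2, false)) *
  (q (p.1.1, true, p.2) + q (p.1.1, false, p.2)) / tot p.1.1.

Lemma reachable_gt0 x a b : 0 < q (code x, a, b).
Proof.
pose y : bits n := [ffun k => if k == i then a else if k == j then b else x k].
have cy : cell y = (code x, a, b).
  rewrite /cell !ffunE eqxx eq_sym (negbTE ij) eqxx; congr (_, _, _); apply/eqP.
  rewrite code_eq; apply/forallP => k; apply/implyP => kT; rewrite ffunE.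
  have [e|_] := eqVneq k i; first by have := iT; rewrite -e kT.
  by have [e|_] := eqVneq k j; first by have := jT; rewrite -e kT.
rewrite /q /marg (bigD1 y) //= cy eqxx mulr1 ltr_pwDl //.
by apply: sumr_ge0 => z _; rewrite mulr_ge0 ?pmf_ge0.
Qed.

(** Changing the coordinates [i] and [j] does not affect the code, so over an attained code all four
    cells are positive and the reweighing divides safely. *)
Lemma q_split z : (forall a b, 0 < q (z, a, b)) \/ (forall a b, q (z, a, b) = 0).
Proof.
case: (boolP [exists x, code x == z]) => [/existsP[x /eqP <-]|/existsPn nz].
  by left=> a b; exact: reachable_gt0.
right=> a b; apply: big1 => x _; rewrite /cell !xpair_eqE (negbTE (nz x)) /=.
by rewrite mulr0.
Qed.

Lemma prd_ge0 p : 0 <= prd p.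
Proof. by rewrite divr_ge0 ?mulr_ge0 ?addr_ge0 ?marg_ge0. Qed.

(* The conditional product of Q: it reweighs Q within each cell so that i and j
   become independent given T. *)
Let proj_fun x : R := Q x * (prd (cell x) / q (cell x)).

Lemma proj_marg p : marg proj_fun p = prd p.
Proof.
rewrite /marg (eq_bigr (fun x => (Q x * (cell x == p)%:R) * (prd p / q p))) => [|x _].
  rewrite -mulr_suml -/(marg Q p) -/q; case: p => [[z a] b].
  have [q0|q0] := q_split z; first by rewrite mulrC divfK // gt_eqF.
  by rewrite q0 mul0r /prd /= !q0 addr0 !mul0r.
rewrite /proj_fun; case: eqP => [->|_]; rewrite ?mulr0 ?mulr1 ?mul0r //.
Qed.

Lemma proj_ge0 x : 0 <= proj_fun x.
Proof. by rewrite mulr_ge0 ?pmf_ge0 // divr_ge0 ?prd_ge0 ?marg_ge0. Qed.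

Lemma prd_sum z : prd (z, true, true) + prd (z, false, false) +
  prd (z, true, false) + prd (z, false, true) = tot z.
Proof.
rewrite /prd /=; have [t0|t0] := eqVneq (tot z) 0; first by rewrite t0 invr0 !mulr0 !addr0.
by rewrite -!mulrDl /tot in t0 *; field.
Qed.

Lemma proj_sum1 : \sum_x proj_fun x = 1.
Proof.
rewrite -(pmf_sum1 Q).
have e (F : bits n -> R) : \sum_x F x = \sum_p marg F p.
  rewrite -[RHS](eq_bigr _ (fun p _ => mulr1 (marg F p))).
  by rewrite -(sum_marg F (fun=> 1)); apply: eq_bigr => x _; rewrite mulr1.
rewrite !e (eq_bigr prd) => [|p _]; last exact: proj_marg.
by rewrite !sum_ZBB; apply: eq_bigr => z _; rewrite prd_sum.
Qed.

Definition proj : distr R n := Distr proj_ge0 proj_sum1.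

Lemma proj_cond_indep : cond_indep proj i j T.
Proof.
move=> a b x; rewrite /cPr Pr_cyl2 Pr_cyl_i Pr_cyl_j Pr_cyl_sum /=.
rewrite -[marg proj]/(marg proj_fun) !proj_marg prd_sum => t0.
by rewrite /prd /=; case: a; case: b; rewrite /tot in t0 *; field.
Qed.

(** The conditional product moves each of the four cells over [z] by exactly [det_ratio], so its
    distance in total variation from [Q] is [2 * dep_stat q], which may not be less than [gamma]. *)
Lemma far_dep_stat gamma : far_from_indep gamma Q i j T -> gamma <= 2 * dep_stat q.
Proof.
move=> far; have : ~~ (dTV Q proj < gamma).
  by apply/negP => /far; apply; exact: proj_cond_indep.
rewrite -leNgt => h; apply: le_trans h _; rewrite /dTV ler_pdivrMr //.
have -> : l1 Q proj = \sum_x Q x * `|1 - prd (cell x) / q (cell x)|.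
  apply: eq_bigr => x _; rewrite /= /proj_fun -{1}[Q x]mulr1 -mulrBr normrM.
  by rewrite ger0_norm ?pmf_ge0.
rewrite (sum_marg Q (fun p => `|1 - prd p / q p|)) sum_ZBB /dep_stat mulr_sumr mulr_suml.
apply: ler_sum => z _; rewrite -/q.
have [q0|q0] := q_split z; last first.
  by rewrite !q0 /det_ratio !(mul0r, mulr0, addr0, subrr, normr0).
have e a b : q (z, a, b) * `|1 - prd (z, a, b) / q (z, a, b)| = `|q (z, a, b) - prd (z, a, b)|.
  rewrite -{1}[q (z, a, b)]gtr0_norm // -normrM mulrBr mulr1 mulrC divfK //.
  by rewrite gt_eqF.
rewrite !e /prd /det_ratio /= /tot.
move: (q0 true true) (q0 false false) (q0 true false) (q0 false true).
move: (q (z, true, true)) (q (z, false, false)) (q (z, true, false))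
  (q (z, false, true)) => a b c d a0 b0 c0 d0.
have s0 : 0 < a + b + c + d by rewrite !addr_gt0.
have sn : a + b + c + d != 0 by rewrite gt_eqF.
have -> : a - (a + c) * (a + d) / (a + b + c + d) = (a * b - c * d) / (a + b + c + d) by field.
have -> : b - (d + b) * (c + b) / (a + b + c + d) = (a * b - c * d) / (a + b + c + d) by field.
have -> : c - (a + c) * (c + b) / (a + b + c + d) = - (a * b - c * d) / (a + b + c + d) by field.
have -> : d - (d + b) * (a + d) / (a + b + c + d) = - (a * b - c * d) / (a + b + c + d) by field.
rewrite !mulNr !normrN normrM normfV (gtr0_norm s0); lra.
Qed.

End Projection.

Section Empirical.
Variables (P : distr R n) (x0 : bits n).
Local Notation Ex := (Ex P x0).

Definition emp (m : nat) (w : nat -> bits n) (p : Z * bool * bool) : nat :=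
  \sum_(k < m) (cell (w k) == p).

Lemma emp_sum m w (A : {set Z * bool * bool}) :
  (\sum_(p in A) emp m w p)%N = count (fun x => cell x \in A) m w.
Proof.
rewrite /emp exchange_big; apply: eq_bigr => k _ /=.
case kA: (cell (w k) \in A).
  rewrite (bigD1 (cell (w k))) //= eqxx big1 ?addn0 // => p /andP[_ pk].
  by rewrite eq_sym (negbTE pk).
by rewrite big1 // => p pA; case: eqP => // e; rewrite e pA in kA.
Qed.

(** The l1 deviation is twice the excess over the set of cells whose count is at least its mean. A
    union bound over all sets of cells costs an exponent linear in the number of cells. *)
Lemma emp_l1 m (t : R) : 0 <= t <= 1/2 -> (0 < m)%N ->
  Ex m (fun w => (~~ (\sum_p `|(emp m w p)%:R - m%:R * marg P p| < 2 * m%:R * t)%R)%:R)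
  <= 2 ^+ (4 * #|Z|) * expR (- (m%:R * t ^+ 2 / 4)).
Proof.
move=> t01 m0.
pose bad (A : {set Z * bool * bool}) w : bool :=
  m%:R * (\sum_(p in A) marg P p + t) <= (count (fun x => cell x \in A) m w)%:R.
apply: (@le_trans _ _ (Ex m (fun w => \sum_(A : {set Z * bool * bool}) (bad A w)%:R))).
  apply: le_Ex => [x|w]; first exact: pmf_ge0.
  case: (boolP (_ < _)) => [_|h]; first by rewrite sumr_ge0.
  pose A := [set p | m%:R * marg P p <= (emp m w p)%:R].
  rewrite (bigD1 A) //= (_ : bad A w) ?lerDl ?sumr_ge0 //.
  apply: contraNT h; rewrite /bad -ltNge -emp_sum natr_sum mulrDr => h.
  pose f p := (emp m w p)%:R - m%:R * marg P p.
  have f0 : \sum_p f p = 0.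
    rewrite sumrB -mulr_sumr (_ : \sum_p marg P p = 1).
      rewrite -natr_sum mulr1 (_ : (\sum_p emp m w p)%N = m) ?subrr //.
      have := emp_sum m w setT; rewrite /count.
      rewrite (eq_bigl xpredT) => [->|p]; last by rewrite inE.
      rewrite (eq_bigr (fun=> 1%N)) => [|k _]; last by rewrite inE.
      by rewrite sum1_card card_ord.
    rewrite -(pmf_sum1 P) -[LHS](eq_bigr _ (fun p _ => mulr1 (marg P p))).
    by rewrite -(sum_marg P (fun=> 1)); apply: eq_bigr => x _; rewrite mulr1.
  have fA : \sum_(p in A) f p < m%:R * t.
    by rewrite sumrB -mulr_sumr ltrBlDl.
  have -> : \sum_p `|(emp m w p)%:R - m%:R * marg P p| =
      \sum_(p in A) f p - \sum_(p in ~: A) f p.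
    rewrite (bigID (mem A)) /= -sumrN; congr (_ + _).
      by apply: eq_bigr => p; rewrite inE => pA; rewrite ger0_norm // subr_ge0.
    apply: eq_big => [p|p pA]; first by rewrite in_setC.
    by rewrite ler0_norm // subr_le0 ltW // ltNge; move: pA; rewrite inE.
  have : \sum_(p in A) f p + \sum_(p in ~: A) f p = 0.
    apply: etrans f0; rewrite [RHS](bigID (mem A)) /=; congr (_ + _).
    by apply: eq_bigl => p; rewrite in_setC.
  by lra.
rewrite Ex_sum; apply: (@le_trans _ _ (\sum_(A : {set Z * bool * bool}) expR (- (m%:R * t ^+ 2 / 4)))).
  apply: ler_sum => A _; apply: (hoeffding_count x0) => //; first exact: pmf_ge0.
    exact: pmf_sum1.
  rewrite /mean (sum_marg P (fun p => (p \in A)%:R)) [LHS]big_mkcond.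
  by apply: eq_bigr => p _; case: (p \in A); rewrite ?mulr1 ?mulr0.
rewrite sumr_const -[_ *+ #|_|]mulr_natl.
have -> : #|[pred A : {set Z * bool * bool} | true]| = (2 ^ (4 * #|Z|))%N.
  have -> : (4 * #|Z| = #|[set: Z * bool * bool]|)%N.
    by rewrite cardsT !card_prod card_bool -mulnA mulnC.
  by rewrite -card_powerset; apply: eq_card => A; rewrite !inE subsetT.
by rewrite natrX.
Qed.

End Empirical.

End CodedMarginal.

(** * A structured programming language *)

Local Close Scope ring_scope.

(* A structured language with immutable scoped variables (de Bruijn levels),
   unboundedly many cells in each of a few arrays, and counted loops.  VLow and
   VRLow read the memory below the virtual arrays: the input, and a buffer for
   the current sample. *)
Inductive vnexp : Type :=
  | VC of nat
  | VV of nat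
  | VA of nat & vnexp
  | VLow of vnexp
  | VAdd of vnexp & vnexp
  | VSub of vnexp & vnexp.

Inductive vrexp : Type :=
  | VRN of vnexp
  | VRA of nat & vnexp
  | VRLow of vnexp
  | VRAdd of vrexp & vrexp
  | VRSub of vrexp & vrexp
  | VRMul of vrexp & vrexp
  | VRDiv of vrexp & vrexp.

Inductive vbexp : Type :=
  | VLeN of vnexp & vnexp
  | VLeR of vrexp & vrexp
  | VNot of vbexp
  | VAnd of vbexp & vbexp.

Inductive vprog : Type :=
  | VSkip
  | VSetN of nat & vnexp & vnexp
  | VSetR of nat & vnexp & vrexp
  | VSample
  | VSeq of vprog & vprog
  | VIf of vbexp & vprog & vprog
  | VFor of nat & vprog
  | VLet of vnexp & vprog
  | VLeast of vbexp & vprog.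

Section VirtualSemantics.
Variables (R : realType) (n B : nat) (rlo : nat -> R) (xs : nat -> bits n).

Record vstore := VStore {
  lo : nat -> nat;
  arr : nat -> nat -> nat;
  rarr : nat -> nat -> R;
  sampled : nat }.

Implicit Types (env : seq nat) (S : vstore).

(* The index is truncated so that it cannot reach the virtual arrays. *)
Definition trunc (k : nat) : nat := (k - (k - (B + B - 1)))%N.

Fixpoint veval (e : vnexp) env S : nat :=
  match e with
  | VC k => k
  | VV k => nth 0%N env k
  | VA a e1 => arr S a (veval e1 env S)
  | VLow e1 => lo S (trunc (veval e1 env S))
  | VAdd e1 e2 => veval e1 env S + veval e2 env S
  | VSub e1 e2 => veval e1 env S - veval e2 env S
  end%N.

Fixpoint vreval (e : vrexp) env S : R :=
  match e with
  | VRN e1 => (veval e1 env S)%:R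
  | VRA a e1 => rarr S a (veval e1 env S)
  | VRLow e1 => rlo (trunc (veval e1 env S))
  | VRAdd e1 e2 => vreval e1 env S + vreval e2 env S
  | VRSub e1 e2 => vreval e1 env S - vreval e2 env S
  | VRMul e1 e2 => vreval e1 env S * vreval e2 env S
  | VRDiv e1 e2 => vreval e1 env S / vreval e2 env S
  end%R.

Fixpoint vbeval (e : vbexp) env S : bool :=
  match e with
  | VLeN e1 e2 => (veval e1 env S <= veval e2 env S)%N
  | VLeR e1 e2 => (vreval e1 env S <= vreval e2 env S)%R
  | VNot e1 => ~~ vbeval e1 env S
  | VAnd e1 e2 => vbeval e1 env S && vbeval e2 env S
  end.

Definition least (p : pred nat) : nat :=
  if pselect (exists k, p k) is left h then ex_minn h else 0.

Lemma leastP (p : pred nat) : (exists k, p k) ->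
  p (least p) /\ forall k, p k -> (least p <= k)%N.
Proof.
by rewrite /least => h; case: pselect => // h'; case: ex_minnP => m pm mm.
Qed.

Fixpoint vfor (b : nat) (f : nat -> vstore -> vstore) S : vstore :=
  if b is c.+1 then f c (vfor c f S) else S.

Definition upd2 (T : Type) (f : nat -> nat -> T) a i v : nat -> nat -> T :=
  upd f a (upd (f a) i v).

Fixpoint den (p : vprog) env S : vstore :=
  match p with
  | VSkip => S
  | VSetN a i e => VStore (lo S) (upd2 (arr S) a (veval i env S) (veval e env S))
                     (rarr S) (sampled S)
  | VSetR a i e => VStore (lo S) (arr S)
                     (upd2 (rarr S) a (veval i env S) (vreval e env S)) (sampled S)
  | VSample => VStore (write_bits (lo S) B (xs (sampled S))) (arr S) (rarr S) (sampled S).+1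
  | VSeq p q => den q env (den p env S)
  | VIf b p q => if vbeval b env S then den p env S else den q env S
  | VFor k p => vfor (nth 0%N env k) (fun i => den p (rcons env i)) S
  | VLet e p => den p (rcons env (veval e env S)) S
  | VLeast b p => den p (rcons env (least (fun k => vbeval b (rcons env k) S))) S
  end.

Fixpoint terminates (p : vprog) env S : Prop :=
  match p with
  | VSeq p q => terminates p env S /\ terminates q env (den p env S)
  | VIf b p q => if vbeval b env S then terminates p env S else terminates q env S
  | VFor k p => forall i, (i < nth 0%N env k)%N ->
      terminates p (rcons env i) (vfor i (fun i => den p (rcons env i)) S)
  | VLet e p => terminates p (rcons env (veval e env S)) S
  | VLeast b p => (exists k, vbeval b (rcons env k) S) /\
      terminates p (rcons env (least (fun k => vbeval b (rcons env k) S))) S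
  | _ => True
  end.

Fixpoint cost (p : vprog) env S : nat :=
  match p with
  | VSkip | VSetN _ _ _ | VSetR _ _ _ => 1
  | VSample => n.+1
  | VSeq p q => cost p env S + cost q env (den p env S)
  | VIf b p q => 1 + if vbeval b env S then cost p env S else cost q env S
  | VFor k p => 2 + \sum_(i < nth 0 env k)
      (2 + cost p (rcons env i) (vfor i (fun i => den p (rcons env i)) S))
  | VLet e p => 1 + cost p (rcons env (veval e env S)) S
  | VLeast b p => let k := least (fun k => vbeval b (rcons env k) S) in
      2 + 2 * k + cost p (rcons env k) S
  end%N.

Fixpoint static_cost (p : vprog) (pre : seq nat) : nat :=
  match p with
  | VSkip | VSetN _ _ _ | VSetR _ _ _ => 1
  | VSample => n.+1
  | VSeq p q => static_cost p pre + static_cost q pre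
  | VIf b p q => 1 + (static_cost p pre + static_cost q pre)
  | VFor k p => 2 + nth 0 pre k * (2 + static_cost p pre)
  | VLet e p => 1 + static_cost p pre
  | VLeast b p => 0
  end%N.

(** Every loop runs up to a variable bound outside the program, so that its cost is bounded in
    advance. [VLeast], whose cost depends on the data, is excluded and treated apart. *)
Fixpoint static_bounds (D : nat) (p : vprog) : bool :=
  match p with
  | VSeq p q | VIf _ p q => static_bounds D p && static_bounds D q
  | VFor k p => (k < D)%N && static_bounds D p
  | VLet e p => static_bounds D p
  | VLeast b p => false
  | _ => true
  end.

Lemma cost_le (pre rest : seq nat) p S : static_bounds (size pre) p ->
  (cost p (pre ++ rest) S <= static_cost p pre)%N.
Proof.
elim: p rest S => //= [p IHp q IHq|b p IHp q IHq|k p IHp|e p IHp] rest S.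
- by case/andP=> hp hq; apply: leq_add; [apply: IHp | apply: IHq].
- case/andP=> hp hq; rewrite leq_add2l; case: ifP => _.
    by apply: leq_trans (IHp _ _ hp) _; apply: leq_addr.
  by apply: leq_trans (IHq _ _ hq) _; apply: leq_addl.
- case/andP=> hk hp; rewrite leq_add2l nth_cat hk -[X in (_ <= X * _)%N]card_ord -sum_nat_const.
  by apply: leq_sum => i _; rewrite leq_add2l rcons_cat; apply: IHp.
- by move=> hp; rewrite ltnS rcons_cat; apply: IHp.
Qed.

Lemma static_terminates (D : nat) p env S : static_bounds D p -> terminates p env S.
Proof.
elim: p env S => //= [p IHp q IHq|b p IHp q IHq|k p IHp|e p IHp] env S.
- by case/andP=> hp hq; split; [apply: IHp | apply: IHq].
- by case/andP=> hp hq; case: ifP => _; [apply: IHp | apply: IHq].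
- by case/andP=> _ hp i _; apply: IHp.
- by move=> hp; apply: IHp.
Qed.

Fixpoint writes (p : vprog) : seq nat :=
  match p with
  | VSetN a _ _ => [:: a]
  | VSeq p q | VIf _ p q => writes p ++ writes q
  | VFor _ p | VLet _ p | VLeast _ p => writes p
  | _ => [::]
  end.

Fixpoint rwrites (p : vprog) : seq nat :=
  match p with
  | VSetR a _ _ => [:: a]
  | VSeq p q | VIf _ p q => rwrites p ++ rwrites q
  | VFor _ p | VLet _ p | VLeast _ p => rwrites p
  | _ => [::]
  end.

Fixpoint sample_free (p : vprog) : bool :=
  match p with
  | VSample => false
  | VSeq p q | VIf _ p q => sample_free p && sample_free q
  | VFor _ p | VLet _ p | VLeast _ p => sample_free p
  | _ => true
  end.

Lemma vfor_ind (Inv : nat -> vstore -> Prop) b f S : Inv 0 S ->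
  (forall i S', (i < b)%N -> Inv i S' -> Inv i.+1 (f i S')) -> Inv b (vfor b f S).
Proof.
move=> h0; elim: b => [|b IH] //= hS; apply: (hS) => //; apply: IH => i S' ib.
by apply: hS; apply: ltnW.
Qed.

Lemma frame_arr p env S a : a \notin writes p -> arr (den p env S) a = arr S a.
Proof.
elim: p env S => //= [b i e|p IHp q IHq|b p IHp q IHq|k p IHp|e p IHp|b p IHp] env S.
- by rewrite inE /upd2 /upd => /negbTE ->.
- by rewrite mem_cat negb_or => /andP[hp hq]; rewrite IHq // IHp.
- by rewrite mem_cat negb_or => /andP[hp hq]; case: ifP => _; [rewrite IHp | rewrite IHq].
- by move=> hp; apply: (@vfor_ind (fun _ S' => arr S' a = arr S a)) => // i S' _ <-; apply: IHp.
- exact: IHp.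
- exact: IHp.
Qed.

Lemma frame_rarr p env S a : a \notin rwrites p -> rarr (den p env S) a = rarr S a.
Proof.
elim: p env S => //= [b i e|p IHp q IHq|b p IHp q IHq|k p IHp|e p IHp|b p IHp] env S.
- by rewrite inE /upd2 /upd => /negbTE ->.
- by rewrite mem_cat negb_or => /andP[hp hq]; rewrite IHq // IHp.
- by rewrite mem_cat negb_or => /andP[hp hq]; case: ifP => _; [rewrite IHp | rewrite IHq].
- by move=> hp; apply: (@vfor_ind (fun _ S' => rarr S' a = rarr S a)) => // i S' _ <-; apply: IHp.
- exact: IHp.
- exact: IHp.
Qed.

Lemma frame_lo p env S : sample_free p -> lo (den p env S) = lo S.
Proof.
elim: p env S => //= [p IHp q IHq|b p IHp q IHq|k p IHp|e p IHp|b p IHp] env S.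
- by case/andP=> hp hq; rewrite IHq // IHp.
- by case/andP=> hp hq; case: ifP => _; [apply: IHp | apply: IHq].
- by move=> hp; apply: (@vfor_ind (fun _ S' => lo S' = lo S)) => // i S' _ <-; apply: IHp.
- exact: IHp.
- exact: IHp.
Qed.

Lemma frame_sampled p env S : sample_free p -> sampled (den p env S) = sampled S.
Proof.
elim: p env S => //= [p IHp q IHq|b p IHp q IHq|k p IHp|e p IHp|b p IHp] env S.
- by case/andP=> hp hq; rewrite IHq // IHp.
- by case/andP=> hp hq; case: ifP => _; [apply: IHp | apply: IHq].
- by move=> hp; apply: (@vfor_ind (fun _ S' => sampled S' = sampled S)) => // i S' _ <-; apply: IHp.
- exact: IHp.
- exact: IHp.
Qed.

Lemma frame_low p env S k : (k < B)%N -> lo (den p env S) k = lo S k.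
Proof.
move=> kB; elim: p env S => //= [|p IHp q IHq|b p IHp q IHq|j p IHp] env S.
- by rewrite /write_bits leqNgt kB.
- by rewrite IHq IHp.
- by case: ifP.
- by apply: (@vfor_ind (fun _ S' => lo S' k = lo S k)) => // i S' _ <-; apply: IHp.
Qed.

End VirtualSemantics.

(** * Compilation *)

Definition dbl (e : nexp) : nexp := NAdd e e.
Definition base : nexp := dbl (NGet (NConst 1)).
(** Sixteen arrays are interleaved above the base, four doublings giving the stride 16 without
    multiplication. Natural array 0 holds the scoped variables, hence the condition [0 < a] in [wfn]
    and [wfp]. *)
Definition cell_addr (a : nat) (i : nexp) : nexp :=
  NAdd base (NAdd (dbl (dbl (dbl (dbl i)))) (NConst a)).
Definition slot (k : nat) : nexp := cell_addr 0 (NConst k).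
Definition ctrunc (e : nexp) : nexp := NSub e (NSub e (NSub base (NConst 1))).

Fixpoint cnexp (e : vnexp) : nexp :=
  match e with
  | VC k => NConst k
  | VV k => NGet (slot k)
  | VA a e1 => NGet (cell_addr a (cnexp e1))
  | VLow e1 => NGet (ctrunc (cnexp e1))
  | VAdd e1 e2 => NAdd (cnexp e1) (cnexp e2)
  | VSub e1 e2 => NSub (cnexp e1) (cnexp e2)
  end.

Fixpoint crexp (e : vrexp) : rexp :=
  match e with
  | VRN e1 => RNat (cnexp e1)
  | VRA a e1 => RGet (cell_addr a (cnexp e1))
  | VRLow e1 => RGet (ctrunc (cnexp e1))
  | VRAdd e1 e2 => RAdd (crexp e1) (crexp e2)
  | VRSub e1 e2 => RSub (crexp e1) (crexp e2)
  | VRMul e1 e2 => RMul (crexp e1) (crexp e2)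
  | VRDiv e1 e2 => RDiv (crexp e1) (crexp e2)
  end.

Fixpoint cbexp (e : vbexp) : bexp :=
  match e with
  | VLeN e1 e2 => BLeN (cnexp e1) (cnexp e2)
  | VLeR e1 e2 => BLeR (crexp e1) (crexp e2)
  | VNot e1 => BNot (cbexp e1)
  | VAnd e1 e2 => BAnd (cbexp e1) (cbexp e2)
  end.

Fixpoint compile (p : vprog) (D : nat) : prog :=
  match p with
  | VSkip => Skip
  | VSetN a i e => SetN (cell_addr a (cnexp i)) (cnexp e)
  | VSetR a i e => SetR (cell_addr a (cnexp i)) (crexp e)
  | VSample => Sample (NGet (NConst 1))
  | VSeq p q => Seq (compile p D) (compile q D)
  | VIf b p q => If (cbexp b) (compile p D) (compile q D)
  | VFor k p => Seq (SetN (slot D) (NConst 0))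
      (While (BNot (BLeN (NGet (slot k)) (NGet (slot D))))
        (Seq (compile p D.+1) (SetN (slot D) (NAdd (NGet (slot D)) (NConst 1)))))
  | VLet e p => Seq (SetN (slot D) (cnexp e)) (compile p D.+1)
  | VLeast b p => Seq (SetN (slot D) (NConst 0))
      (Seq (While (BNot (cbexp b)) (SetN (slot D) (NAdd (NGet (slot D)) (NConst 1))))
        (compile p D.+1))
  end.

Fixpoint wfn (D : nat) (e : vnexp) : bool :=
  match e with
  | VC k => true
  | VV k => (k < D)%N
  | VA a e1 => (0 < a < 16)%N && wfn D e1
  | VLow e1 => wfn D e1
  | VAdd e1 e2 | VSub e1 e2 => wfn D e1 && wfn D e2
  end.

Fixpoint wfr (D : nat) (e : vrexp) : bool :=
  match e with
  | VRN e1 => wfn D e1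
  | VRA a e1 => (a < 16)%N && wfn D e1
  | VRLow e1 => wfn D e1
  | VRAdd e1 e2 | VRSub e1 e2 | VRMul e1 e2 | VRDiv e1 e2 => wfr D e1 && wfr D e2
  end.

Fixpoint wfb (D : nat) (e : vbexp) : bool :=
  match e with
  | VLeN e1 e2 => wfn D e1 && wfn D e2
  | VLeR e1 e2 => wfr D e1 && wfr D e2
  | VNot e1 => wfb D e1
  | VAnd e1 e2 => wfb D e1 && wfb D e2
  end.

Fixpoint wfp (D : nat) (p : vprog) : bool :=
  match p with
  | VSkip | VSample => true
  | VSetN a i e => [&& (0 < a < 16)%N, wfn D i & wfn D e]
  | VSetR a i e => [&& (a < 16)%N, wfn D i & wfr D e]
  | VSeq p q => wfp D p && wfp D q
  | VIf b p q => [&& wfb D b, wfp D p & wfp D q]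
  | VFor k p => (k < D)%N && wfp D.+1 p
  | VLet e p => wfn D e && wfp D.+1 p
  | VLeast b p => wfb D.+1 b && wfp D.+1 p
  end.

Section CompileCorrect.
Variables (R : realType) (n B : nat) (rlo : nat -> R).
Variables (xs : nat -> bits n) (rs : nat -> bool).
Hypothesis B1 : (1 < B)%N.
Hypothesis nB : (n <= B)%N.
Implicit Types (env : seq nat) (S : vstore R) (st : state R).
Local Notation den := (den B rlo xs).
Local Notation cost := (cost B rlo xs).
Local Notation terminates := (terminates B rlo xs).

Definition vaddr (a i : nat) : nat := (B + B + (16 * i + a))%N.

(** Addresses below [B] hold the input, those from [B] to [2 * B] contain the sample buffer, and the
    arrays follow. By [rep_base] cell 1 contains [B], from which compiled code finds the buffer and
    the arrays. *)
Record rep env S st : Prop := Rep {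
  rep_env : forall k, (k < size env)%N -> nmem st (vaddr 0 k) = nth 0%N env k;
  rep_arr : forall a i, (0 < a < 16)%N -> nmem st (vaddr a i) = arr S a i;
  rep_rarr : forall a i, (a < 16)%N -> rmem st (vaddr a i) = rarr S a i;
  rep_lo : forall k, (k < B + B)%N -> nmem st k = lo S k;
  rep_rlo : forall k, (k < B + B)%N -> rmem st k = rlo k;
  rep_base : lo S 1%N = B;
  rep_drawn : drawn st = sampled S }.

Lemma vaddr_inj a i b j : (a < 16)%N -> (b < 16)%N ->
  (vaddr a i == vaddr b j) = (a == b) && (i == j).
Proof. by rewrite /vaddr => *; apply/eqP/andP => [h|[/eqP -> /eqP ->] //]; split; lia. Qed.

Lemma vaddr_ge a i k : (k < B + B)%N -> (k == vaddr a i) = false.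
Proof. by rewrite /vaddr; lia. Qed.

Section Eval.
Variables (env : seq nat) (S : vstore R) (st : state R).
Hypothesis r : rep env S st.

Lemma base_eval : neval base st = (B + B)%N.
Proof. by rewrite /= (rep_lo r) ?(rep_base r) //; lia. Qed.

Lemma cell_addr_eval a e : neval (cell_addr a e) st = vaddr a (neval e st).
Proof.
have d e' : neval (dbl e') st = (neval e' st + neval e' st)%N by [].
rewrite -[LHS]/(neval base st + (neval (dbl (dbl (dbl (dbl e)))) st + a))%N base_eval !d.
by rewrite /vaddr; lia.
Qed.

Lemma slot_eval k : neval (slot k) st = vaddr 0 k.
Proof. by rewrite /slot cell_addr_eval. Qed.

Lemma ctrunc_eval e : neval (ctrunc e) st = trunc B (neval e st).
Proof. by rewrite /ctrunc -[LHS]/(neval e st - (neval e st - (neval base st - 1)))%N base_eval. Qed.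

Lemma trunc_lt k : (trunc B k < B + B)%N.
Proof. by rewrite /trunc; lia. Qed.

Lemma cnexp_eval e : wfn (size env) e -> neval (cnexp e) st = veval B e env S.
Proof.
elim: e => //= [k kD|a e IH /andP[aa we]|e IH we|e IHe f IHf /andP[we wf]|e IHe f IHf /andP[we wf]].
- by rewrite -[LHS]/(nmem st (neval (slot k) st)) slot_eval (rep_env r).
- by rewrite -[LHS]/(nmem st (neval (cell_addr a (cnexp e)) st)) cell_addr_eval (rep_arr r) // IH.
- by rewrite -[LHS]/(nmem st (neval (ctrunc (cnexp e)) st)) ctrunc_eval (rep_lo r) ?trunc_lt // IH.
- by rewrite IHe ?IHf.
- by rewrite IHe ?IHf.
Qed.

Lemma crexp_eval e : wfr (size env) e -> reval (crexp e) st = vreval B rlo e env S.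
Proof.
elim: e => /= [e we|a e /andP[aa we]|e we|e IHe f IHf /andP[we wf]|e IHe f IHf /andP[we wf]|
   e IHe f IHf /andP[we wf]|e IHe f IHf /andP[we wf]].
- by rewrite cnexp_eval.
- rewrite -[LHS]/(rmem st (neval (cell_addr a (cnexp e)) st)) cell_addr_eval (rep_rarr r) //.
  by rewrite cnexp_eval.
- rewrite -[LHS]/(rmem st (neval (ctrunc (cnexp e)) st)) ctrunc_eval (rep_rlo r) ?trunc_lt //.
  by rewrite cnexp_eval.
- by rewrite IHe ?IHf.
- by rewrite IHe ?IHf.
- by rewrite IHe ?IHf.
- by rewrite IHe ?IHf.
Qed.

Lemma cbexp_eval e : wfb (size env) e -> beval (cbexp e) st = vbeval B rlo e env S.
Proof.
elim: e => //= [e f /andP[we wf]|e f /andP[we wf]|e IHe we|e IHe f IHf /andP[we wf]].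
- by rewrite !cnexp_eval.
- by rewrite !crexp_eval.
- by rewrite IHe.
- by rewrite IHe ?IHf.
Qed.

Lemma rep_tick : rep env S (tick st).
Proof. by case: r => *; split. Qed.

Lemma rep_push v : rep (rcons env v) S
  (State (upd (nmem st) (neval (slot (size env)) st) v) (rmem st) (clock st).+1 (drawn st)
     (flipped st)).
Proof.
rewrite slot_eval; case: r => h1 h2 h3 h4 h5 h6 h7; split=> //=.
- move=> k; rewrite size_rcons ltnS /upd vaddr_inj // nth_rcons => kD /=.
  by case: eqP kD => [-> _|kne kD]; rewrite ?ltnn // h1 ?ifT //; lia.
- by move=> a i aa; rewrite /upd vaddr_inj //; [case: eqP aa => [->|_] //= /h2 | case/andP: aa].
- by move=> k kB; rewrite /upd vaddr_ge // h4.
Qed.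

End Eval.

Lemma rep_pop env v S st : rep (rcons env v) S st -> rep env S st.
Proof.
case=> h1 h2 h3 h4 h5 h6 h7; split=> // k kD.
by rewrite h1 ?size_rcons 1?ltnW // nth_rcons kD.
Qed.

Lemma rep_top env v S st : rep (rcons env v) S st ->
  nmem st (neval (slot (size env)) st) = v.
Proof.
move=> r; rewrite (slot_eval r) (rep_env r) ?size_rcons // nth_rcons ltnn eqxx //.
Qed.

Lemma rep_repush env v u S st : rep (rcons env v) S st ->
  rep (rcons env u) S (State (upd (nmem st) (neval (slot (size env)) st) u) (rmem st)
    (clock st).+1 (drawn st) (flipped st)).
Proof.
by move=> r; have := rep_push (rep_pop r) u.
Qed.

(** The clock is tracked exactly, so that time bounds can be proved on the structured program
    alone. *)
Theorem compile_correct p env S st : wfp (size env) p -> rep env S st ->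
  terminates p env S ->
  exists st', [/\ exec xs rs (compile p (size env)) st st', rep env (den p env S) st'
    & clock st' = (clock st + cost p env S)%N].
Proof.
elim: p env S st => [|a i e|a i e||p IHp q IHq|b p IHp q IHq|k p IHp|e p IHp|b p IHp] env S st /=.
- move=> _ r _; exists (tick st); split; [exact: ExecSkip | exact: rep_tick | by rewrite addn1].
- case/and3P=> /andP[a0 a16] wi we r _; eexists; split; first exact: ExecSetN.
    rewrite (cell_addr_eval r) (cnexp_eval r wi) (cnexp_eval r we).
    case: r => h1 h2 h3 h4 h5 h6 h7; split=> //= [k kD|b j bb|k kB].
    + by rewrite /upd vaddr_inj //; case: eqP a0 => [<-|_] //= _; apply: h1.
    + rewrite /upd2 /upd vaddr_inj //; last by case/andP: bb.
      by case: eqP => [->|_] /=; [case: eqP => // _; apply: h2; rewrite a0 | apply: h2].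
    + by rewrite /upd vaddr_ge // h4.
  by rewrite /= addn1.
- case/and3P=> a16 wi we r _; eexists; split; first exact: ExecSetR.
    rewrite (cell_addr_eval r) (cnexp_eval r wi) (crexp_eval r we).
    case: r => h1 h2 h3 h4 h5 h6 h7; split=> //= [b j bb|k kB].
    + rewrite /upd2 /upd vaddr_inj //.
      by case: eqP => [->|_] /=; [case: eqP => // _; apply: h3 | apply: h3].
    + by rewrite /upd vaddr_ge // h5.
  by rewrite /= addn1.
- move=> _ r _; eexists; split; first exact: ExecSample.
    case: (r) => h1 h2 h3 h4 h5 h6 h7.
    have eB : neval (NGet (NConst 1)) st = B by rewrite /= h4 ?h6 //; lia.
    have big m a i : write_bits m B (xs (sampled S)) (vaddr a i) = m (vaddr a i).
      rewrite /write_bits; case: ifP => // _; case: insubP => //= j jn _.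
      by move: jn; rewrite /vaddr; lia.
    rewrite eB h7; split=> //= [k kD|a i aa|k kB|].
    + by rewrite big h1.
    + by rewrite big h2.
    + by rewrite /write_bits h4.
    + by rewrite /write_bits leqNgt B1.
  by [].
- case/andP=> wp wq r [tp tq].
  have [st1 [e1 r1 c1]] := IHp _ _ _ wp r tp.
  have [st2 [e2 r2 c2]] := IHq _ _ _ wq r1 tq.
  by exists st2; split=> //; [apply: ExecSeq e1 e2 | rewrite c2 c1 addnA].
- case/and3P=> wb wp wq r; have rt := rep_tick r.
  case: ifP => hb t.
    have [st1 [e1 r1 c1]] := IHp _ _ _ wp rt t.
    by exists st1; split=> //; [apply: ExecIf; rewrite (cbexp_eval r) // hb | rewrite c1 /=; lia].
  have [st1 [e1 r1 c1]] := IHq _ _ _ wq rt t.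
  by exists st1; split=> //; [apply: ExecIf; rewrite (cbexp_eval r) // hb | rewrite c1 /=; lia].
- case/andP=> kD wp r t; set N := nth 0%N env k in t *.
  set f := fun i => den p (rcons env i) in t *.
  have r0 := rep_push r 0%N; set st0 := State _ _ _ _ _ in r0.
  have step i st1 : (i <= N)%N -> rep (rcons env i) (vfor i f S) st1 ->
    exists st', [/\ exec xs rs (While (BNot (BLeN (NGet (slot k)) (NGet (slot (size env)))))
        (Seq (compile p (size env).+1)
           (SetN (slot (size env)) (NAdd (NGet (slot (size env))) (NConst 1))))) st1 st',
      rep env (vfor N f S) st' &
      clock st' = (clock st1 + 1 + \sum_(i <= j < N) (2 + cost p (rcons env j) (vfor j f S)))%N].
    move: {2}(N - i)%N (erefl (N - i)%N) => m.
    have bv i' st' : rep (rcons env i') (vfor i' f S) st' ->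
        beval (BNot (BLeN (NGet (slot k)) (NGet (slot (size env))))) st' = (i' < N)%N.
      move=> r'; rewrite -[LHS]/(~~ (nmem st' (neval (slot k) st') <= nmem st' (neval (slot (size env)) st'))%N).
      rewrite (rep_top r') (slot_eval r') (rep_env (rep_pop r')) // -ltnNge //.
    elim: m i st1 => [|m IHm] i st1 Nm iN ri.
      have -> : i = N by lia.
      exists (tick st1); split; first by apply: ExecWhileEnd; rewrite (bv _ _ ri); lia.
        by apply: rep_tick; apply: rep_pop (i) _ _ _; have -> : N = i by lia.
      by rewrite big_geq //= !addn1 addn0.
    have iN' : (i < N)%N by lia.
    have [|st2 [e2 r2 c2]] := IHp (rcons env i) (vfor i f S) (tick st1) _ (rep_tick ri) (t i iN').
      by rewrite size_rcons.
    rewrite size_rcons in e2.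
    have r3 := rep_repush i.+1 r2; set st3 := State _ _ _ _ _ in r3.
    have [|st4 [e4 r4 c4]] := IHm i.+1 st3 _ iN' r3; first by lia.
    exists st4; split=> //.
      apply: ExecWhileStep e4; first by rewrite (bv _ _ ri).
      apply: ExecSeq e2 _; rewrite /st3 -[i.+1]addn1 -{1}(rep_top r2).
      exact: ExecSetN.
    by rewrite c4 (big_ltn iN') /st3 /= c2 /=; lia.
  have [//|st' [e' r' c']] := step 0%N st0 _ r0.
  exists st'; split=> //; first by apply: ExecSeq e'; exact: ExecSetN.
  by rewrite c' /st0 /= big_mkord addn1 addnA addn2.
- case/andP=> we wp r t.
  have r0 := rep_push r (veval B e env S).
  have [|st1 [e1 r1 c1]] := IHp _ _ _ _ r0 t; first by rewrite size_rcons.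
  exists st1; split; last by rewrite c1 /=; lia.
    rewrite size_rcons in e1; apply: ExecSeq e1; rewrite -(cnexp_eval r we); exact: ExecSetN.
  exact: rep_pop r1.
- case/andP=> wb wp r [ex t]; have [hk mk] := leastP ex.
  set K := least _ in t hk mk *.
  have r0 := rep_push r 0%N; set st0 := State _ _ _ _ _ in r0.
  have step i st1 : (i <= K)%N -> rep (rcons env i) S st1 ->
    exists st', [/\ exec xs rs (While (BNot (cbexp b))
        (SetN (slot (size env)) (NAdd (NGet (slot (size env))) (NConst 1)))) st1 st',
      rep (rcons env K) S st' & clock st' = (clock st1 + 1 + 2 * (K - i))%N].
    move: {2}(K - i)%N (erefl (K - i)%N) => m.
    have bv i' st' : rep (rcons env i') S st' ->
        beval (BNot (cbexp b)) st' = ~~ vbeval B rlo b (rcons env i') S.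
      by move=> r'; rewrite /= (cbexp_eval r') // size_rcons.
    elim: m i st1 => [|m IHm] i st1 Km iK ri.
      have iKe : i = K by lia.
      exists (tick st1); split; first by apply: ExecWhileEnd; rewrite (bv _ _ ri) iKe hk.
        by rewrite -iKe; apply: rep_tick.
      by rewrite /= Km; lia.
    have nb : ~~ vbeval B rlo b (rcons env i) S by apply/negP => /mk; lia.
    have r3 := rep_repush i.+1 (rep_tick ri); set st3 := State _ _ _ _ _ in r3.
    have [||//|st4 [e4 r4 c4]] := IHm i.+1 st3; [by lia | by lia|].
    exists st4; split=> //; last by rewrite c4 /st3 /=; lia.
    apply: ExecWhileStep e4; first by rewrite (bv _ _ ri).
    rewrite /st3 -[i.+1]addn1 -{1}(rep_top (rep_tick ri)); exact: ExecSetN.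
  have [//|st1 [e1 r1 c1]] := step 0%N st0 _ r0.
  have [|st2 [e2 r2 c2]] := IHp _ _ _ _ r1 t; first by rewrite size_rcons.
  rewrite size_rcons in e2; exists st2; split; last by rewrite c2 c1 /st0 /=; lia.
    by apply: ExecSeq (ExecSeq e1 e2); exact: ExecSetN.
  exact: rep_pop r2.
Qed.

End CompileCorrect.

(* Diagonal entries of the adjacency matrix are free cells: 2 and n + 3 are the
   first two of them. *)
Definition prelude : prog :=
  let c := NConst 2 in
  let b := NAdd (NGet (NConst 0)) (NConst 3) in
  Seq (SetN c (NAdd (dbl (NGet (NConst 0))) (NGet (NConst 1))))
  (Seq (SetN b (NConst 16))
  (Seq (While (BLeN (NConst 1) (NGet c))
         (Seq (SetN b (dbl (NGet b))) (SetN c (NSub (NGet c) (NConst 1)))))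
  (Seq (SetN (NAdd (dbl (NGet b)) (NConst 1)) (NGet (NConst 1)))
  (Seq (SetN (NConst 1) (NGet b))
       (SetN b (NConst 0)))))).

Definition machine (p : vprog) (out : nat) : prog :=
  Seq prelude (Seq (compile p 0) (SetN (NConst 0) (NGet (cell_addr out (NConst 0))))).

(** * Memory layout after the prelude, and runs of a compiled program *)

Section Machine.
Variables (R : realType) (n d : nat) (G : dag n) (Q : distr R n) (eps gamma : R).
Variables (xs : nat -> bits n) (rs : nat -> bool).
Hypothesis n1 : (1 < n)%N.

(** A power of two can be built by doubling alone, [n + n + d] times from 16. It exceeds the [n * n]
    and [n * 2 ^ d] entries of the input tables, and its size costs no time, as only the cells
    accessed are paid for. *)
Definition virtual_base : nat := 16 * 2 ^ (n + n + d).
Local Notation B := virtual_base.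
Local Notation rlo := (input_real d G Q eps gamma).

(** The prelude overwrites address 1, which contained [d], with [B], and saves [d] in cell 0 of
    array 1. All other array cells are zero because the input is zero that far out. *)
Definition init_store : vstore R :=
  VStore (upd (input_nat d G) 1 B) (fun a i => if (a == 1) && (i == 0) then d else 0)%N
    (fun _ _ => 0%R) 0.

Lemma base_gt : (n * n + n * 2 ^ d + n + 4 < B)%N.
Proof.
have h1 : (n < 2 ^ n)%N by rewrite ltn_expl.
have h2 : (0 < 2 ^ d)%N by rewrite expn_gt0.
have h3 : (n * n <= 2 ^ (n + n + d))%N.
  by rewrite !expnD -[(n * n)%N]muln1 !leq_mul // ltnW.
have h4 : (n * 2 ^ d <= 2 ^ (n + n + d))%N.
  rewrite !expnD leq_mul2r; apply/orP; right; rewrite -[n]muln1 leq_mul ?expn_gt0 // muln1.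
  exact: ltnW.
have h5 : (n <= n * n)%N by rewrite leq_pmulr; lia.
rewrite /B; lia.
Qed.

Lemma input_nat_high k : (n * n + 2 <= k)%N -> input_nat d G k = 0%N.
Proof.
case: k => [|[|k]] /=; [lia | lia |] => h.
by rewrite insubF // ltnNge leq_divRL; lia.
Qed.

Lemma input_nat_diag (i : nat) : (i < n)%N -> input_nat d G (i * n + i).+2 = 0%N.
Proof.
move=> iN /=; have n0 : (0 < n)%N by lia.
rewrite divnMDl // divn_small // addn0 modnMDl modn_small //.
rewrite !(insubT (fun m => m < n)%N iN) /=; set j := Sub _ _.
case jj: (j \in G j) => //; exfalso.
by have := @dag_acyclic n G [:: j]; rewrite /= andbT /edge jj => /(_ isT).
Qed.

Lemma input_real_high k : (n * 2 ^ d + 2 <= k)%N -> input_real d G Q eps gamma k = 0%R.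
Proof.
case: k => [|[|k]] /=; [lia | lia |] => h.
by rewrite insubF // ltnNge leq_divRL ?expn_gt0 //; lia.
Qed.

Lemma prelude_loop m (st : state R) : nmem st 0 = n -> nmem st 2 = m ->
  exists st', [/\ exec xs rs (While (BLeN (NConst 1) (NGet (NConst 2)))
    (Seq (SetN (NAdd (NGet (NConst 0)) (NConst 3)) (dbl (NGet (NAdd (NGet (NConst 0)) (NConst 3)))))
         (SetN (NConst 2) (NSub (NGet (NConst 2)) (NConst 1))))) st st',
    forall k, nmem st' k = if k == 2 then 0%N else
      if k == (n + 3)%N then (nmem st k * 2 ^ m)%N else nmem st k,
    rmem st' = rmem st, drawn st' = drawn st & clock st' = (clock st + (3 * m + 1))%N].
Proof.
elim: m st => [|m IH] st e0 e2.
  exists (tick st); split=> //; first by apply: ExecWhileEnd; rewrite /= e2.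
    by move=> k /=; rewrite muln1; case: eqP => [->|_] //; case: ifP.
  by rewrite /=; lia.
set a := NAdd (NGet (NConst 0)) (NConst 3).
pose st1 := State (upd (nmem st) (n + 3) (nmem st (n + 3) * 2)) (rmem st) (clock st).+2
   (drawn st) (flipped st).
have E1 : exec xs rs (SetN a (dbl (NGet a))) (tick st) st1.
  have := @ExecSetN R n xs rs a (dbl (NGet a)) (tick st).
  by rewrite /= e0 addnn -muln2.
pose st2 := State (upd (nmem st1) 2 m) (rmem st) (clock st).+3 (drawn st) (flipped st).
have E2 : exec xs rs (SetN (NConst 2) (NSub (NGet (NConst 2)) (NConst 1))) st1 st2.
  have := @ExecSetN R n xs rs (NConst 2) (NSub (NGet (NConst 2)) (NConst 1)) st1.
  rewrite /= /upd (_ : (2 == n + 3)%N = false); last by lia.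
  by rewrite e2 subn1.
have [||st' [E' m' r' d' c']] := IH st2.
- by rewrite /= /upd /= (_ : (0 == n + 3)%N = false) //; lia.
- by [].
exists st'; split=> //; last by rewrite c' /=; lia.
  by apply: ExecWhileStep E'; [rewrite /= e2 | apply: ExecSeq E1 E2].
move=> k; rewrite m' /= /upd; case: (k =P 2%N) => // _.
by case: (k =P (n + 3)%N) => // ->; rewrite expnS mulnA.
Qed.

Lemma prelude_correct : exists st,
  [/\ exec xs rs prelude (input d G Q eps gamma) st,
      rep B rlo [::] init_store st & clock st = (6 + 3 * (n + n + d))%N].
Proof.
have Bgt := base_gt.
have f3 : (2 == n + 3)%N = false by lia.
have f0 : (0 == n + 3)%N = false by lia.
have f1 : (1 == n + 3)%N = false by lia.
set st0 := input d G Q eps gamma.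
pose st1 := State (upd (nmem st0) 2 (n + n + d)) (rmem st0) 1 0 0.
pose b := NAdd (NGet (NConst 0)) (NConst 3).
have E1 : exec xs rs (SetN (NConst 2) (NAdd (dbl (NGet (NConst 0))) (NGet (NConst 1)))) st0 st1.
  exact: (@ExecSetN R n xs rs).
pose st2 := State (upd (nmem st1) (n + 3) 16) (rmem st0) 2 0 0.
have E2 : exec xs rs (SetN b (NConst 16)) st1 st2 by exact: (@ExecSetN R n xs rs).
have [||st3 [E3 m3 r3 d3 c3]] := @prelude_loop (n + n + d)%N st2.
- by rewrite /= /upd f0.
- by rewrite /= /upd f3.
have m30 : nmem st3 0 = n by rewrite m3 /= f0 /upd f0.
have m31 : nmem st3 1 = d by rewrite m3 /= f1 /upd f1.
have m3b : nmem st3 (n + 3) = B by rewrite m3 eqxx [_ == 2]eq_sym f3 /= /upd eqxx.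
pose st4 := State (upd (nmem st3) (B + B + 1) d) (rmem st3) (clock st3).+1 (drawn st3) (flipped st3).
have E4 : exec xs rs (SetN (NAdd (dbl (NGet b)) (NConst 1)) (NGet (NConst 1))) st3 st4.
  have := @ExecSetN R n xs rs (NAdd (dbl (NGet b)) (NConst 1)) (NGet (NConst 1)) st3.
  by rewrite /= m30 m3b m31.
have gB : (n + 3 == B + B + 1)%N = false by lia.
have gB0 : (0 == B + B + 1)%N = false by lia.
pose st5 := State (upd (nmem st4) 1 B) (rmem st3) (clock st3).+2 (drawn st3) (flipped st3).
have E5 : exec xs rs (SetN (NConst 1) (NGet b)) st4 st5.
  have := @ExecSetN R n xs rs (NConst 1) (NGet b) st4.
  by rewrite /= /upd gB0 m30 gB m3b.
pose st6 := State (upd (nmem st5) (n + 3) 0) (rmem st3) (clock st3).+3 (drawn st3) (flipped st3).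
have E6 : exec xs rs (SetN b (NConst 0)) st5 st6.
  have := @ExecSetN R n xs rs b (NConst 0) st5.
  by rewrite /= /upd /= gB0 m30.
exists st6; split; last by rewrite /= c3 /=; lia.
  apply: ExecSeq E1 _; apply: ExecSeq E2 _; apply: ExecSeq E3 _.
  by apply: ExecSeq E4 _; apply: ExecSeq E5 E6.
have high k : (B <= k)%N -> input_nat d G k = 0%N by move=> kB; apply: input_nat_high; lia.
split=> //.
- move=> a i /andP[a0 a16]; rewrite /= /upd /vaddr.
  rewrite (_ : (_ == n + 3)%N = false); last by lia.
  rewrite (_ : (_ == 1)%N = false); last by lia.
  case: (boolP ((a == 1) && (i == 0)))%N => [/andP[/eqP -> /eqP ->]|ai].
    by rewrite muln0 add0n eqxx.
  rewrite (_ : (_ == B + B + 1)%N = false); last by lia.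
  rewrite m3 /= /upd (_ : (_ == 2)%N = false); last by lia.
  rewrite (_ : (_ == n + 3)%N = false); last by lia.
  by rewrite high //; lia.
- by move=> a i a16; rewrite /= r3 /= input_real_high //; rewrite /vaddr; lia.
- move=> k kB; rewrite /= /upd.
  case: (k =P (n + 3)%N) => [->|kn].
    have := input_nat_diag n1; rewrite mul1n => h.
    have e : (n + 3 = (n + 1).+2)%N by lia.
    by rewrite [_ == 1%N]eq_sym f1 e h.
  case: (k =P 1%N) => // k1; rewrite (_ : (_ == B + B + 1)%N = false); last by lia.
  rewrite m3 /= /upd; case: (k =P 2%N) => [->|k2].
    by have /= -> // := @input_nat_diag 0; lia.
  by case: (k =P (n + 3)%N).
- by move=> k kB; rewrite /= r3.
Qed.

Lemma machine_run (p : vprog) (out : nat) : wfp 0 p -> (0 < out < 16)%N ->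
  terminates B rlo xs p [::] init_store ->
  exists st, [/\ exec xs rs (machine p out) (input d G Q eps gamma) st,
    verdict st = (arr (den B rlo xs p [::] init_store) out 0 != 0%N),
    drawn st = sampled (den B rlo xs p [::] init_store) &
    clock st = (7 + 3 * (n + n + d) + cost B rlo xs p [::] init_store)%N].
Proof.
move=> wp ho t; have [st1 [e1 r1 c1]] := prelude_correct.
have Bgt := base_gt; have B1 : (1 < B)%N by lia.
have nB : (n <= B)%N by lia.
have [st2 [e2 r2 c2]] := @compile_correct R n B rlo xs rs B1 nB p [::] _ _ wp r1 t.
eexists; split.
- by apply: ExecSeq e1 (ExecSeq e2 _); exact: ExecSetN.
- by rewrite /verdict -[nmem _ _]/(nmem st2 (neval (cell_addr out (NConst 0)) st2))
    (cell_addr_eval B1 nB r2) (rep_arr r2).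
- by rewrite /= (rep_drawn r2).
- by rewrite /= c2 c1; lia.
Qed.

End Machine.

(** * The tester *)

Declare Scope vprog_scope.
Delimit Scope vprog_scope with V.
Local Notation "p ;; q" := (VSeq p q) (at level 62, right associativity) : vprog_scope.
Local Open Scope vprog_scope.

Definition vincr a i := VSetN a i (VAdd (VA a i) (VC 1)).
Definition veqn e f := VAnd (VLeN e f) (VLeN f e).
Definition vadj i j := VLow (VAdd (VAdd (VC 2) (VA 4 i)) j).
Definition visadj i j := VLeN (VC 1) (vadj i j).
Definition vbit k := VLow (VAdd (VLow (VC 1)) k).
Definition vrc k := VRN (VC k).
Definition veps := VRLow (VC 0).
Definition vgamma := VRLow (VC 1).
Definition vif b p := VIf b p VSkip.

(* Variables: 0 n, 1 d, 2 d+2, 3 2^d, 4 n^(d+2), 5 log n, 6 the number of samples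
   of the structure test, 7 that of each of the other two phases, 8 the count
   threshold.  Natural arrays: 2 edge flag, 3 number of parental configurations,
   4 multiples of n, 5 stored samples, 6 current tuple, 7 carry, 8 marks of the
   conditioning set, 9 link flag, 10 counts of the structure test, 11 code,
   12 verdict, 13 multiples of 2^d, 14 counts of parental configurations, 15
   number of large counts.  Real arrays: 0 powers, 1 dependence statistic, 2
   partial sums, 3 U-statistic. *)

Definition config_code : vprog :=
  VSetN 11 (VC 0) (VC 0) ;;
  VFor 0 (let l := VSub (VSub (VV 0) (VC 1)) (VV 11) in
    vif (visadj (VV 10) l)
      (VSetN 11 (VC 0) (VAdd (VAdd (VA 11 (VC 0)) (VA 11 (VC 0))) (vbit l)))).

Definition count_configs : vprog :=
  VFor 7 (VSample ;; VFor 0 (config_code ;;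
    vincr 14 (VAdd (VA 13 (VV 10)) (VA 11 (VC 0))))).

Definition count_hits : vprog :=
  VFor 0 (VFor 3 (vif (VLeN (VV 8) (VA 14 (VAdd (VA 13 (VV 9)) (VV 10)))) (vincr 15 (VC 0)))).

(** For each node only the configuration shown by the sample is updated, [gval] being 0 at the
    others. With a code found in order [n] steps, a sample takes time of order [n ^ 2] instead of
    [n * 2 ^ d]. *)
Definition u_statistic : vprog :=
  VFor 7 (VSample ;; VFor 0 (config_code ;;
    VLet (VAdd (VA 13 (VV 10)) (VA 11 (VC 0)))
     (let q := VRLow (VAdd (VC 2) (VV 11)) in
      let g := VRSub (VRN (vbit (VV 10))) q in
      VSetR 3 (VC 0) (VRAdd (VRA 3 (VC 0))
        (VRMul (VRDiv (VRN (VV 7)) (VRMul (VRN (VA 14 (VV 11))) (VRMul q (VRSub (vrc 1) q))))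
               (VRMul g (VRA 2 (VV 11))))) ;;
      VSetR 2 (VV 11) (VRAdd (VRA 2 (VV 11)) g)))).

Definition store_samples : vprog :=
  VFor 6 (VSample ;;
    VFor 0 (VSetN 5 (VAdd (VA 4 (VV 9)) (VV 10)) (vbit (VV 10))) ;;
    VSetN 4 (VAdd (VV 9) (VC 1)) (VAdd (VA 4 (VV 9)) (VV 0))).

Definition dig r := VA 6 r.
Definition digi := dig (VC 0).
Definition digj := dig (VC 1).
Definition digt := dig (VAdd (VV 10) (VC 2)).

(** The first two digits of a tuple are [i] and [j]; the other [d] list the conditioning set,
    possibly with repetitions. Unmarking [i] and [j] at the end turns every tuple into a legal set
    of at most [d] nodes. *)
Definition mark_set : vprog :=
  VFor 0 (VSetN 8 (VV 10) (VC 0)) ;;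
  VFor 1 (VSetN 8 digt (VC 1)) ;;
  VSetN 8 digi (VC 0) ;; VSetN 8 digj (VC 0).

Definition check_linked : vprog :=
  let k := VV 10 in
  let inT := VLeN (VC 1) (VA 8 k) in
  VSetN 9 (VC 0) (vadj digj digi) ;;
  VFor 0 (vif (VAnd inT (VAnd (visadj k digi) (visadj k digj))) (VSetN 9 (VC 0) (VC 1)) ;;
    vif (VAnd (VNot inT) (VAnd (visadj k digi) (visadj digj k))) (VSetN 9 (VC 0) (VC 1)) ;;
    vif (VAnd (VNot inT) (VAnd (visadj digi k) (visadj digj k))) (VSetN 9 (VC 0) (VC 1))).

Definition four e := VAdd (VAdd e e) (VAdd e e).

Definition tuple_code : vprog :=
  VSetN 11 (VC 0) (VC 0) ;;
  VFor 1 (let t := dig (VAdd (VV 11) (VC 2)) in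
    VSetN 11 (VC 0) (VAdd (VA 11 (VC 0)) (VA 11 (VC 0))) ;;
    vif (VLeN (VC 1) (VA 8 t))
      (VSetN 11 (VC 0) (VAdd (VA 11 (VC 0)) (VA 5 (VAdd (VA 4 (VV 10)) t))))).

Definition count_cells : vprog :=
  VFor 3 (VSetN 10 (four (VV 10)) (VC 0) ;; VSetN 10 (VAdd (four (VV 10)) (VC 1)) (VC 0) ;;
    VSetN 10 (VAdd (four (VV 10)) (VC 2)) (VC 0) ;; VSetN 10 (VAdd (four (VV 10)) (VC 3)) (VC 0)) ;;
  VFor 6 (tuple_code ;;
    let xi := VA 5 (VAdd (VA 4 (VV 10)) digi) in
    let xj := VA 5 (VAdd (VA 4 (VV 10)) digj) in
    vincr 10 (VAdd (four (VA 11 (VC 0))) (VAdd (VAdd xi xi) xj))).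

Definition dep_statistic : vprog :=
  VSetR 1 (VC 0) (vrc 0) ;;
  VFor 3 (let c k := VRN (VA 10 (VAdd (four (VV 10)) (VC k))) in
    let num := VRSub (VRMul (c 3) (c 0)) (VRMul (c 2) (c 1)) in
    let den := VRAdd (VRAdd (VRAdd (c 3) (c 0)) (c 2)) (c 1) in
    VIf (VLeR (vrc 0) num)
      (VSetR 1 (VC 0) (VRAdd (VRA 1 (VC 0)) (VRDiv num den)))
      (VSetR 1 (VC 0) (VRSub (VRA 1 (VC 0)) (VRDiv num den)))).

Definition next_tuple : vprog :=
  VSetN 7 (VC 0) (VC 1) ;;
  VFor 2 (vif (VLeN (VC 1) (VA 7 (VC 0)))
    (vincr 6 (VV 10) ;;
     VIf (VLeN (VV 0) (dig (VV 10))) (VSetN 6 (VV 10) (VC 0)) (VSetN 7 (VC 0) (VC 0)))).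

(** The statistic is compared with [m0 * gamma / 4], half of the [m0 * gamma / 2] that nondegeneracy
    guarantees for the exact frequencies of [Q]. *)
Definition test_tuple : vprog :=
  mark_set ;; check_linked ;; count_cells ;; dep_statistic ;;
  vif (VAnd (VLeN (VC 1) (VA 9 (VC 0))) (VAnd (VNot (veqn digi digj))
        (VNot (VLeR (VRMul (VRN (VV 6)) vgamma) (VRMul (vrc 4) (VRA 1 (VC 0)))))))
    (VSetN 12 (VC 0) (VC 0)) ;;
  next_tuple.

(** For far [P] the mean of the U-statistic is at least [m ^ 2 * V / 8] with [V >= eps ^ 2 / 4],
    hence at least [m ^ 2 * eps ^ 2 / 32]; the threshold is half of this. *)
Definition decide : vprog :=
  VIf (VAnd (veqn (VA 15 (VC 0)) (VA 3 (VC 0)))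
         (VLeR (VRMul (vrc 64) (VRA 3 (VC 0)))
               (VRMul (VRMul (VRN (VV 7)) (VRN (VV 7))) (VRMul veps veps))))
    VSkip (VSetN 12 (VC 0) (VC 0)).

Definition test_body : vprog :=
  store_samples ;; VSetN 12 (VC 0) (VC 1) ;; VFor 4 test_tuple ;;
  count_configs ;; count_hits ;; u_statistic ;; decide.

(** Powers are computed in a real cell, the naturals having no multiplication; [VLeast] then counts
    up to the power to obtain it as a natural number. *)
Definition real_power k (e : vrexp) : vprog :=
  VSetR 0 (VC 0) (vrc 1) ;; VFor k (VSetR 0 (VC 0) (VRMul (VRA 0 (VC 0)) e)).

Definition scan_input : vprog :=
  VFor 0 (VSetN 4 (VAdd (VV 6) (VC 1)) (VAdd (VA 4 (VV 6)) (VV 0)) ;;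
          VSetN 13 (VAdd (VV 6) (VC 1)) (VAdd (VA 13 (VV 6)) (VV 3))) ;;
  VFor 0 (VSetN 3 (VC 1) (VC 1) ;;
    VFor 0 (vif (visadj (VV 6) (VV 7))
      (VSetN 3 (VC 1) (VAdd (VA 3 (VC 1)) (VA 3 (VC 1))) ;; VSetN 2 (VC 0) (VC 1))) ;;
    VSetN 3 (VC 0) (VAdd (VA 3 (VC 0)) (VA 3 (VC 1)))).

(* The sample sizes are found by counting, as the machine cannot round. *)
Definition big (k : nat) : vrexp := iter k (VRMul (vrc 1024)) (vrc 1).

Definition tester (c0 c1 c2 : nat) : vprog :=
  VLet (VLow (VC 0)) (VLet (VA 1 (VC 0)) (VLet (VAdd (VV 1) (VC 2)) (
  real_power 1 (vrc 2) ;; VLeast (VLeR (VRA 0 (VC 0)) (VRN (VV 3))) (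
  real_power 2 (VRN (VV 0)) ;; VLeast (VLeR (VRA 0 (VC 0)) (VRN (VV 4))) (
  VSetR 0 (VC 0) (vrc 1) ;; VFor 0 (VSetR 0 (VAdd (VV 5) (VC 1)) (VRMul (vrc 2) (VRA 0 (VV 5)))) ;;
  VLeast (VLeR (VRN (VV 0)) (VRA 0 (VV 5))) (
  scan_input ;;
  VLeast (VLeR (VRMul (VRN (VA 2 (VC 0))) (VRMul (big c0) (VRAdd (VRN (VV 3))
            (VRMul (VRN (VV 1)) (VRN (VV 5))))))
          (VRMul (VRN (VV 6)) (VRMul vgamma vgamma))) (
  VLeast (VLeR (VRMul (big c1) (VRMul (VRN (VV 0)) (VRN (VV 3))))
          (VRMul (VRMul (VRN (VV 7)) (VRN (VV 7)))
                 (VRMul (VRMul veps veps) (VRMul veps veps)))) (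
  VLeast (VLeR (VRMul (big c2) (VRN (VAdd (VAdd (VV 1) (VV 5)) (VC 1)))) (VRN (VV 8)))
    test_body)))))))).

Lemma tester_wf c0 c1 c2 : wfp 0 (tester c0 c1 c2).
Proof.
have wb k D : wfr D (big k) by elim: k.
by rewrite /tester /= !wb.
Qed.

(** * Loop invariants of the blocks of the tester *)

Section LeafSpecs.
Variables (R : realType) (n d : nat) (G : dag n) (Q : distr R n) (eps gamma : R).
Variable (xs : nat -> bits n).
Hypothesis n1 : (1 < n)%N.
Local Notation B := (virtual_base n d).
Local Notation rlo := (input_real d G Q eps gamma).
Local Notation den := (den B rlo xs).
Local Notation vstore := (vstore R).
Implicit Types S : vstore.

Definition nadj (i j : nat) : bool :=
  if insub i is Some i' then if insub j is Some j' then (j' : 'I_n) \in G i' else false else false.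

Definition nbit (x : bits n) (k : nat) : bool := if insub k is Some i then x i else false.

Record ctx (S : vstore) : Prop := Ctx {
  ctx_lo : forall k, (k < B)%N -> lo S k = if k == 1%N then B else input_nat d G k;
  ctx_mul : forall i, (i < n)%N -> arr S 4 i = (i * n)%N;
  ctx_mp : forall i, (i < n)%N -> arr S 13 i = (i * 2 ^ d)%N }.

Definition buffered (S : vstore) (x : bits n) :=
  forall k, (k < n)%N -> lo S (B + k)%N = nbit x k.

Lemma trunc_small k : (k < B + B)%N -> trunc B k = k.
Proof. by rewrite /trunc; lia. Qed.

Lemma vadj_eval S env e f i j : (forall k, (k < B)%N -> lo S k = if k == 1%N then B else input_nat d G k) ->
  (forall i, (i < n)%N -> arr S 4 i = (i * n)%N) ->
  veval B e env S = i -> veval B f env S = j -> (i < n)%N -> (j < n)%N ->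
  veval B (vadj e f) env S = nadj i j.
Proof.
move=> hlo hmul /= -> -> iN jN; have Bgt := base_gt d n1.
have h : (i * n + j < n * n)%N.
  apply: (@leq_trans (i * n + n)%N); first by rewrite ltn_add2l.
  by rewrite -mulSnr leq_mul2r iN orbT.
rewrite hmul // trunc_small; last by lia.
rewrite hlo; last by lia.
have -> : (2 + i * n + j = (i * n + j).+2)%N by lia.
rewrite /= divnMDl ?divn_small ?addn0 ?modnMDl ?modn_small //; last by lia.
by rewrite /nadj; case: (insub i) => [a|] //; case: (insub j).
Qed.

Lemma visadj_eval S env e f i j : ctx S ->
  veval B e env S = i -> veval B f env S = j -> (i < n)%N -> (j < n)%N ->
  vbeval B rlo (visadj e f) env S = nadj i j.
Proof.
case=> hlo hmul _ he hf iN jN; rewrite -[LHS]/(0 < veval B (vadj e f) env S)%N.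
by rewrite (vadj_eval hlo hmul he hf iN jN) lt0b.
Qed.

Lemma vbit_eval S env x e k : ctx S -> buffered S x -> veval B e env S = k -> (k < n)%N ->
  veval B (vbit e) env S = nbit x k.
Proof.
case=> hlo _ _ bx /= -> kN; have Bgt := base_gt d n1.
rewrite (trunc_small (k := 1)); last by lia.
rewrite (hlo 1%N); last by lia.
by rewrite /= trunc_small; [exact: bx | lia].
Qed.

Lemma ctx_frame S S' : ctx S -> (forall k, (k < B)%N -> lo S' k = lo S k) ->
  arr S' 4 = arr S 4 -> arr S' 13 = arr S 13 -> ctx S'.
Proof.
case=> h1 h2 h3 e1 e2 e3; split=> [k kB|i iN|i iN]; first by rewrite e1 ?h1.
  by rewrite e2 h2.
by rewrite e3 h3.
Qed.

Lemma ctx_den p env S : ctx S -> 4 \notin writes p -> 13 \notin writes p -> ctx (den p env S).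
Proof.
move=> c h4 h13; apply: (ctx_frame c).
- by move=> k kB; exact: frame_low.
- exact: frame_arr.
- exact: frame_arr.
Qed.

Lemma buffered_den p env S x : buffered S x -> sample_free p -> buffered (den p env S) x.
Proof. by move=> b sf k kn; rewrite frame_lo // b. Qed.

Lemma sample_buffered env S : buffered (den VSample env S) (xs (sampled S)).
Proof.
move=> k kn /=; rewrite /write_bits leq_addr addKn /nbit.
by rewrite (insubT (fun m => m < n)%N kn).
Qed.

Lemma sample_ctx env S : ctx S -> ctx (den VSample env S).
Proof. by move=> c; exact: ctx_den. Qed.

(** Horner's scheme over the nodes from the last to the first, so that the smallest parent gets the
    lowest binary digit, as in [decode_config]. *)
Fixpoint pcode_rec (i : nat) (x : bits n) (l : nat) : nat :=
  if l is l'.+1 then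
    let v := (n - 1 - l')%N in
    if nadj i v then (pcode_rec i x l' + pcode_rec i x l' + nbit x v)%N else pcode_rec i x l'
  else 0%N.

Definition pcode i x := pcode_rec i x n.

Variables (p2 nt lg m0 m1 T0 : nat).
Hypothesis p2E : p2 = (2 ^ d)%N.
Hypothesis pcode_lt : forall i x, (i < n)%N -> (pcode i x < p2)%N.
Definition params : seq nat := [:: n; d; (d + 2)%N; p2; nt; lg; m0; m1; T0].

Lemma config_code_spec S x s i : ctx S -> buffered S x -> (i < n)%N ->
  arr (den config_code (params ++ [:: s; i]) S) 11 0 = pcode i x.
Proof.
move=> c bx iN; rewrite /config_code.
set body := vif _ _; pose e l := params ++ [:: s; i; l].
suff : [/\ ctx (vfor n (fun l => den body (e l)) (den (VSetN 11 (VC 0) (VC 0)) (params ++ [:: s; i]) S)),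
   buffered (vfor n (fun l => den body (e l)) (den (VSetN 11 (VC 0) (VC 0)) (params ++ [:: s; i]) S)) x &
   arr (vfor n (fun l => den body (e l)) (den (VSetN 11 (VC 0) (VC 0)) (params ++ [:: s; i]) S)) 11 0
     = pcode i x] by case.
apply: (@vfor_ind R (fun l S' => [/\ ctx S', buffered S' x & arr S' 11 0 = pcode_rec i x l])).
  by split=> //; apply: ctx_den.
move=> l S' lN [c' b' e']; split; [exact: ctx_den | exact: buffered_den |].
have vN : (n - 1 - l < n)%N by lia.
rewrite /body /vif; set a := visadj _ _; set p := VSetN _ _ _.
rewrite -[den _ _ _]/(if vbeval B rlo a (e l) S' then den p (e l) S' else S').
rewrite (visadj_eval (i := i) (j := n - 1 - l) c') //.
case: ifP => h; last by rewrite e' /= h.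
have -> : arr (den p (e l) S') 11 0 = (arr S' 11 0 + arr S' 11 0 +
    veval B (vbit (VSub (VSub (VV 0) (VC 1)) (VV 11))) (e l) S')%N by [].
by rewrite (vbit_eval (k := (n - 1 - l)%N) c' b') // e' /= h.
Qed.

Lemma index_eq i z i' z' : (z < p2)%N -> (z' < p2)%N ->
  ((i * p2 + z)%N == (i' * p2 + z')%N) = (i == i') && (z == z').
Proof.
move=> zp zp'; apply/eqP/andP => [e|[/eqP -> /eqP ->] //].
have p0 : (0 < p2)%N by exact: leq_trans zp.
have e1 := congr1 (divn^~ p2) e; have e2 := congr1 (modn^~ p2) e.
by rewrite /= !divnMDl // !divn_small // !addn0 in e1; rewrite /= !modnMDl !modn_small // in e2; split; apply/eqP.
Qed.

Lemma count_configs_spec S : ctx S -> (forall j, arr S 14 j = 0%N) ->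
  sampled (den count_configs params S) = (sampled S + m1)%N /\
  forall i z, (i < n)%N -> (z < p2)%N ->
    arr (den count_configs params S) 14 (i * p2 + z) =
    (\sum_(s < m1) (pcode i (xs (sampled S + s)%N) == z))%N.
Proof.
move=> c0 z0.
pose Inv s S' := [/\ ctx S', sampled S' = (sampled S + s)%N &
  forall i z, (i < n)%N -> (z < p2)%N -> arr S' 14 (i * p2 + z) =
    (\sum_(k < s) (pcode i (xs (sampled S + k)%N) == z))%N].
pose q := config_code ;; vincr 14 (VAdd (VA 13 (VV 10)) (VA 11 (VC 0))).
suff : Inv m1 (den count_configs params S) by case.
apply: (@vfor_ind R Inv m1 (fun s => den (VSample ;; VFor 0 q) (params ++ [:: s]))).
  by split=> // [|i z iN zp]; rewrite ?addn0 ?z0 ?big_ord0.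
move=> s S' sm [c e h]; set x := xs (sampled S').
pose Inv2 i S2 := [/\ ctx S2, buffered S2 x, sampled S2 = (sampled S').+1 &
  forall i' z, (i' < n)%N -> (z < p2)%N -> arr S2 14 (i' * p2 + z) =
    (arr S' 14 (i' * p2 + z) + ((i' < i) && (pcode i' x == z)))%N].
have : Inv2 n (den (VSample ;; VFor 0 q) (params ++ [:: s]) S').
  apply: (@vfor_ind R Inv2 n (fun i => den q (params ++ [:: s; i]))
    (den VSample (params ++ [:: s]) S')).
    split=> // [||i' z _ _]; [exact: sample_ctx | exact: sample_buffered |].
    by rewrite /= addn0.
  move=> i S2 iN [c2 b2 e2 h2]; have := config_code_spec s c2 b2 iN.
  set S3 := den config_code _ _ => code3; have c3 : ctx S3 by exact: ctx_den.
  have e14 : arr S3 14 = arr S2 14 by exact: frame_arr.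
  split; [by apply: ctx_den | by apply: buffered_den | by rewrite frame_sampled |].
  move=> i' z iN' zp.
  have -> : arr (den q (params ++ [:: s; i]) S2) 14 = upd (arr S3 14)
     (arr S3 13 i + arr S3 11 0) (arr S3 14 (arr S3 13 i + arr S3 11 0) + 1)%N by [].
  rewrite code3 (ctx_mp c3) // -p2E /upd index_eq ?pcode_lt // e14.
  case: (i' =P i) => [->|ii] /=.
    rewrite !h2 ?pcode_lt // ltnn ltnSn /=.
    case: (z =P pcode i x) => [->|zc]; first by rewrite eqxx addn0.
    by case: eqP => [e'|_]; [case: zc | rewrite addn0].
  by rewrite h2 //; have -> : (i' < i.+1)%N = (i' < i)%N by lia.
case=> c2 b2 e2 h2; split=> // [|i z iN zp]; first by rewrite e2 e addnS.
by rewrite h2 // iN /= big_ord_recr /= h // /x e.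
Qed.

Lemma count_hits_spec S : ctx S -> arr S 15 0 = 0%N ->
  arr (den count_hits params S) 15 0 =
  (\sum_(i < n) \sum_(z < p2) (T0 <= arr S 14 (i * p2 + z)))%N.
Proof.
move=> c0 z0; pose F i z := (T0 <= arr S 14 (i * p2 + z))%N.
pose q := vif (VLeN (VV 8) (VA 14 (VAdd (VA 13 (VV 9)) (VV 10)))) (vincr 15 (VC 0)).
pose Inv i S' := [/\ ctx S', arr S' 14 = arr S 14 &
  arr S' 15 0 = (\sum_(j < i) \sum_(z < p2) F j z)%N].
suff : Inv n (den count_hits params S) by case.
apply: (@vfor_ind R Inv n (fun i => den (VFor 3 q) (params ++ [:: i]))).
  by split=> //; rewrite big_ord0.
move=> i S' iN [c e h].
pose Inv2 z S2 := [/\ ctx S2, arr S2 14 = arr S 14 &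
  arr S2 15 0 = (arr S' 15 0 + \sum_(y < z) F i y)%N].
have : Inv2 p2 (den (VFor 3 q) (params ++ [:: i]) S').
  apply: (@vfor_ind R Inv2 p2 (fun z => den q (params ++ [:: i; z]))).
    by split=> //; rewrite big_ord0 addn0.
  move=> z S2 zp [c2 e2 h2]; split; [exact: ctx_den | by rewrite frame_arr |].
  rewrite big_ord_recr /=.
  have -> : (T0 <= arr S2 14 (arr S2 13 i + z))%N = F i z by rewrite e2 (ctx_mp c2) // -p2E.
  by case: (F i z); rewrite /= ?h2 ?addnA ?addn0 // /upd2 /upd /= h2.
by case=> c2 e2 h2; split=> //; rewrite h2 h big_ord_recr.
Qed.

Local Open Scope ring_scope.

Definition pprob (i z : nat) : R := rlo (2 + (i * p2 + z))%N.

Definition gval (i z : nat) (x : bits n) : R :=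
  (pcode i x == z)%:R * ((nbit x i)%:R - pprob i z).

Lemma u_statistic_spec S : ctx S -> (forall j, rarr S 2 j = 0) -> rarr S 3 0%N = 0 ->
  let wgt i z := m1%:R / ((arr S 14 (i * p2 + z))%:R * (pprob i z * (1 - pprob i z))) in
  sampled (den u_statistic params S) = (sampled S + m1)%N /\
  rarr (den u_statistic params S) 3 0%N =
    \sum_(s < m1) \sum_(i < n) \sum_(z < p2) wgt i z *
      (gval i z (xs (sampled S + s)%N) * \sum_(t < s) gval i z (xs (sampled S + t)%N)).
Proof.
move=> c0 z2 z3 wgt.
pose old s i z := \sum_(t < s) gval i z (xs (sampled S + t)%N).
pose Inv s S' := [/\ ctx S', sampled S' = (sampled S + s)%N, arr S' 14 = arr S 14,
  forall i z, (i < n)%N -> (z < p2)%N -> rarr S' 2 (i * p2 + z)%N = old s i z &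
  rarr S' 3 0%N = \sum_(t < s) \sum_(i < n) \sum_(z < p2) wgt i z *
      (gval i z (xs (sampled S + t)%N) * old t i z)].
suff : Inv m1 (den u_statistic params S) by case.
pose q1 := let q := VRLow (VAdd (VC 2) (VV 11)) in
      let g := VRSub (VRN (vbit (VV 10))) q in
      VSetR 3 (VC 0) (VRAdd (VRA 3 (VC 0))
        (VRMul (VRDiv (VRN (VV 7)) (VRMul (VRN (VA 14 (VV 11))) (VRMul q (VRSub (vrc 1) q))))
               (VRMul g (VRA 2 (VV 11))))) ;;
      VSetR 2 (VV 11) (VRAdd (VRA 2 (VV 11)) g).
pose q := config_code ;; VLet (VAdd (VA 13 (VV 10)) (VA 11 (VC 0))) q1.
apply: (@vfor_ind R Inv m1 (fun s => den (VSample ;; VFor 0 q) (params ++ [:: s]))).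
  split=> //; rewrite ?addn0 ?big_ord0 //.
  by move=> i z iN zp; rewrite z2 /old big_ord0.
move=> s S' sm [c e e14 h hU]; set x := xs (sampled S').
have exs : x = xs (sampled S + s)%N by rewrite /x e.
pose Inv2 i S2 := [/\ ctx S2, buffered S2 x, sampled S2 = (sampled S').+1 /\ arr S2 14 = arr S 14,
  forall i' z, (i' < n)%N -> (z < p2)%N -> rarr S2 2 (i' * p2 + z)%N =
    old s i' z + (i' < i)%N%:R * gval i' z x &
  rarr S2 3 0%N = rarr S' 3 0%N + \sum_(i' < i) \sum_(z < p2) wgt i' z * (gval i' z x * old s i' z)].
have : Inv2 n (den (VSample ;; VFor 0 q) (params ++ [:: s]) S').
  apply: (@vfor_ind R Inv2 n (fun i => den q (params ++ [:: s; i]))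
    (den VSample (params ++ [:: s]) S')).
    split=> // [|||]; [exact: sample_ctx | exact: sample_buffered | | by rewrite big_ord0 addr0].
    by move=> i' z iN zp; rewrite ltn0 mul0r addr0 -h.
  move=> i S2 iN [c2 b2 [e2 e142] h2 hU2]; have := config_code_spec s c2 b2 iN.
  set S3 := den config_code _ _ => code3; have c3 : ctx S3 by exact: ctx_den.
  have b3 : buffered S3 x by exact: buffered_den.
  have r2 : rarr S3 2 = rarr S2 2 by exact: frame_rarr.
  have r3 : rarr S3 3 = rarr S2 3 by exact: frame_rarr.
  have a14 : arr S3 14 = arr S2 14 by exact: frame_arr.
  set idx := (i * p2 + pcode i x)%N; set env := params ++ [:: s; i; idx].
  have Eq : den q (params ++ [:: s; i]) S2 = den q1 env S3.
    rewrite /env /idx -code3 p2E -(ctx_mp c3 iN) //.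
  have Bgt := base_gt d n1; have pl := pcode_lt x iN.
  have idx_lt : (idx < n * 2 ^ d)%N.
    rewrite -p2E; apply: (@leq_trans (i * p2 + p2)%N); first by rewrite ltn_add2l.
    by rewrite -mulSnr leq_mul2r iN orbT.
  have rE : rlo (trunc B (2 + idx)) = pprob i (pcode i x).
    by rewrite trunc_small //; lia.
  have bE S4 : ctx S4 -> buffered S4 x -> veval B (vbit (VV 10)) env S4 = nbit x i.
    by move=> c4 b4; apply: vbit_eval.
  have g0 z : z != pcode i x -> gval i z x = 0.
    by move=> zc; rewrite /gval eq_sym (negbTE zc) mul0r.
  have gE : gval i (pcode i x) x = (nbit x i)%:R - pprob i (pcode i x).
    by rewrite /gval eqxx mul1r.
  have hidx : rarr S3 2 idx = old s i (pcode i x).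
    by rewrite r2 h2 // ltnn mul0r addr0.
  rewrite Eq; split; [by apply: ctx_den | by apply: buffered_den | | |].
  - by split; [rewrite frame_sampled // /S3 frame_sampled | rewrite frame_arr // a14].
  - move=> i' z iN' zp.
    have -> : rarr (den q1 env S3) 2 = upd (rarr S3 2) idx (rarr S3 2 idx +
        ((veval B (vbit (VV 10)) env (den (VSetR 3 (VC 0) (VRN (VC 0))) env S3))%:R
           - rlo (trunc B (2 + idx)))) by [].
    rewrite bE; [|exact: ctx_den|exact: buffered_den].
    rewrite rE /upd index_eq // hidx -gE r2.
    case: (i' =P i) => [->|ii] /=.
      rewrite ltnSn mul1r; case: (z =P pcode i x) => [->//|/eqP zc].
      by rewrite h2 // ltnn mul0r g0.
    by rewrite h2 //; have -> : (i' < i.+1)%N = (i' < i)%N by lia.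
  have -> : rarr (den q1 env S3) 3 0%N = rarr S3 3 0%N +
     m1%:R / ((arr S3 14 idx)%:R * (rlo (trunc B (2 + idx)) * (1%:R - rlo (trunc B (2 + idx))))) *
     (((veval B (vbit (VV 10)) env S3)%:R - rlo (trunc B (2 + idx))) * rarr S3 2 idx) by [].
  rewrite bE // rE hidx -gE r3 hU2 big_ord_recr /= addrA; congr (_ + _).
  rewrite (bigD1 (Ordinal pl)) //= big1 ?addr0 ?a14 ?e142 // => z zc.
  by rewrite g0 ?mul0r ?mulr0.
case=> c2 b2 [e2 e142] h2 hU2; split=> // [|i z iN zp|]; first by rewrite e2 e addnS.
  by rewrite h2 // iN mul1r /old big_ord_recr /= exs.
by rewrite hU2 big_ord_recr /= hU exs.
Qed.

Local Close Scope ring_scope.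

Section StructurePhase.
Variable w : nat -> bits n.

Record sctx (S : vstore) : Prop := Sctx {
  sctx_ctx : ctx S;
  sctx_mul : forall t, (t < m0)%N -> arr S 4 t = (t * n)%N;
  sctx_smp : forall t k, (t < m0)%N -> (k < n)%N -> arr S 5 (t * n + k) = nbit (w t) k }.

Lemma sctx_den p env S : sctx S -> 4 \notin writes p -> 13 \notin writes p ->
  5 \notin writes p -> sctx (den p env S).
Proof.
case=> c h1 h2 h4 h13 h5; split; first exact: ctx_den.
  by move=> t tm; rewrite frame_arr // h1.
by move=> t k tm kn; rewrite frame_arr // h2.
Qed.

Lemma mul_index_eq i k i' k' : (k < n)%N -> (k' < n)%N ->
  ((i * n + k)%N == (i' * n + k')%N) = (i == i') && (k == k').
Proof.
move=> kp kp'; apply/eqP/andP => [e|[/eqP -> /eqP ->] //].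
have n0 : (0 < n)%N by exact: leq_trans kp.
have e1 := congr1 (divn^~ n) e; have e2 := congr1 (modn^~ n) e.
by rewrite /= !divnMDl // !divn_small // !addn0 in e1; rewrite /= !modnMDl !modn_small // in e2; split; apply/eqP.
Qed.

Lemma store_samples_spec S : ctx S -> (forall t, w t = xs (sampled S + t)%N) ->
  sctx (den store_samples params S) /\
  sampled (den store_samples params S) = (sampled S + m0)%N.
Proof.
move=> c0 wE.
pose Inv s S' := [/\ ctx S', sampled S' = (sampled S + s)%N,
  forall t, (t <= s)%N -> arr S' 4 t = (t * n)%N &
  forall t k, (t < s)%N -> (k < n)%N -> arr S' 5 (t * n + k) = nbit (w t) k].
suff : Inv m0 (den store_samples params S).
  by case=> c e h1 h2; split=> //; split=> // t tm; apply: h1; apply: ltnW.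
pose q := VSetN 5 (VAdd (VA 4 (VV 9)) (VV 10)) (vbit (VV 10)).
pose q2 := VSetN 4 (VAdd (VV 9) (VC 1)) (VAdd (VA 4 (VV 9)) (VV 0)).
apply: (@vfor_ind R Inv m0 (fun s => den (VSample ;; VFor 0 q ;; q2) (params ++ [:: s]))).
  split=> // [|t]; first by rewrite addn0.
  by rewrite leqn0 => /eqP ->; rewrite (ctx_mul c0) //; lia.
move=> s S' sm [c e hm hx]; set env := params ++ [:: s].
have := sample_ctx env c; have := sample_buffered env S'.
set Sa := den VSample env S' => ba ca.
have xE : xs (sampled S') = w s by rewrite wE e.
pose Inv2 k S2 := [/\ ctx S2, buffered S2 (w s), arr S2 4 = arr S' 4, sampled S2 = sampled Sa &
  forall t j, (t < s.+1)%N -> (j < n)%N -> (t < s)%N || (j < k)%N ->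
     arr S2 5 (t * n + j) = nbit (w t) j].
have : Inv2 n (den (VFor 0 q) env Sa).
  apply: (@vfor_ind R Inv2 n (fun k => den q (params ++ [:: s; k]))).
    split=> //; first by rewrite -xE.
    by move=> t j ts jn; rewrite ltn0 orbF => ts'; rewrite /Sa frame_arr // hx.
  move=> k S2 kn [c2 b2 e2 sa2 h2]; split; [exact: ctx_den | exact: buffered_den | | |] => //.
  move=> t j ts jn hj.
  have -> : arr (den q (params ++ [:: s; k]) S2) 5 =
      upd (arr S2 5) (arr S2 4 s + k)%N (veval B (vbit (VV 10)) (params ++ [:: s; k]) S2) by [].
  rewrite (vbit_eval c2 b2 (k := k)) // e2 hm // /upd mul_index_eq //.
  case: (t =P s) => [et|tns] /=; last by apply: h2 => //; apply/orP; left; lia.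
  rewrite et in hj ts *.
  by case: (j =P k) => [->|jk] //=; apply: h2 => //; apply/orP; right; lia.
set Sb := den _ _ _; case=> cb bb eb sb hb; rewrite /Inv.
have -> : den (VSample;; VFor 0 q;; q2) env S' = den q2 env Sb by [].
have a4 : arr (den q2 env Sb) 4 = upd (arr Sb 4) (s + 1)%N (arr Sb 4 s + n)%N by [].
have a4' t : (t <= s.+1)%N -> arr (den q2 env Sb) 4 t = (t * n)%N.
  move=> ts; rewrite a4 /upd eb; case: eqP => [->|tn]; last by apply: hm; lia.
  by rewrite hm // addn1 mulSnr.
split.
- have [h1 h2 h3] := cb; split=> // i iN; rewrite a4 /upd.
  by case: eqP => [->|_]; [rewrite eb hm // addn1 mulSnr | exact: h2].
- by rewrite /= sb /= e addnS.
- exact: a4'.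
- by move=> t k ts kn; rewrite frame_arr // hb // kn orbT.
Qed.

Variable dg : nat -> nat.
Hypothesis dg_lt : forall r, (r < d + 2)%N -> (dg r < n)%N.

Definition tmask (k : nat) : bool :=
  [&& has (fun r => dg (r + 2) == k) (iota 0 d), k != dg 0%N & k != dg 1%N].

Definition nlinked : bool :=
  nadj (dg 1) (dg 0) || has (fun k =>
    [|| tmask k && (nadj k (dg 0) && nadj k (dg 1)),
        ~~ tmask k && (nadj k (dg 0) && nadj (dg 1) k) |
        ~~ tmask k && (nadj (dg 0) k && nadj (dg 1) k)]) (iota 0 n).

Fixpoint tcode_rec (x : bits n) (r : nat) : nat :=
  if r is r'.+1 then (tcode_rec x r' + tcode_rec x r' + (tmask (dg (r' + 2)) && nbit x (dg (r' + 2))))%N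
  else 0%N.

Definition tcode x := tcode_rec x d.

Lemma tcode_lt x : (tcode x < p2)%N.
Proof.
rewrite p2E /tcode; elim: d => [|r IH] //=; rewrite expnS.
by case: (_ && _); lia.
Qed.

Definition tcell (x : bits n) : nat := (nbit x (dg 0) + nbit x (dg 0) + nbit x (dg 1))%N.

Definition tcount (z c : nat) : nat :=
  \sum_(s < m0) ((tcode (w s) == z) && (tcell (w s) == c)).

Definition tstat : R := (\sum_(z < p2)
  det_ratio (tcount z 3)%:R (tcount z 0)%:R (tcount z 2)%:R (tcount z 1)%:R)%R.

Definition digits (S : vstore) := forall r, (r < d + 2)%N -> arr S 6 r = dg r.

Lemma digits_den p env S : digits S -> 6 \notin writes p -> digits (den p env S).
Proof. by move=> h h6 r rd; rewrite frame_arr // h. Qed.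

Variable u : nat.
Local Notation env0 := (params ++ [:: u]).

Definition marked (S : vstore) := forall k, (k < n)%N -> arr S 8 k = tmask k.

Lemma marked_den p env S : marked S -> 8 \notin writes p -> marked (den p env S).
Proof. by move=> h h8 k kn; rewrite frame_arr // h. Qed.

Lemma mark_set_spec S : digits S -> marked (den mark_set env0 S).
Proof.
move=> hd; rewrite /mark_set.
set p1 := VFor 0 _; set p2' := VFor 1 _; set p3 := VSetN _ digi _; set p4 := VSetN _ digj _.
have -> : den (p1;; p2';; p3;; p4) env0 S = den p4 env0 (den p3 env0 (den p2' env0 (den p1 env0 S))) by [].
set S1 := den p1 env0 S; set S2 := den p2' _ _; set S3 := den p3 _ _.
have d1 : digits S1 by exact: digits_den.
have d2 : digits S2 by exact: digits_den.
have d3 : digits S3 by exact: digits_den.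
have h1 k : (k < n)%N -> arr S1 8 k = 0%N.
  pose Inv i S' := forall k, (k < i)%N -> arr S' 8 k = 0%N.
  suff : Inv n S1 by apply.
  apply: (@vfor_ind R Inv n (fun k => den (VSetN 8 (VV 10) (VC 0)) (params ++ [:: u; k]))) => //.
  move=> i S' iN IH j ji.
  rewrite -[LHS]/(upd (arr S' 8) i 0%N j) /upd.
  by case: eqP => // ne; apply: IH; lia.
have h2 k : (k < n)%N -> arr S2 8 k = has (fun r => dg (r + 2) == k) (iota 0 d).
  pose Inv r S' := digits S' /\ forall k, (k < n)%N -> arr S' 8 k = has (fun r => dg (r + 2) == k) (iota 0 r).
  suff : Inv d S2 by case=> _; apply.
  apply: (@vfor_ind R Inv d (fun r => den (VSetN 8 digt (VC 1)) (params ++ [:: u; r]))).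
    by split=> // j jn; rewrite h1.
  move=> r S' rd [dS' IH]; split; first exact: digits_den.
  move=> j jn; rewrite -[LHS]/(upd (arr S' 8) (arr S' 6 (r + 2)) 1%N j) dS'; last by lia.
  by rewrite /upd -[r.+1]addn1 iotaD has_cat /= orbF add0n IH // [_ == j]eq_sym; case: eqP; rewrite ?orbT ?orbF.
move=> k kn.
rewrite -[LHS]/(upd (arr S3 8) (arr S3 6 1) 0%N k) d3; last by lia.
rewrite /upd /tmask; case: (k =P dg 1) => [_|_] /=; first by rewrite !andbF.
rewrite -[LHS]/(upd (arr S2 8) (arr S2 6 0) 0%N k) d2; last by lia.
by rewrite /upd; case: (k =P dg 0) => [_|_] /=; rewrite ?andbF ?andbT // h2.
Qed.

Lemma check_linked_spec S : sctx S -> digits S -> marked S ->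
  (0 < arr (den check_linked env0 S) 9 0)%N = nlinked.
Proof.
move=> c hd hm.
pose f k := [|| tmask k && (nadj k (dg 0) && nadj k (dg 1)),
        ~~ tmask k && (nadj k (dg 0) && nadj (dg 1) k) |
        ~~ tmask k && (nadj (dg 0) k && nadj (dg 1) k)].
pose Inv k S' := [/\ sctx S', digits S', marked S' &
  (0 < arr S' 9 0)%N = nadj (dg 1) (dg 0) || has f (iota 0 k)].
pose k := VV 10; pose inT := VLeN (VC 1) (VA 8 k); pose set9 := VSetN 9 (VC 0) (VC 1).
pose q1 := vif (VAnd inT (VAnd (visadj k digi) (visadj k digj))) set9.
pose q2 := vif (VAnd (VNot inT) (VAnd (visadj k digi) (visadj digj k))) set9.
pose q3 := vif (VAnd (VNot inT) (VAnd (visadj digi k) (visadj digj k))) set9.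
have dl0 : (dg 0 < n)%N by apply: dg_lt; lia.
have dl1 : (dg 1 < n)%N by apply: dg_lt; lia.
suff : Inv n (den check_linked env0 S) by case.
apply: (@vfor_ind R Inv n (fun k => den (q1 ;; q2 ;; q3) (params ++ [:: u; k]))
  (den (VSetN 9 (VC 0) (vadj digj digi)) env0 S)).
  have [hlo hmul _] := sctx_ctx c.
  split; [exact: sctx_den | exact: digits_den | exact: marked_den |].
  rewrite -[LHS]/(0 < veval B (vadj digj digi) env0 S)%N.
  rewrite (vadj_eval hlo hmul (i := dg 1) (j := dg 0)) ?lt0b ?orbF //.
    by rewrite /= hd //; lia.
  by rewrite /= hd //; lia.
move=> j S' jn [c' d' m' h']; split; [exact: sctx_den | exact: digits_den | exact: marked_den |].
rewrite -[j.+1]addn1 iotaD has_cat [has _ [:: _]]/= orbF add0n orbA -h'; cbv beta.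
set env := params ++ [:: u; j].
have step b S2 : sctx S2 -> digits S2 -> marked S2 ->
  arr (den (vif b set9) env S2) 9 0 = if vbeval B rlo b env S2 then 1%N else arr S2 9 0.
  by move=> _ _ _ /=; case: ifP.
have -> : den (q1;; q2;; q3) env S' = den q3 env (den q2 env (den q1 env S')) by [].
set Sq1 := den q1 env S'; set Sq2 := den q2 env Sq1.
have c1 : sctx Sq1 by exact: sctx_den.
have c2 : sctx Sq2 by exact: sctx_den.
have e1 : digits Sq1 by exact: digits_den.
have e2 : digits Sq2 by exact: digits_den.
have g1 : marked Sq1 by exact: marked_den.
have g2 : marked Sq2 by exact: marked_den.
have tE S2 : marked S2 -> vbeval B rlo inT env S2 = tmask j.
  by move=> g; rewrite -[LHS]/(0 < arr S2 8 j)%N g // lt0b.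
have aE S2 e f' i1 i2 : sctx S2 -> veval B e env S2 = i1 -> veval B f' env S2 = i2 ->
    (i1 < n)%N -> (i2 < n)%N -> vbeval B rlo (visadj e f') env S2 = nadj i1 i2.
  by move=> cc *; apply: visadj_eval => //; exact: sctx_ctx.
have iE S2 : digits S2 -> veval B digi env S2 = dg 0 by move=> h; rewrite /= h //; lia.
have jE S2 : digits S2 -> veval B digj env S2 = dg 1 by move=> h; rewrite /= h //; lia.
have kE S2 : veval B k env S2 = j by [].
have AndE b b' S2 : vbeval B rlo (VAnd b b') env S2 = vbeval B rlo b env S2 && vbeval B rlo b' env S2 by [].
have NotE b S2 : vbeval B rlo (VNot b) env S2 = ~~ vbeval B rlo b env S2 by [].
rewrite /q3 step // !(AndE, NotE) tE // (aE _ _ _ (dg 0) j c2) ?iE //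
   (aE _ _ _ (dg 1) j c2) ?jE //.
rewrite /Sq2 /q2 step // !(AndE, NotE) tE // (aE _ _ _ j (dg 0) c1) ?iE //
   (aE _ _ _ (dg 1) j c1) ?jE //.
rewrite /Sq1 /q1 step // !(AndE, NotE) tE // (aE _ _ _ j (dg 0) c') ?iE //
   (aE _ _ _ j (dg 1) c') ?jE //.
rewrite /f.
by case: (tmask j) (nadj j (dg 0)) (nadj j (dg 1)) (nadj (dg 1) j) (nadj (dg 0) j)
  => [] [] [] [] []; rewrite /= ?orbT ?orbF.
Qed.

Lemma smp_eval S s e k env : sctx S -> (s < m0)%N -> nth 0%N env 10 = s ->
  veval B e env S = k -> (k < n)%N ->
  veval B (VA 5 (VAdd (VA 4 (VV 10)) e)) env S = nbit (w s) k.
Proof. by move=> [_ h1 h2] sm /= -> -> kn; rewrite h1 ?h2. Qed.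

Lemma tuple_code_spec S s : sctx S -> digits S -> marked S -> (s < m0)%N ->
  arr (den tuple_code (params ++ [:: u; s]) S) 11 0 = tcode (w s).
Proof.
move=> c hd hm sm.
pose Inv r S' := [/\ sctx S', digits S', marked S' & arr S' 11 0 = tcode_rec (w s) r].
pose t := dig (VAdd (VV 11) (VC 2)).
pose q1 := VSetN 11 (VC 0) (VAdd (VA 11 (VC 0)) (VA 11 (VC 0))).
pose q2 := vif (VLeN (VC 1) (VA 8 t))
      (VSetN 11 (VC 0) (VAdd (VA 11 (VC 0)) (VA 5 (VAdd (VA 4 (VV 10)) t)))).
suff : Inv d (den tuple_code (params ++ [:: u; s]) S) by case.
apply: (@vfor_ind R Inv d (fun r => den (q1 ;; q2) (params ++ [:: u; s; r]))
  (den (VSetN 11 (VC 0) (VC 0)) (params ++ [:: u; s]) S)).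
  by split; [exact: sctx_den | exact: digits_den | exact: marked_den |].
move=> r S' rd [c' d' m' h']; split; [exact: sctx_den | exact: digits_den | exact: marked_den |].
set env := params ++ _.
have -> : den (q1 ;; q2) env S' = den q2 env (den q1 env S') by [].
set S1 := den q1 env S'.
have c1 : sctx S1 by exact: sctx_den.
have d1 : digits S1 by exact: digits_den.
have m1' : marked S1 by exact: marked_den.
have e1 : arr S1 11 0 = (tcode_rec (w s) r + tcode_rec (w s) r)%N by rewrite /S1 /= /upd2 /upd /= h'.
have dl : (dg (r + 2) < n)%N by apply: dg_lt; lia.
have tE : veval B t env S1 = dg (r + 2) by rewrite -[LHS]/(arr S1 6 (r + 2)) d1 //; lia.
have -> : arr (den q2 env S1) 11 0 = if (0 < arr S1 8 (veval B t env S1))%N then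
   (arr S1 11 0 + veval B (VA 5 (VAdd (VA 4 (VV 10)) t)) env S1)%N else arr S1 11 0.
  by rewrite /q2 /=; case: ifP.
rewrite (smp_eval c1 sm _ tE) // tE m1' // lt0b e1 /=.
by case: (tmask _); rewrite /= ?addn0.
Qed.

Lemma four_eval e env S : veval B (four e) env S = (4 * veval B e env S)%N.
Proof. by rewrite /=; lia. Qed.

Lemma count_cells_spec S : sctx S -> digits S -> marked S ->
  forall z c, (z < p2)%N -> (c < 4)%N ->
  arr (den count_cells env0 S) 10 (4 * z + c) = tcount z c.
Proof.
move=> c0 d0 k0.
pose q0 := VSetN 10 (four (VV 10)) (VC 0) ;; VSetN 10 (VAdd (four (VV 10)) (VC 1)) (VC 0) ;;
    VSetN 10 (VAdd (four (VV 10)) (VC 2)) (VC 0) ;; VSetN 10 (VAdd (four (VV 10)) (VC 3)) (VC 0).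
set S0 := den (VFor 3 q0) env0 S.
have z0 z c : (z < p2)%N -> (c < 4)%N -> arr S0 10 (4 * z + c) = 0%N.
  move=> zp; pose Inv y S' := forall z c, (z < y)%N -> (c < 4)%N -> arr S' 10 (4 * z + c) = 0%N.
  suff h : Inv p2 S0 by exact: h.
  apply: (@vfor_ind R Inv p2 (fun z => den q0 (params ++ [:: u; z]))) => //.
  move=> y S' yp IH z' c' zy c4.
  have -> : arr (den q0 (params ++ [:: u; y]) S') 10 = upd (upd (upd (upd (arr S' 10)
     (y + y + (y + y)) 0) (y + y + (y + y) + 1) 0) (y + y + (y + y) + 2) 0) (y + y + (y + y) + 3) 0 by [].
  rewrite /upd; do 4 case: eqP => // ?; apply: IH => //; lia.
pose xi := VA 5 (VAdd (VA 4 (VV 10)) digi).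
pose xj := VA 5 (VAdd (VA 4 (VV 10)) digj).
pose q1 := vincr 10 (VAdd (four (VA 11 (VC 0))) (VAdd (VAdd xi xi) xj)).
pose Inv s S' := [/\ sctx S', digits S', marked S' & forall z c, (z < p2)%N -> (c < 4)%N ->
  arr S' 10 (4 * z + c) = (\sum_(t < s) ((tcode (w t) == z) && (tcell (w t) == c)))%N].
suff : Inv m0 (den count_cells env0 S) by case.
apply: (@vfor_ind R Inv m0 (fun s => den (tuple_code ;; q1) (params ++ [:: u; s])) S0).
  split; [exact: sctx_den | exact: digits_den | exact: marked_den |].
  by move=> z c zp c4; rewrite z0 // big_ord0.
move=> s S' sm [c' d' k' h']; split; [exact: sctx_den | exact: digits_den | exact: marked_den |].
have := tuple_code_spec c' d' k' sm; set env := params ++ _.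
set S1 := den tuple_code env S' => code1.
have c1 : sctx S1 by exact: sctx_den.
have d1 : digits S1 by exact: digits_den.
have a10 : arr S1 10 = arr S' 10 by exact: frame_arr.
have dl0 : (dg 0 < n)%N by apply: dg_lt; lia.
have dl1 : (dg 1 < n)%N by apply: dg_lt; lia.
have iE : veval B digi env S1 = dg 0 by rewrite /= d1 //; lia.
have jE : veval B digj env S1 = dg 1 by rewrite /= d1 //; lia.
move=> z c zp c4.
set idx := (4 * tcode (w s) + tcell (w s))%N.
have -> : arr (den (tuple_code;; q1) env S') 10 = upd (arr S1 10) idx (arr S1 10 idx + 1)%N.
  rewrite -[LHS]/(upd (arr S1 10) (veval B (four (VA 11 (VC 0))) env S1 +
    (veval B xi env S1 + veval B xi env S1 + veval B xj env S1))%N _).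
  rewrite -[X in upd _ _ X]/(arr S1 10 (veval B (four (VA 11 (VC 0))) env S1 +
    (veval B xi env S1 + veval B xi env S1 + veval B xj env S1)) + 1)%N.
  by rewrite four_eval (smp_eval c1 sm _ iE) // (smp_eval c1 sm _ jE) //
     -[veval _ (VA 11 _) _ _]/(arr S1 11 0) code1.
have tc4 : (tcell (w s) < 4)%N by rewrite /tcell; case: (nbit _ _); case: (nbit _ _).
have idxE : ((4 * z + c)%N == idx) = (tcode (w s) == z) && (tcell (w s) == c).
  by rewrite /idx; lia.
rewrite /upd idxE a10 big_ord_recr /= -h' //.
by case: andP => [[/eqP <- /eqP <-]|_]; rewrite ?addn0.
Qed.

Local Open Scope ring_scope.

Lemma dep_statistic_spec S :
  (forall z c, (z < p2)%N -> (c < 4)%N -> arr S 10 (4 * z + c)%N = tcount z c) ->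
  rarr (den dep_statistic env0 S) 1 0%N = tstat.
Proof.
move=> hc; pose F z : R := det_ratio (tcount z 3)%:R (tcount z 0)%:R (tcount z 2)%:R (tcount z 1)%:R.
pose Inv z S' := arr S' 10 = arr S 10 /\ rarr S' 1 0%N = \sum_(y < z) F y.
pose c k := VRN (VA 10 (VAdd (four (VV 10)) (VC k))).
pose num := VRSub (VRMul (c 3%N) (c 0%N)) (VRMul (c 2%N) (c 1%N)).
pose dn := VRAdd (VRAdd (VRAdd (c 3%N) (c 0%N)) (c 2%N)) (c 1%N).
pose q := VIf (VLeR (vrc 0) num)
      (VSetR 1 (VC 0) (VRAdd (VRA 1 (VC 0)) (VRDiv num dn)))
      (VSetR 1 (VC 0) (VRSub (VRA 1 (VC 0)) (VRDiv num dn))).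
suff : Inv p2 (den dep_statistic env0 S) by case.
apply: (@vfor_ind R Inv p2 (fun z => den q (params ++ [:: u; z]))).
  by split=> //; rewrite big_ord0.
move=> z S' zp [e h]; set env := params ++ _; split; first by rewrite frame_arr.
have cE k : (k < 4)%N -> vreval B rlo (c k) env S' = (tcount z k)%:R.
  move=> k4; rewrite -[LHS]/((arr S' 10 (veval B (four (VV 10)) env S' + k)%N)%:R) four_eval e hc //.
rewrite big_ord_recr /= -h.
have -> : rarr (den q env S') 1 0%N = if 0%:R <= vreval B rlo num env S' then
   rarr S' 1 0%N + vreval B rlo num env S' / vreval B rlo dn env S' else
   rarr S' 1 0%N - vreval B rlo num env S' / vreval B rlo dn env S'.
  have -> : den q env S' = if 0%:R <= vreval B rlo num env S' then
    den (VSetR 1 (VC 0) (VRAdd (VRA 1 (VC 0)) (VRDiv num dn))) env S' else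
    den (VSetR 1 (VC 0) (VRSub (VRA 1 (VC 0)) (VRDiv num dn))) env S' by [].
  by case: ifP.
have -> : vreval B rlo num env S' = (tcount z 3)%:R * (tcount z 0)%:R - (tcount z 2)%:R * (tcount z 1)%:R.
  by rewrite -!cE.
have -> : vreval B rlo dn env S' = (tcount z 3)%:R + (tcount z 0)%:R + (tcount z 2)%:R + (tcount z 1)%:R.
  by rewrite -!cE.
rewrite /F /det_ratio; case: ifP => h0; first by rewrite ger0_norm.
by rewrite ltr0_norm ?mulNr // ltNge h0.
Qed.

End StructurePhase.

Local Close Scope ring_scope.

Definition digit (v k : nat) : nat := (v %/ n ^ k %% n)%N.

Lemma digit_lt v k : (digit v k < n)%N.
Proof. by rewrite ltn_mod; lia. Qed.

Lemma next_tuple_spec S u v : digits (digit v) S ->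
  digits (digit v.+1) (den next_tuple (params ++ [:: u]) S).
Proof.
move=> hd; have n0 : (0 < n)%N by lia.
(* The carry into position [k] of the base [n] counter is set exactly when [n ^ k] divides
   [v.+1]. *)
pose Inv k S' := arr S' 7 0 = ((n ^ k)%N %| v.+1) :> nat /\
  forall r, (r < d + 2)%N -> arr S' 6 r = if (r < k)%N then digit v.+1 r else digit v r.
pose q0 := VIf (VLeN (VV 0) (dig (VV 10))) (VSetN 6 (VV 10) (VC 0)) (VSetN 7 (VC 0) (VC 0)).
pose q := vif (VLeN (VC 1) (VA 7 (VC 0))) (vincr 6 (VV 10) ;; q0).
suff : Inv (d + 2)%N (den next_tuple (params ++ [:: u]) S).
  by case=> _ h r rd; rewrite h ?rd.
apply: (@vfor_ind R Inv (d + 2)%N (fun k => den q (params ++ [:: u; k]))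
  (den (VSetN 7 (VC 0) (VC 1)) (params ++ [:: u]) S)).
  split=> [|r rd]; first by rewrite expn0 dvd1n.
  by rewrite frame_arr // hd.
move=> k S' kd [hc hr]; set env := params ++ _.
have nk0 : (0 < n ^ k)%N by rewrite expn_gt0 n0.
have hk : arr S' 6 k = digit v k by rewrite hr // ltnn.
have qE : den q env S' = if (0 < arr S' 7 0)%N then den q0 env (den (vincr 6 (VV 10)) env S') else S' by [].
have dE r : digit v.+1 r = (((n ^ r)%N %| v.+1) + v %/ n ^ r) %% n.
  by rewrite /digit divnS ?expn_gt0 ?n0.
cbv beta; rewrite qE hc lt0b; case: (boolP (_ %| _)) => hdv; last first.
  split.
    rewrite hc (negbTE hdv); case: (boolP (_ %| _)) => // h.
    by case/negP: hdv; apply: dvdn_trans h; rewrite expnS dvdn_mull.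
  move=> r rd; rewrite hr // ltnS; case: (ltngtP r k) => // ->.
  by rewrite dE (negbTE hdv).
set S1 := den (vincr 6 (VV 10)) env S'.
have h6 : arr S1 6 = upd (arr S' 6) k (digit v k).+1.
  by rewrite -[LHS]/(upd (arr S' 6) k (arr S' 6 k + 1)%N) hk addn1.
have h7 : arr S1 7 = arr S' 7 by exact: frame_arr.
have q0E : den q0 env S1 = if (n <= arr S1 6 k)%N then den (VSetN 6 (VV 10) (VC 0)) env S1
   else den (VSetN 7 (VC 0) (VC 0)) env S1 by [].
have dv : digit v.+1 k = if (n %| (v %/ n ^ k).+1) then 0%N else (digit v k).+1.
  by rewrite dE hdv add1n modnS.
have dvS : ((n ^ k.+1)%N %| v.+1) = (n %| (v %/ n ^ k).+1).
  have e : v.+1 = (n ^ k * (v %/ n ^ k).+1)%N.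
    by rewrite -[LHS](divnK hdv) divnS // hdv add1n mulnC.
  by rewrite e expnSr dvdn_pmul2l.
have full : (n <= (digit v k).+1)%N = (n %| (v %/ n ^ k).+1).
  rewrite /digit; case: (boolP (n %| _)) => h.
    have e : (v %/ n ^ k %% n).+1 %% n = 0%N by rewrite -addn1 modnDml addn1; apply/eqP.
    by rewrite leqNgt; apply/negP => lt; rewrite modn_small in e.
  have := ltn_pmod (v %/ n ^ k).+1 n0; rewrite modnS (negbTE h) => lt.
  by rewrite leqNgt lt.
rewrite q0E h6 {1}/upd eqxx full -dvS; case: (boolP (_ %| _)) => h2.
  split; first by rewrite frame_arr // h7 hc hdv h2.
  move=> r rd; rewrite -[LHS]/(upd (arr S1 6) k 0%N r) h6 /upd ltnS.
  case: (ltngtP r k) => [rk|rk|->].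
  - by rewrite ?ltn_eqF // hr // rk.
  - by rewrite ?gtn_eqF // hr // ltnNge ltnW.
  - by rewrite dv -dvS h2.
split; first by rewrite (negbTE h2).
move=> r rd; rewrite frame_arr // h6 /upd ltnS.
case: (ltngtP r k) => [rk|rk|->].
- by rewrite hr // rk.
- by rewrite hr // ltnNge ltnW.
- by rewrite dv -dvS (negbTE h2).
Qed.

Local Open Scope ring_scope.

Definition tuple_ok (w : nat -> bits n) (v : nat) : bool :=
  ~~ [&& nlinked (digit v), digit v 0 != digit v 1 &
         ~~ (m0%:R * gamma <= 4 * tstat w (digit v))].

Lemma test_tuple_spec w u S : sctx w S -> digits (digit u) S ->
  arr (den test_tuple (params ++ [:: u]) S) 12 0%N =
    (if tuple_ok w u then arr S 12 0%N else 0%N) /\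
  digits (digit u.+1) (den test_tuple (params ++ [:: u]) S).
Proof.
move=> c0 d0; set env := params ++ [:: u].
have dlt r : (r < d + 2)%N -> (digit u r < n)%N by move=> _; exact: digit_lt.
pose b := (VAnd (VLeN (VC 1) (VA 9 (VC 0))) (VAnd (VNot (veqn digi digj))
        (VNot (VLeR (VRMul (VRN (VV 6)) vgamma) (VRMul (vrc 4) (VRA 1 (VC 0))))))).
set S1 := den mark_set env S.
have c1 : sctx w S1 by exact: sctx_den.
have d1 : digits (digit u) S1 by exact: digits_den.
have m1' : marked (digit u) S1 by exact: mark_set_spec.
have := check_linked_spec dlt u c1 d1 m1'; set S2 := den check_linked _ _ => l2.
have c2 : sctx w S2 by exact: sctx_den.
have d2 : digits (digit u) S2 by exact: digits_den.
have m2 : marked (digit u) S2 by exact: marked_den.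
have := count_cells_spec dlt u c2 d2 m2; set S3 := den count_cells _ _ => k3.
have d3 : digits (digit u) S3 by exact: digits_den.
have := dep_statistic_spec u k3; set S4 := den dep_statistic _ _ => s4.
have d4 : digits (digit u) S4 by exact: digits_den.
have l4 : arr S4 9 = arr S2 9 by rewrite frame_arr // frame_arr.
have a12 : arr S4 12 = arr S 12 by rewrite !frame_arr.
set S5 := den (vif b (VSetN 12 (VC 0) (VC 0))) env S4.
have E : den test_tuple env S = den next_tuple env S5 by [].
rewrite E; split; last by apply: next_tuple_spec; exact: digits_den.
rewrite frame_arr //.
have -> : arr S5 12 0%N = if vbeval B rlo b env S4 then 0%N else arr S4 12 0%N.
  by rewrite /S5 /vif -[den _ env S4]/(if _ then _ else _); case: ifP.
have -> : vbeval B rlo b env S4 = [&& (0 < arr S4 9 0)%N,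
   ~~ ((arr S4 6 0 <= arr S4 6 1)%N && (arr S4 6 1 <= arr S4 6 0)%N) &
   ~~ (m0%:R * rlo (trunc B 1) <= 4%:R * rarr S4 1 0%N)] by [].
rewrite l4 l2 s4 !d4 ?addn2 // -eqn_leq a12 /tuple_ok trunc_small //=; last first.
  by have := base_gt d n1; lia.
by case: [&& _, _ & _].
Qed.

Lemma test_loop_spec w S : sctx w S -> digits (digit 0) S -> arr S 12 0%N = 1%N ->
  arr (den (VFor 4 test_tuple) params S) 12 0%N = all (tuple_ok w) (iota 0 nt).
Proof.
move=> c0 d0 a0.
pose Inv v S' := [/\ sctx w S', digits (digit v) S' & arr S' 12 0%N = all (tuple_ok w) (iota 0 v)].
suff : Inv nt (den (VFor 4 test_tuple) params S) by case.
apply: (@vfor_ind R Inv nt (fun v => den test_tuple (params ++ [:: v]))) => //.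
move=> v S' vn [c' d' a']; have [h1 h2] := test_tuple_spec c' d'.
split=> //; first exact: sctx_den.
rewrite h1 a' -[v.+1]addn1 iotaD all_cat /= andbT.
by case: (tuple_ok w v); rewrite ?andbT ?andbF.
Qed.

Definition hit_total (f : nat -> nat -> nat) : nat := \sum_(i < n) \sum_(z < p2) (T0 <= f i z).

Definition config_count (w : nat -> bits n) (i z : nat) : nat :=
  \sum_(s < m1) (pcode i (w s) == z).

Definition tester_ustat (wgt : nat -> nat -> R) (w : nat -> bits n) : R :=
  \sum_(s < m1) \sum_(i < n) \sum_(z < p2) wgt i z *
      (gval i z (w s) * \sum_(t < s) gval i z (w t)).

Definition count_weight (f : nat -> nat -> nat) (i z : nat) : R :=
  m1%:R / ((f i z)%:R * (pprob i z * (1 - pprob i z))).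

Lemma test_body_spec S (w w1 w2 : nat -> bits n) : ctx S ->
  (forall a i, (a \notin [:: 1; 2; 3; 4; 13]%N) -> arr S a i = 0%N) ->
  (forall a i, (a != 0)%N -> rarr S a i = 0) -> sampled S = 0%N ->
  (forall t, w t = xs t) -> (forall t, w1 t = xs (m0 + t)%N) ->
  (forall t, w2 t = xs (m0 + m1 + t)%N) ->
  (arr (den test_body params S) 12 0%N != 0%N) =
    [&& all (tuple_ok w) (iota 0 nt), hit_total (config_count w1) == arr S 3 0%N &
        64 * tester_ustat (count_weight (config_count w1)) w2 <= m1%:R * m1%:R * (eps * eps)] /\
  sampled (den test_body params S) = (m0 + m1 + m1)%N.
Proof.
move=> c0 z0 r0 s0 wE w1E w2E.
have wE' t : w t = xs (sampled S + t)%N by rewrite s0 wE.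
have [c1 s1] := store_samples_spec c0 wE'.
have dg0 : digits (digit 0) S by move=> r _; rewrite z0 // /digit div0n mod0n.
move: c1 s1; set S1 := den store_samples params S => c1 s1.
set S2 := den (VSetN 12 (VC 0) (VC 1)) params S1.
have c2 : sctx w S2 by exact: sctx_den.
have d2 : digits (digit 0) S2.
  by apply: digits_den => //; apply: digits_den.
have := test_loop_spec c2 d2 (erefl _); set S3 := den (VFor 4 test_tuple) params S2 => v3.
have c3 : ctx S3 by apply: ctx_den => //; exact: (sctx_ctx c2).
have z14 j : arr S3 14 j = 0%N by rewrite !frame_arr // z0.
have s3 : sampled S3 = m0.
  by rewrite frame_sampled // frame_sampled // s1 s0.
have := count_configs_spec c3 z14; set S4 := den count_configs params S3 => -[s4 k4].
have c4 : ctx S4 by exact: ctx_den.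
have z15 : arr S4 15 0 = 0%N by rewrite !frame_arr // z0.
have := count_hits_spec c4 z15; set S5 := den count_hits params S4 => h5.
have c5 : ctx S5 by exact: ctx_den.
have zr2 j : rarr S5 2 j = 0 by rewrite !frame_rarr // r0.
have zr3 : rarr S5 3 0%N = 0 by rewrite !frame_rarr // r0.
have := u_statistic_spec c5 zr2 zr3; set S6 := den u_statistic params S5 => -[s6 u6].
have ck (i : 'I_n) (z : 'I_p2) : arr S4 14 (i * p2 + z)%N = config_count w1 i z.
  by rewrite k4 //; apply: eq_bigr => s _; rewrite s3 w1E.
have s5 : sampled S5 = (m0 + m1)%N by rewrite frame_sampled // s4 s3.
have u6' : rarr S6 3 0%N = tester_ustat (count_weight (config_count w1)) w2.
  rewrite u6; apply: eq_bigr => s _; apply: eq_bigr => i _; apply: eq_bigr => z _.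
  rewrite frame_arr // ck s5 /count_weight -w2E; congr (_ * (_ * _)).
  by apply: eq_bigr => t _; rewrite -w2E.
have h6 : arr S6 15 0%N = hit_total (config_count w1).
  rewrite frame_arr // h5; apply: eq_bigr => i _; apply: eq_bigr => z _.
  by rewrite ck.
have a3 : arr S6 3 0%N = arr S 3 0%N by rewrite !frame_arr.
have a12 : arr S6 12 0%N = all (tuple_ok w) (iota 0 nt).
  by rewrite -v3; do 3 (rewrite frame_arr; last by []).
have -> : den test_body params S = den decide params S6 by [].
split; last by rewrite frame_sampled // s6 s5.
pose bb := VAnd (veqn (VA 15 (VC 0)) (VA 3 (VC 0)))
         (VLeR (VRMul (vrc 64) (VRA 3 (VC 0)))
               (VRMul (VRMul (VRN (VV 7)) (VRN (VV 7))) (VRMul veps veps))).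
have -> : arr (den decide params S6) 12 0%N = if vbeval B rlo bb params S6 then arr S6 12 0%N else 0%N.
  by rewrite /decide -[den _ _ _]/(if vbeval B rlo bb params S6 then _ else _); case: ifP.
have -> : vbeval B rlo bb params S6 = ((arr S6 15 0 <= arr S6 3 0)%N && (arr S6 3 0 <= arr S6 15 0)%N) &&
   (64%:R * rarr S6 3 0%N <= m1%:R * m1%:R * (rlo (trunc B 0) * rlo (trunc B 0))) by [].
rewrite -eqn_leq h6 a3 u6' trunc_small /=; last by have := base_gt d n1; lia.
by rewrite a12; case: (all _ _); case: (hit_total _ == _); case: (_ * _ <= _ :> R)%R.
Qed.

End LeafSpecs.

Local Notation "p ;; q" := (VSeq p q) (at level 62, right associativity).

(** * Preprocessing of the input and choice of the sample sizes *)

Section TesterRun.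
Variables (R : realType) (n d : nat) (G : dag n) (Q : distr R n) (eps gamma : R).
Variable (xs : nat -> bits n).
Hypothesis n1 : (1 < n)%N.
Local Notation B := (virtual_base n d).
Local Notation rlo := (input_real d G Q eps gamma).
Local Notation den := (den B rlo xs).
Local Notation vstore := (vstore R).
Implicit Types S : vstore.

Lemma least_eq (p : pred nat) m : p m -> (forall k, p k -> (m <= k)%N) -> least p = m.
Proof.
move=> pm hm; have [h1 h2] := leastP (ex_intro _ m pm).
by apply/eqP; rewrite eqn_leq h2 // hm.
Qed.

Record runs (p : vprog) env S S' (N : nat) : Prop := Runs {
  runs_terminates : terminates B rlo xs p env S;
  runs_den : den p env S = S';
  runs_cost : (cost B rlo xs p env S <= N)%N }.

Lemma runs_static p env S : static_bounds (size env) p ->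
  runs p env S (den p env S) (static_cost n p env).
Proof.
move=> h; split=> //; first exact: static_terminates h.
by have := @cost_le R n B rlo xs env [::] p S h; rewrite cats0.
Qed.

Lemma runs_seq q p env S S' N : static_bounds (size env) q ->
  runs p env (den q env S) S' N -> runs (q ;; p) env S S' (static_cost n q env + N).
Proof.
move=> /(runs_static S)[t1 _ c1] [t2 d2 c2]; split=> //.
by rewrite /= leq_add.
Qed.

Lemma runs_let e p env S S' N v : veval B e env S = v ->
  runs p (rcons env v) S S' N -> runs (VLet e p) env S S' (1 + N).
Proof. by move=> <- [t2 d2 c2]; split. Qed.

Lemma runs_least b p env S S' N v : (exists k, vbeval B rlo b (rcons env k) S) ->
  least (fun k => vbeval B rlo b (rcons env k) S) = v ->
  runs p (rcons env v) S S' N -> runs (VLeast b p) env S S' (2 + 2 * v + N).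
Proof.
move=> ex <- [t2 d2 c2]; split=> //.
by rewrite /= leq_add2l.
Qed.

Lemma real_power_spec k e env S v : (forall i S', vreval B rlo e (rcons env i) S' = v) ->
  rarr (den (real_power k e) env S) 0 0 = (v ^+ nth 0%N env k)%R.
Proof.
move=> he; pose Inv i S' := rarr S' 0 0 = (v ^+ i)%R.
apply: (@vfor_ind R Inv _ (fun i => den (VSetR 0 (VC 0) (VRMul (VRA 0 (VC 0)) e)) (rcons env i))).
  by rewrite /Inv expr0.
move=> i S' _ h; rewrite /Inv exprSr -h.
by rewrite -[LHS]/(rarr S' 0 0 * vreval B rlo e (rcons env i) S')%R he.
Qed.

Lemma big_eval k env S : vreval B rlo (big k) env S = (1024 ^+ k)%R.
Proof.
elim: k => [|k IH] //; rewrite exprS -IH.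
by rewrite /big iterS -[LHS]/(1024%:R * vreval B rlo (iter k (VRMul (vrc 1024)) (vrc 1)) env S)%R.
Qed.

Section Scan.
Variables (p2 lg nt : nat).
Local Notation env := [:: n; d; (d + 2)%N; p2; nt; lg].

Definition nedge : bool := has (fun i => has (fun j => nadj G i j) (iota 0 n)) (iota 0 n).
Definition nconfigs : nat := \sum_(i < n) 2 ^ (\sum_(j < n) nadj G i j).

Lemma scan_input_spec S :
  (forall k, (k < B)%N -> lo S k = if k == 1%N then B else input_nat d G k) ->
  (forall a i, a != 1%N -> arr S a i = 0%N) ->
  [/\ forall i, (i <= n)%N -> arr (den scan_input env S) 4 i = (i * n)%N,
      forall i, (i <= n)%N -> arr (den scan_input env S) 13 i = (i * p2)%N,
      arr (den scan_input env S) 3 0 = nconfigs & arr (den scan_input env S) 2 0 = nedge].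
Proof.
move=> hlo z0.
pose q0 := VSetN 4 (VAdd (VV 6) (VC 1)) (VAdd (VA 4 (VV 6)) (VV 0)) ;;
          VSetN 13 (VAdd (VV 6) (VC 1)) (VAdd (VA 13 (VV 6)) (VV 3)).
pose q1 := vif (visadj (VV 6) (VV 7))
      (VSetN 3 (VC 1) (VAdd (VA 3 (VC 1)) (VA 3 (VC 1))) ;; VSetN 2 (VC 0) (VC 1)).
pose q2 := VSetN 3 (VC 0) (VAdd (VA 3 (VC 0)) (VA 3 (VC 1))).
pose q3 := VSetN 3 (VC 1) (VC 1) ;; VFor 0 q1 ;; q2.
pose S1 := den (VFor 0 q0) env S.
have h1 : (forall i, (i <= n)%N -> arr S1 4 i = (i * n)%N) /\
          (forall i, (i <= n)%N -> arr S1 13 i = (i * p2)%N).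
  pose Inv j S' := (forall i, (i <= j)%N -> arr S' 4 i = (i * n)%N) /\
          (forall i, (i <= j)%N -> arr S' 13 i = (i * p2)%N).
  apply: (@vfor_ind R Inv n (fun i => den q0 (env ++ [:: i]))).
    by split=> i; rewrite leqn0 => /eqP ->; rewrite z0.
  move=> j S' jn [h4 h13]; split=> i ij.
    rewrite -[LHS]/(upd (arr S' 4) (j + 1)%N (arr S' 4 j + n)%N i) /upd.
    by case: eqP => [->|ne]; [rewrite h4 // addn1 mulSnr | apply: h4; lia].
  rewrite -[LHS]/(upd (arr S' 13) (j + 1)%N (arr S' 13 j + p2)%N i) /upd.
  by case: eqP => [->|ne]; [rewrite h13 // addn1 mulSnr | apply: h13; lia].
have [h4 h13] := h1.
have -> : den scan_input env S = den (VFor 0 q3) env S1 by [].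
pose F i := has (fun j => nadj G i j) (iota 0 n).
pose Inv i S' := [/\ forall k, (k < B)%N -> lo S' k = lo S1 k, arr S' 4 = arr S1 4,
   arr S' 3 0 = (\sum_(i' < i) 2 ^ (\sum_(j < n) nadj G i' j))%N &
   arr S' 2 0 = has F (iota 0 i)].
suff : Inv n (den (VFor 0 q3) env S1).
  case=> _ _ h3 h2; split=> //; first by move=> i iN; rewrite frame_arr // h4.
  by move=> i iN; rewrite frame_arr // h13.
apply: (@vfor_ind R Inv n (fun i => den q3 (env ++ [:: i]))).
  by split=> //; rewrite ?big_ord0 frame_arr // z0.
move=> i S' iN [hl' h4' h3' h2'].
pose Inv2 j S2 := [/\ forall k, (k < B)%N -> lo S2 k = lo S1 k, arr S2 4 = arr S1 4,
   arr S2 3 0 = arr S' 3 0, arr S2 3 1 = (2 ^ (\sum_(j' < j) nadj G i j'))%N &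
   arr S2 2 0 = has F (iota 0 i) || has (fun j => nadj G i j) (iota 0 j)].
have : Inv2 n (den (VFor 0 q1) (env ++ [:: i]) (den (VSetN 3 (VC 1) (VC 1)) (env ++ [:: i]) S')).
  apply: (@vfor_ind R Inv2 n (fun j => den q1 (env ++ [:: i; j]))
    (den (VSetN 3 (VC 1) (VC 1)) (env ++ [:: i]) S')).
    by split=> //; rewrite ?big_ord0 // orbF.
  move=> j S2 jn [hl2 h42 h32 h312 h22].
  have aE : vbeval B rlo (visadj (VV 6) (VV 7)) (env ++ [:: i; j]) S2 = nadj G i j.
    rewrite -[LHS]/(0 < veval B (vadj (VV 6) (VV 7)) (env ++ [:: i; j]) S2)%N.
    rewrite (vadj_eval (d := d) (G := G) n1 (i := i) (j := j)) ?lt0b //.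
      by move=> k kB; rewrite hl2 // frame_low // hlo.
    by move=> k kn; rewrite h42 h4 // ltnW.
  have -> : den q1 (env ++ [:: i; j]) S2 = if nadj G i j then
       den (VSetN 3 (VC 1) (VAdd (VA 3 (VC 1)) (VA 3 (VC 1))) ;; VSetN 2 (VC 0) (VC 1)) (env ++ [:: i; j]) S2
       else S2 by rewrite -aE.
  have iS : iota 0 j.+1 = iota 0 j ++ [:: j] by rewrite -[j.+1]addn1 iotaD.
  rewrite /Inv2 iS has_cat big_ord_recr [has _ [:: _]]/= orbF /=.
  case: (nadj G i j); rewrite ?addn0 ?orbF ?orbT //.
  by split=> //; rewrite /upd2 /upd /= h312 addn1 expnS mul2n addnn.
set S2 := den _ _ _; case=> hl2 h42 h32 h312 h22.
cbv beta; have -> : den q3 (env ++ [:: i]) S' = den q2 (env ++ [:: i]) S2 by [].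
split=> //; first by rewrite big_ord_recr /= /upd2 /upd /= h32 h3' h312.
by rewrite frame_arr // h22 -[i.+1]addn1 iotaD has_cat [has _ (iota (0 + i) 1)]/= orbF.
Qed.

End Scan.

Local Open Scope ring_scope.

Definition log_up : nat := least (fun k => (n <= 2 ^ k)%N).
(** The factor [nedge] makes the structure batch empty when there are no edges, hence no linked
    pairs. In particular for [d = 0] the allowed [gamma] term has no logarithm to pay for a union
    bound. *)
Definition size0 (c0 : nat) : nat := least (fun k =>
  nedge%:R * (1024 ^+ c0 * ((2 ^ d)%N%:R + d%:R * log_up%:R)) <= k%:R * (gamma * gamma)).
(** Both sides are squared to avoid a square root: the condition is [k * eps ^ 2 >= 32 ^ c1 * sqrt
    (n * 2 ^ d)]. *)
Definition size1 (c1 : nat) : nat := least (fun k =>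
  1024 ^+ c1 * (n%:R * (2 ^ d)%N%:R) <= k%:R * k%:R * (eps * eps * (eps * eps))).
(** A multiple of the logarithm of the number [n * 2 ^ d] of table entries, so that the Chernoff
    bound survives the union over all of them. *)
Definition threshold (c2 : nat) : nat := (1024 ^ c2 * (d + log_up + 1))%N.

Definition tester_params c0 c1 c2 : seq nat :=
  params n d (2 ^ d) (n ^ (d + 2)) log_up (size0 c0) (size1 c1) (threshold c2).

Lemma archi_ex (a b : R) : 0 < b -> exists k : nat, a <= k%:R * b.
Proof.
move=> b0; exists (Num.Def.archi_bound `|a / b|).
rewrite -ler_pdivrMr //; apply: le_trans (ler_norm _) _.
by apply: ltW; apply: archi_boundP; apply: normr_ge0.
Qed.

Definition setup_cost c0 c1 c2 : nat :=
  (3 * d + 3 * (d + 2) + 3 * n + 2 * 2 ^ d + 2 * n ^ (d + 2) + 2 * log_up + 4 * n +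
   n * (10 + 6 * n) + 2 * size0 c0 + 2 * size1 c1 + 2 * threshold c2 + 40)%N.

Lemma tester_runs c0 c1 c2 : 0 < eps -> 0 < gamma ->
  exists S, [/\ runs (tester c0 c1 c2) [::] (init_store R d G)
      (den test_body (tester_params c0 c1 c2) S)
      (setup_cost c0 c1 c2 + static_cost n test_body (tester_params c0 c1 c2))%N,
    ctx d G S, forall a i, (a \notin [:: 1; 2; 3; 4; 13]%N) -> arr S a i = 0%N,
    forall a i, (a != 0)%N -> rarr S a i = 0 & sampled S = 0%N /\ arr S 3 0%N = nconfigs].
Proof.
move=> e0 g0; have Bgt := base_gt d n1.
set S0 := init_store R d G.
pose e3 := [:: n; d; (d + 2)%N].
pose S1 := den (real_power 1 (vrc 2)) e3 S0.
have r1 : rarr S1 0%N 0%N = (2 ^ d)%N%:R.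
  by rewrite /S1 (@real_power_spec _ _ _ _ 2%:R) // natrX.
pose e4 := [:: n; d; (d + 2)%N; (2 ^ d)%N].
pose S2 := den (real_power 2 (VRN (VV 0))) e4 S1.
have r2 : rarr S2 0%N 0%N = (n ^ (d + 2))%N%:R.
  by rewrite /S2 (@real_power_spec _ _ _ _ n%:R) // natrX.
pose e5 := [:: n; d; (d + 2)%N; (2 ^ d)%N; (n ^ (d + 2))%N].
pose S3 := den (VSetR 0 (VC 0) (vrc 1)) e5 S2.
pose S4 := den (VFor 0 (VSetR 0 (VAdd (VV 5) (VC 1)) (VRMul (vrc 2) (VRA 0 (VV 5))))) e5 S3.
have r4 k : (k <= n)%N -> rarr S4 0%N k = (2 ^ k)%N%:R.
  pose Inv i S' := forall k, (k <= i)%N -> rarr S' 0%N k = (2 ^ k)%N%:R :> R.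
  suff h : Inv n S4 by apply: h.
  apply: (@vfor_ind R Inv n (fun i => den (VSetR 0 (VAdd (VV 5) (VC 1))
    (VRMul (vrc 2) (VRA 0 (VV 5)))) (e5 ++ [:: i])) S3).
    by move=> j; rewrite leqn0 => /eqP ->.
  move=> i S' iN h j ji; rewrite -[LHS]/(upd (rarr S' 0%N) (i + 1)%N (2%:R * rarr S' 0%N i) j) /upd.
  by case: eqP => [->|ne]; [rewrite h // addn1 expnS natrM | apply: h; lia].
have n2 : (n <= 2 ^ n)%N by rewrite ltnW // ltn_expl.
have [lgP lgM] : (n <= 2 ^ log_up)%N /\ (forall k, (n <= 2 ^ k)%N -> (log_up <= k)%N).
  by apply: (@leastP (fun k => (n <= 2 ^ k)%N)); exists n.
have lgn : (log_up <= n)%N by exact: lgM.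
pose e6 := [:: n; d; (d + 2)%N; (2 ^ d)%N; (n ^ (d + 2))%N; log_up].
pose S5 := den scan_input e6 S4.
have lo4 k : (k < B)%N -> lo S4 k = if k == 1%N then B else input_nat d G k.
  by move=> kB; rewrite !frame_low // /= /upd; case: eqP.
have a4 a i : a != 1%N -> arr S4 a i = 0%N.
  by move=> a1; rewrite !frame_arr //= (negbTE a1).
have [h4 h13 h3 h2] := @scan_input_spec (2 ^ d) log_up (n ^ (d + 2)) S4 lo4 a4.
rewrite -/S5 in h4 h13 h3 h2.
have tr0 : trunc B 0 = 0%N by rewrite trunc_small //; lia.
have tr1 : trunc B 1 = 1%N by rewrite trunc_small //; lia.
exists S5; split; last first.
- by split=> //; rewrite !frame_sampled.
- by move=> a i a0; rewrite !frame_rarr /= ?inE ?negb_or ?a0.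
- move=> a i; rewrite !inE !negb_or => /and5P[a1 a2 a3 a4' a13].
  by rewrite frame_arr ?a4 //= !inE !negb_or a2 a3 a4' a13.
- split=> [k kB|i iN|i iN]; first by rewrite frame_low // lo4.
    by rewrite h4 // ltnW.
  by rewrite h13 // ltnW.
have body : runs test_body (tester_params c0 c1 c2) S5 (den test_body (tester_params c0 c1 c2) S5)
    (static_cost n test_body (tester_params c0 c1 c2)).
  exact: runs_static.
set SB := static_cost n test_body _ in body *.
have rT : runs (VLeast (VLeR (VRMul (big c2) (VRN (VAdd (VAdd (VV 1) (VV 5)) (VC 1)))) (VRN (VV 8)))
    test_body) (e6 ++ [:: size0 c0; size1 c1]) S5 (den test_body (tester_params c0 c1 c2) S5)
    (2 + 2 * threshold c2 + SB).
  have tE k : vbeval B rlo (VLeR (VRMul (big c2) (VRN (VAdd (VAdd (VV 1) (VV 5)) (VC 1)))) (VRN (VV 8)))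
     (rcons (e6 ++ [:: size0 c0; size1 c1]) k) S5 = (threshold c2 <= k)%N.
    rewrite -[LHS]/(vreval B rlo (big c2) _ S5 * (d + log_up + 1)%N%:R <= k%:R) big_eval.
    by rewrite /threshold -(ler_nat R) natrM natrX.
  apply: (@runs_least _ _ _ _ _ _ (threshold c2)); last exact: body.
    by exists (threshold c2); rewrite tE.
  by apply: least_eq => [|k]; rewrite tE.
pose b1 := VLeR (VRMul (big c1) (VRMul (VRN (VV 0)) (VRN (VV 3))))
          (VRMul (VRMul (VRN (VV 7)) (VRN (VV 7))) (VRMul (VRMul veps veps) (VRMul veps veps))).
have b1E k : vbeval B rlo b1 (rcons (e6 ++ [:: size0 c0]) k) S5 =
    (1024 ^+ c1 * (n%:R * (2 ^ d)%N%:R) <= k%:R * k%:R * (eps * eps * (eps * eps))).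
  rewrite -[LHS]/(vreval B rlo (big c1) _ S5 * (n%:R * (2 ^ d)%N%:R) <=
      k%:R * k%:R * (rlo (trunc B 0) * rlo (trunc B 0) * (rlo (trunc B 0) * rlo (trunc B 0)))).
  by rewrite tr0 big_eval.
have h : 0 < eps * eps * (eps * eps) by rewrite !mulr_gt0.
have ex1 : exists k, vbeval B rlo b1 (rcons (e6 ++ [:: size0 c0]) k) S5.
  have [k hk] := archi_ex (1024 ^+ c1 * (n%:R * (2 ^ d)%N%:R)) h.
  exists k.+1; rewrite b1E; apply: le_trans hk _; apply: ler_wpM2r; first exact: ltW.
  by rewrite -natrM ler_nat; lia.
have eq1 : least (fun k => vbeval B rlo b1 (rcons (e6 ++ [:: size0 c0]) k) S5) = size1 c1.
  by rewrite /size1; congr least; apply/funext => k; rewrite b1E.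
have r1E := runs_least ex1 eq1 rT.
pose b0 := VLeR (VRMul (VRN (VA 2 (VC 0))) (VRMul (big c0) (VRAdd (VRN (VV 3))
            (VRMul (VRN (VV 1)) (VRN (VV 5)))))) (VRMul (VRN (VV 6)) (VRMul vgamma vgamma)).
have b0E k : vbeval B rlo b0 (rcons e6 k) S5 =
    (nedge%:R * (1024 ^+ c0 * ((2 ^ d)%N%:R + d%:R * log_up%:R)) <= k%:R * (gamma * gamma)).
  rewrite -[LHS]/((arr S5 2 0)%:R * (vreval B rlo (big c0) _ S5 *
      ((2 ^ d)%N%:R + d%:R * log_up%:R)) <= k%:R * (rlo (trunc B 1) * rlo (trunc B 1))).
  by rewrite tr1 big_eval h2.
have h' : 0 < gamma * gamma by rewrite mulr_gt0.
have ex0 : exists k, vbeval B rlo b0 (rcons e6 k) S5.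
  have [k hk] := archi_ex (nedge%:R * (1024 ^+ c0 * ((2 ^ d)%N%:R + d%:R * log_up%:R))) h'.
  by exists k; rewrite b0E.
have eq0 : least (fun k => vbeval B rlo b0 (rcons e6 k) S5) = size0 c0.
  by rewrite /size0; congr least; apply/funext => k; rewrite b0E.
have r0E := runs_least ex0 eq0 r1E.
have {}r0E := @runs_seq scan_input _ e6 S4 _ _ isT r0E.
pose bL := VLeR (VRN (VV 0)) (VRA 0 (VV 5)).
have bLE k : vbeval B rlo bL (rcons e5 k) S4 = (n%:R <= rarr S4 0%N k) by [].
have exL : exists k, vbeval B rlo bL (rcons e5 k) S4 by exists n; rewrite bLE r4 // ler_nat.
have eqL : least (fun k => vbeval B rlo bL (rcons e5 k) S4) = log_up.
  apply: least_eq => [|k]; rewrite bLE; first by rewrite r4 // ler_nat.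
  have [kn|kn] := leqP k n; last by move=> _; apply: leq_trans lgn _; apply: ltnW.
  by rewrite r4 // ler_nat; exact: lgM.
have rL := runs_least exL eqL r0E.
have {}rL := @runs_seq (VFor 0 (VSetR 0 (VAdd (VV 5) (VC 1)) (VRMul (vrc 2) (VRA 0 (VV 5))))) _ e5 S3 _ _ isT rL.
have {}rL := @runs_seq (VSetR 0 (VC 0) (vrc 1)) _ e5 S2 _ _ isT rL.
pose bN := VLeR (VRA 0 (VC 0)) (VRN (VV 4)).
have bNE k : vbeval B rlo bN (rcons e4 k) S2 = (n ^ (d + 2) <= k)%N.
  by rewrite -[LHS]/(rarr S2 0%N 0%N <= k%:R) r2 ler_nat.
have exN : exists k, vbeval B rlo bN (rcons e4 k) S2 by exists (n ^ (d + 2))%N; rewrite bNE.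
have eqN : least (fun k => vbeval B rlo bN (rcons e4 k) S2) = (n ^ (d + 2))%N.
  by apply: least_eq => [|k]; rewrite bNE.
have rN := runs_least exN eqN rL.
have {}rN := @runs_seq (real_power 2 (VRN (VV 0))) _ e4 S1 _ _ isT rN.
pose bP := VLeR (VRA 0 (VC 0)) (VRN (VV 3)).
have bPE k : vbeval B rlo bP (rcons e3 k) S1 = (2 ^ d <= k)%N.
  by rewrite -[LHS]/(rarr S1 0%N 0%N <= k%:R) r1 ler_nat.
have exP : exists k, vbeval B rlo bP (rcons e3 k) S1 by exists (2 ^ d)%N; rewrite bPE.
have eqP : least (fun k => vbeval B rlo bP (rcons e3 k) S1) = (2 ^ d)%N.
  by apply: least_eq => [|k]; rewrite bPE.
have rP := runs_least exP eqP rN.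
have {}rP := @runs_seq (real_power 1 (vrc 2)) _ e3 S0 _ _ isT rP.
have {}rP := @runs_let (VAdd (VV 1) (VC 2)) _ [:: n; d] S0 _ _ (d + 2)%N (erefl _) rP.
have {}rP := @runs_let (VA 1 (VC 0)) _ [:: n] S0 _ _ d (erefl _) rP.
have e0' : veval B (VLow (VC 0)) [::] S0 = n by rewrite /= tr0.
have [t dd cc] := runs_let e0' rP; split=> //; apply: leq_trans cc _.
rewrite /setup_cost /= -/SB; move: (2 ^ d)%N (n ^ (d + 2))%N => a b; lia.
Qed.

End TesterRun.

(** * Decoding the tables of the tester *)

Section Codes.
Variables (n : nat) (G : dag n).
Implicit Types (i j : 'I_n) (x y : bits n).

Lemma nadjE i j : nadj G i j = (j \in G i).
Proof. by rewrite /nadj !valK. Qed.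

Lemma nbitE x i : nbit x i = x i.
Proof. by rewrite /nbit valK. Qed.

(** After [l] rounds the nodes from [n - l] on have been read. These are the parents read after [j],
    each of which has shifted the digit of [j] up by one. *)
Let above i (l j : nat) : {set 'I_n} := [set p in G i | (n - l <= p < j)%N].

Lemma above_succ i l (j : nat) (v : 'I_n) : (l < n)%N -> v = (n - 1 - l)%N :> nat -> (v < j)%N ->
  above i l.+1 j = if v \in G i then v |: above i l j else above i l j.
Proof.
move=> ln ve vj; case vG: (v \in G i); apply/setP => p; rewrite !inE.
  have [->|pv] := eqVneq p v; first by rewrite vG /=; lia.
  have pv' : p != v :> nat by rewrite val_eqE.
  by case: (p \in G i) => //=; lia.
have [->|pv] := eqVneq p v; first by rewrite vG.
have pv' : p != v :> nat by rewrite val_eqE.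
by case: (p \in G i) => //=; lia.
Qed.

Lemma pcode_rec_digit i x l : (l <= n)%N -> forall j, j \in G i -> (n - l <= j)%N ->
  odd (pcode_rec G i x l %/ 2 ^ #|above i l j|) = x j.
Proof.
elim: l => [|l IH] ln j jG jl; first by have := ltn_ord j; lia.
have vn : (n - 1 - l < n)%N by lia.
pose v := Ordinal vn; rewrite /= -[(n - 1 - l)%N]/(nat_of_ord v) nadjE nbitE.
have [jv|jv] := eqVneq j v.
  have -> : above i l.+1 j = set0.
    by apply/setP => p; rewrite !inE jv /=; case: (p \in G i) => //=; lia.
  rewrite -jv jG cards0 expn0 divn1 !oddD.
  by case: (odd _) => /=; case: (x j).
have jl' : (n - l <= j)%N.
  have : j != v :> nat by rewrite val_eqE.
  by rewrite /=; lia.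
have vj : (v < j)%N by rewrite /=; lia.
rewrite (above_succ i ln (erefl _ : v = _ :> nat) vj); case vG: (v \in G i); last exact: (IH (ltnW ln)).
rewrite cardsU1 (_ : v \notin above i l j) ?add1n; last first.
  by rewrite !inE vG /=; lia.
rewrite expnS divnMA -(IH (ltnW ln) j jG jl'); congr (odd (_ %/ _)).
by rewrite addnn -muln2 divnMDl // divn_small ?addn0 //; case: (x v).
Qed.

Lemma decode_pcode i x j : j \in G i -> decode_config G i (pcode G i x) j = x j.
Proof.
move=> jG; rewrite ffunE -(@pcode_rec_digit i x n) ?subnn //.
by congr (odd (_ %/ 2 ^ _)); apply: eq_card => p; rewrite !inE subnn.
Qed.

Lemma pcode_eq i x y : (pcode G i x == pcode G i y) = [forall j in G i, x j == y j].
Proof.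
apply/eqP/forallP => [e j|h].
  by apply/implyP => jG; rewrite -(decode_pcode x jG) e decode_pcode.
suff key l : (l <= n)%N -> pcode_rec G i x l = pcode_rec G i y l by exact: key.
elim: l => [|l IH] //= ln.
have vn : (n - 1 - l < n)%N by lia.
rewrite -[(n - 1 - l)%N]/(nat_of_ord (Ordinal vn)) nadjE !nbitE IH; last exact: ltnW.
by case vG: (_ \in G i) => //; have := h (Ordinal vn); rewrite vG => /eqP ->.
Qed.

Lemma pcode_lt_deg i x : (pcode G i x < 2 ^ #|G i|)%N.
Proof.
have key l : (l <= n)%N -> (pcode_rec G i x l < 2 ^ #|above i l n|)%N.
  elim: l => [|l IH] ln; first by rewrite expn_gt0.
  have vn : (n - 1 - l < n)%N by lia.
  pose v := Ordinal vn; rewrite /= -[(n - 1 - l)%N]/(nat_of_ord v) nadjE nbitE.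
  have := IH (ltnW ln).
  rewrite (above_succ i ln (erefl _ : v = _ :> nat) vn); case vG: (v \in G i) => //.
  rewrite cardsU1 (_ : v \notin above i l n) ?add1n ?expnS; last first.
    by rewrite !inE vG /=; lia.
  by case: (x v); lia.
apply: leq_trans (key n (leqnn n)) _; rewrite leq_exp2l // subset_leq_card //.
by apply/subsetP => p; rewrite inE => /andP[].
Qed.

(** By counting: the codes of the subsets of the parents are distinct and lie below [2 ^ #|G i|], so
    they exhaust that range. *)
Lemma pcode_onto i z : (z < 2 ^ #|G i|)%N -> exists x, pcode G i x = z.
Proof.
move=> zl; pose f (x : {set 'I_n}) : 'I_(2 ^ #|G i|) :=
  Ordinal (pcode_lt_deg i [ffun j => j \in x]).
have finj : {in powerset (G i) &, injective f}.
  move=> A B; rewrite !inE => /subsetP AG /subsetP BG /(congr1 val) /= /eqP.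
  rewrite pcode_eq => /forallP h; apply/setP => j.
  have := h j; rewrite !ffunE; case jG: (j \in G i) => /=; [by move/eqP | move=> _].
  by apply/idP/idP => [/AG|/BG]; rewrite jG.
have : f @: powerset (G i) = setT.
  apply/eqP; rewrite eqEcard subsetT /= card_in_imset // card_powerset cardsT card_ord //.
move/setP/(_ (Ordinal zl)); rewrite inE => /imsetP[A _ /(congr1 val) /= e].
by exists [ffun j => j \in A].
Qed.

Lemma sum_nadj i : (\sum_(j < n) nadj G i j)%N = #|G i|.
Proof.
rewrite -sum1_card [RHS]big_mkcond /=; apply: eq_bigr => j _.
by rewrite nadjE; case: (j \in G i).
Qed.

Lemma nconfigsE : nconfigs G = (\sum_(i < n) 2 ^ #|G i|)%N.
Proof. by apply: eq_bigr => i _; rewrite sum_nadj. Qed.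

Lemma nedgeP : reflect (exists i j, j \in G i) (nedge G).
Proof.
apply: (iffP hasP) => [[i]|[i [j ij]]].
  rewrite mem_iota => /= iN /hasP[j]; rewrite mem_iota => /= jN.
  by rewrite -[i]/(nat_of_ord (Ordinal iN)) -[j]/(nat_of_ord (Ordinal jN)) nadjE; exists (Ordinal iN), (Ordinal jN).
by exists (val i); rewrite ?mem_iota ?ltn_ord //=; apply/hasP; exists (val j);
  rewrite ?mem_iota ?ltn_ord // nadjE.
Qed.

Section Hits.
Variables (p2 T0 : nat) (f : nat -> nat -> nat).
Hypothesis T0_gt0 : (0 < T0)%N.
Hypothesis deg_le : forall i, (2 ^ #|G i| <= p2)%N.
Hypothesis f0 : forall i z, (2 ^ #|G i| <= z)%N -> f i z = 0%N.

(** Every configuration contributes at most 1, so the total is the number of configurations only if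
    all are hit. Entries of a row from [2 ^ #|G i|] on have count 0 and cannot reach the positive
    [T0]. *)
Lemma hit_totalP : reflect (forall i z, (z < 2 ^ #|G i|)%N -> (T0 <= f i z)%N)
  (hit_total n p2 T0 f == nconfigs G).
Proof.
have rowE i : (\sum_(z < p2) (T0 <= f i z) = \sum_(z < 2 ^ #|G i|) (T0 <= f i z))%N.
  rewrite (big_ord_widen p2 (fun z => (T0 <= f i z)%N : nat) (deg_le i)) [RHS]big_mkcond /=.
  apply: eq_bigr => z _; case: ltnP => // zl.
  by rewrite f0 // leqNgt T0_gt0.
have oneE i : (2 ^ #|G i| = \sum_(z < 2 ^ #|G i|) 1)%N by rewrite sum1_card card_ord.
have row_le i : (\sum_(z < p2) (T0 <= f i z) <= 2 ^ #|G i|)%N.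
  rewrite rowE [leqRHS]oneE; apply: leq_sum => z _.
  exact: leq_b1.
have rowP i : (\sum_(z < p2) (T0 <= f i z) == 2 ^ #|G i|)%N =
    [forall z : 'I_(2 ^ #|G i|), T0 <= f i z].
  rewrite rowE [X in _ == X]oneE.
  apply/idP/forallP => [h z|h]; last first.
    by apply/eqP; apply: eq_bigr => z _; rewrite h.
  apply: contraTT h => nz; rewrite neq_ltn; apply/orP; left.
  rewrite (bigD1 z) //= [X in (_ < X)%N](bigD1 z) //= (negbTE nz) add0n add1n ltnS.
  by apply: leq_sum => y _; exact: leq_b1.
rewrite nconfigsE /hit_total; apply: (iffP eqP) => [h i z zl|h].
  have : [forall z : 'I_(2 ^ #|G i|), T0 <= f i z].
    rewrite -rowP; apply: contra_eqT h => ne; rewrite neq_ltn; apply/orP; left.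
    rewrite (bigD1 i) //= [X in (_ < X)%N](bigD1 i) //= -addSn.
    by apply: leq_add; [rewrite ltn_neqAle ne row_le | apply: leq_sum => i' _].
  by move/forallP => /(_ (Ordinal zl)).
by apply: eq_bigr => i _; apply/eqP; rewrite rowP; apply/forallP => z; apply: h.
Qed.

End Hits.

Hypothesis n1 : (1 < n)%N.

Lemma digitD a b k : (a < n)%N -> digit n (a + n * b) k.+1 = digit n b k /\ digit n (a + n * b) 0 = a.
Proof.
move=> an; have n0 : (0 < n)%N by lia.
rewrite /digit; split; last by rewrite expn0 divn1 mulnC addnC modnMDl modn_small.
by rewrite mulnC addnC expnS divnMA divnMDl // (divn_small an) addn0.
Qed.

Lemma digit_onto k (f : nat -> nat) : (forall r, (f r < n)%N) ->
  exists2 v, (v < n ^ k)%N & forall r, (r < k)%N -> digit n v r = f r.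
Proof.
elim: k f => [|k IH] f fl; first by exists 0%N.
have [|v vl hv] := IH (fun r => f r.+1); first by move=> r.
exists (f 0 + n * v)%N.
  rewrite expnS; have := fl 0%N; have : (v.+1 <= n ^ k)%N by []. 
  by move=> h1 h2; apply: (@leq_trans (n * v.+1)); [lia | rewrite leq_mul2l h1 orbT].
case=> [_|r rk]; first by have [] := @digitD (f 0) v 0 (fl 0).
by have [-> _] := @digitD (f 0) v r (fl 0); apply: hv.
Qed.

End Codes.

Local Open Scope ring_scope.

Section TupleTest.
Variables (R : realType) (n d : nat) (G : dag n).
Hypothesis n1 : (1 < n)%N.

Section OneTuple.
Variables (dg : nat -> nat) (i j : 'I_n).
Hypothesis dg0 : dg 0%N = i.
Hypothesis dg1 : dg 1%N = j.
Hypothesis dg_lt : forall r, (dg r < n)%N.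

Definition tset : {set 'I_n} := [set k : 'I_n | tmask d dg k].

Lemma tset_card : (#|tset| <= d)%N.
Proof.
have <- : size [seq dg (r + 2)%N | r <- iota 0 d] = d by rewrite size_map size_iota.
rewrite cardE -[X in (X <= _)%N](size_map (@nat_of_ord n)).
apply: uniq_leq_size; first by rewrite map_inj_uniq ?enum_uniq //; exact: ord_inj.
move=> k /mapP[k']; rewrite mem_enum inE => /and3P[/hasP[r ri /eqP e] _ _] ->.
by apply/mapP; exists r.
Qed.

Lemma tset_i : i \notin tset.
Proof. by rewrite inE /tmask dg0 eqxx andbF. Qed.

Lemma tset_j : j \notin tset.
Proof. by rewrite inE /tmask dg1 eqxx !andbF. Qed.

Lemma nlinkedP : reflect (linked G tset i j) (nlinked d G dg).
Proof.
rewrite /nlinked dg0 dg1 nadjE; apply: (iffP orP) => [[h|/hasP[k]]|].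
- by apply: Or41.
- rewrite mem_iota => /= kn; set k' := Ordinal kn; rewrite -[k]/(nat_of_ord k') !nadjE.
  have -> : tmask d dg k' = (k' \in tset) by rewrite inE.
  case/or3P=> /andP[kT h].
  + by apply: Or42; exists k'.
  + by apply: Or43; exists k'.
  + by apply: Or44; exists k'.
have kin (k : 'I_n) : nat_of_ord k \in iota 0 n by rewrite mem_iota /=.
have tE (k : 'I_n) : tmask d dg k = (k \in tset) by rewrite inE.
case=> [h|[k kT h]|[k kT h]|[k kT h]]; first by left.
- by right; apply/hasP; exists (nat_of_ord k); rewrite ?kin // !nadjE tE kT h.
- by right; apply/hasP; exists (nat_of_ord k); rewrite ?kin // !nadjE tE kT h orbT.
- by right; apply/hasP; exists (nat_of_ord k); rewrite ?kin // !nadjE tE kT h !orbT.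
Qed.

Lemma tcode_ltp (x : bits n) : (tcode d dg x < 2 ^ d)%N.
Proof. exact: tcode_lt. Qed.

Definition tcode_ord (x : bits n) : 'I_(2 ^ d) := Ordinal (tcode_ltp x).

Lemma tcode_ord_eq x y : (tcode_ord x == tcode_ord y) = [forall k in tset, x k == y k].
Proof.
rewrite -val_eqE /= /tcode.
have key r : (tcode_rec d dg x r == tcode_rec d dg y r) =
    all (fun r' => tmask d dg (dg (r' + 2)%N) ==> (nbit x (dg (r' + 2)%N) == nbit y (dg (r' + 2)%N))) (iota 0 r).
  elim: r => [|r IH] //; rewrite -[r.+1]addn1 iotaD all_cat -IH addn1 /= andbT.
  by case: (tmask _ _ _); case: (nbit x _); case: (nbit y _); rewrite /= ?andbT ?andbF; lia.
rewrite key; apply/allP/forallP => [h k|h r ri].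
  apply/implyP; rewrite inE => /[dup] kt /and3P[/hasP[r ri /eqP e] _ _].
  by have := h r ri; rewrite e kt !nbitE.
apply/implyP => mt; have := h (Ordinal (dg_lt (r + 2))); rewrite inE mt /=.
by rewrite -!nbitE.
Qed.

Lemma tcountE (m : nat) (w : nat -> bits n) (z : 'I_(2 ^ d)) (a b : bool) :
  tcount d m w dg z (a + a + b)%N = emp i j tcode_ord m w (z, a, b).
Proof.
apply: eq_bigr => s _; rewrite /cell !xpair_eqE -[tcode_ord _ == z]val_eqE /= -andbA.
congr (nat_of_bool (_ && _)); rewrite /tcell dg0 dg1 !nbitE.
by case: (w s i); case: (w s j); case: a; case: b.
Qed.

Lemma tstatE (m : nat) (w : nat -> bits n) :
  tstat R d (2 ^ d) m w dg = dep_stat (fun p => (emp i j tcode_ord m w p)%:R : R).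
Proof.
rewrite /tstat /dep_stat; apply: eq_bigr => z _.
by rewrite (tcountE m w z true true) (tcountE m w z false false) (tcountE m w z true false)
  (tcountE m w z false true).
Qed.

(** The factor 8 makes the l1 error, hence by Lipschitz continuity that of the statistic, less than
    [m * gamma / 4]: enough to separate 0 from [m * gamma / 2]. *)
Definition accurate (P : distr R n) (gamma : R) (m : nat) (w : nat -> bits n) : bool :=
  \sum_p `|(emp i j tcode_ord m w p)%:R - m%:R * marg i j tcode_ord P p| < 2 * m%:R * (gamma / 8).

Lemma accurate_dist P gamma m w : accurate P gamma m w ->
  `|tstat R d (2 ^ d) m w dg - m%:R * dep_stat (marg i j tcode_ord P)| < m%:R * gamma / 4.
Proof.
move=> acc; rewrite tstatE -dep_statZ //.
apply: le_lt_trans (dep_stat_lip _ _) _ => [p|p|]; first by rewrite ler0n.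
  by rewrite mulr_ge0 ?marg_ge0.
by apply: lt_le_trans acc _; lra.
Qed.

Lemma accurate_indep P gamma m w : accurate P gamma m w -> cond_indep P i j tset ->
  4 * tstat R d (2 ^ d) m w dg < m%:R * gamma.
Proof.
move=> /accurate_dist h ci.
rewrite (cond_indep_dep_stat tcode_ord_eq ci) mulr0 subr0 in h.
by have := le_lt_trans (ler_norm _) h; lra.
Qed.

Lemma accurate_far (Q : distr R n) gamma m w : (forall x, 0 < Q x) -> i != j ->
  accurate Q gamma m w -> far_from_indep gamma Q i j tset ->
  m%:R * gamma <= 4 * tstat R d (2 ^ d) m w dg.
Proof.
move=> Q0 ij /accurate_dist h far.
have := far_dep_stat tcode_ord_eq ij tset_i tset_j Q0 far.
move: h; rewrite ltr_norml => /andP[h _] h2.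
have : m%:R * gamma <= m%:R * (2 * dep_stat (marg i j tcode_ord Q)) by rewrite ler_wpM2l.
by lra.
Qed.

(** The statistic is at most 1. This keeps [gamma / 8] in the range of the Hoeffding bound. *)
Lemma far_gamma_le (Q : distr R n) gamma : (forall x, 0 < Q x) -> i != j ->
  far_from_indep gamma Q i j tset -> gamma <= 2.
Proof.
move=> Q0 ij far; have := far_dep_stat tcode_ord_eq ij tset_i tset_j Q0 far.
have := dep_stat_le1 i j tcode_ord Q; lra.
Qed.

Lemma accurate_prob (P : distr R n) gamma m : 0 <= gamma <= 2 -> (0 < m)%N ->
  Ex P [ffun=> false] m (fun w => (~~ accurate P gamma m w)%:R) <=
  2 ^+ (4 * 2 ^ d) * expR (- (m%:R * gamma ^+ 2 / 256)).
Proof.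
move=> g01 m0; have t01 : 0 <= gamma / 8 <= 1/2.
  by case/andP: g01 => *; apply/andP; split; lra.
have := emp_l1 i j tcode_ord P [ffun=> false] t01 m0; rewrite card_ord => h.
apply: le_trans h _; rewrite ler_wpM2l ?exprn_ge0 // exp.ler_expR lerN2.
by rewrite expr_div_n; lra.
Qed.

End OneTuple.

Lemma tuple_onto (i j : 'I_n) (T : {set 'I_n}) : (#|T| <= d)%N -> i \notin T -> j \notin T ->
  exists2 v, (v < n ^ (d + 2))%N &
    [/\ digit n v 0 = i, digit n v 1 = j & tset (digit n v) = T].
Proof.
(* The default value [i] of [nth] pads the list of [T] to length [d]; the mask discards it. *)
move=> Td iT jT; pose f r : nat := if r == 0%N then val i else if r == 1%N then val j else
   val (nth i (enum T) (r - 2)).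
have fl r : (f r < n)%N by rewrite /f; do 2 (case: ifP => _; first exact: ltn_ord); exact: ltn_ord.
have [v vn hv] := digit_onto n1 (d + 2) fl; exists v => //.
have d0 : digit n v 0 = i by rewrite hv //; lia.
have d1 : digit n v 1 = j by rewrite hv //; lia.
split=> //; apply/setP => k; rewrite inE /tmask d0 d1.
apply/and3P/idP => [[/hasP[r]]|kT].
  rewrite mem_iota => /= rd; rewrite hv; last by lia.
  rewrite /f !addn2 /= subn2 /= => /eqP e ki kj.
  have {}e : nth i (enum T) r = k by exact: val_inj.
  have [rs|rs] := ltnP r (size (enum T)); last by rewrite nth_default // in e; rewrite e eqxx in ki.
  by rewrite -e -mem_enum mem_nth.
split; first last.
- by apply: contraNneq jT => /val_inj <-.
- by apply: contraNneq iT => /val_inj <-.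
have ks : (index k (enum T) < size (enum T))%N by rewrite index_mem mem_enum.
apply/hasP; exists (index k (enum T)).
  by rewrite mem_iota /=; apply: leq_trans ks _; rewrite -cardE.
rewrite hv; last by have := leq_trans ks (_ : (size (enum T) <= d)%N); rewrite -cardE => /(_ Td); lia.
by rewrite /f !addn2 /= subn2 /= nth_index ?mem_enum.
Qed.

End TupleTest.

(** * Error probabilities *)

Section RealBounds.
Variable R : realType.

(** One of [q] and [1 - q] is at least 1/2. This gives [1 / (q * (1 - q)) <= 2 / c]. *)
Lemma le_double_var (c q : R) : 0 < c -> c <= q <= 1 - c -> c <= 2 * (q * (1 - q)).
Proof.
move=> c0 /andP[q1 q2]; have [h|h] := lerP q (1/2).
  have : 0 <= q * (1 - 2 * q) by apply: mulr_ge0; lra.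
  lra.
have : 0 <= (1 - q) * (2 * q - 1) by apply: mulr_ge0; lra.
lra.
Qed.

Lemma var_diff_le (p q : R) : 0 <= p <= 1 -> 0 <= q <= 1 ->
  p * (1 - p) <= q * (1 - q) + `|p - q|.
Proof.
move=> /andP[? ?] /andP[? ?]; rewrite -lerBlDl.
have -> : p * (1 - p) - q * (1 - q) = (p - q) * (1 - p - q) by ring.
apply: le_trans (ler_norm _) _; rewrite normrM ler_piMr //.
by rewrite ler_norml; apply/andP; split; lra.
Qed.

Lemma var_le (p : R) : p * (1 - p) <= 1/2.
Proof. by have := sqr_ge0 (p - 1/2); lra. Qed.

End RealBounds.

(** * Two nets over one structure: noise, gaps and moments of the U-statistic *)

Section KnownStructure.
Variables (R : realType) (n d : nat) (G : dag n) (s : {perm 'I_n}).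
Variables (P Q : distr R n) (phi psi : 'I_n -> bits n -> R) (eps gamma c C : R).
Hypothesis topo : topological G s.
Hypothesis facP : factors G P phi.
Hypothesis facQ : factors G Q psi.
Hypothesis degG : (degree G <= d)%N.
Hypothesis c_gt0 : 0 < c.
Hypothesis bal : balanced G Q c C.

Lemma deg_le i : (#|G i| <= d)%N.
Proof. by apply: leq_trans degG; exact: (leq_bigmax (F := fun j => #|parents G j|)). Qed.

Lemma exp_deg_le i : (2 ^ #|G i| <= 2 ^ d)%N.
Proof. by rewrite leq_exp2l ?deg_le. Qed.

Lemma cond_param_bounds i a : c <= cond_param G Q i a <= 1 - c.
Proof. by case: (bal i a). Qed.

Lemma cond_paramE i a : cond_param G Q i a = par_prob psi i a.
Proof.
have /andP[h1 _] := cond_param_bounds i a.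
(* Division by zero yields 0, which is below [c], so the configuration has positive probability. *)
have p0 : Pr Q (par_config G i a) != 0.
  apply: contraTneq (lt_le_trans c_gt0 h1) => e.
  by rewrite /cond_param /cPr e invr0 mulr0 ltxx.
rewrite /cond_param /cPr (@Pr_par_prob _ _ G s Q psi topo facQ i _ a) ?mulfK //.
exact: (@dep_cyl_pa R n G s topo i a).
Qed.

Lemma psi_bounds i x : c <= par_prob psi i x <= 1 - c.
Proof. by rewrite -cond_paramE; exact: cond_param_bounds. Qed.

Lemma psi_open i x : 0 < par_prob psi i x < 1.
Proof. by have := c_gt0; have /andP[? ?] := psi_bounds i x; move=> ?; apply/andP; split; lra. Qed.

Lemma c_le_half : (0 < n)%N -> c <= 1/2.
Proof.
by move=> n0; have /andP[? ?] := cond_param_bounds (Ordinal n0) [ffun=> true]; lra.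
Qed.

Lemma Q_pos x : 0 < Q x.
Proof.
by case: (facQ) => _ _ _ ->; apply: prodr_gt0 => i _; apply: (psi_gt0 facQ psi_open).
Qed.

Local Notation A := ('I_n * 'I_(2 ^ d))%type.
Local Notation mean := (mean P).

(** A table row has length [2 ^ d], but node [i] has only [2 ^ #|G i|] configurations; the remaining
    entries are dead. *)
Definition live (a : A) : bool := (a.2 < 2 ^ #|G a.1|)%N.
Definition conf (a : A) (x : bits n) : R := (pcode G a.1 x == a.2)%:R.
Definition pv (a : A) : R := par_prob phi a.1 (decode_config G a.1 a.2).
Definition qv (a : A) : R := pprob d G Q eps gamma (2 ^ d) a.1 a.2.
Definition noise (a : A) (x : bits n) : R := conf a x * ((x a.1)%:R - pv a).
(** Zero on dead entries: their probability is 0, so bounding [gap ^ 2] by a multiple of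
    [weight * gap ^ 2] would fail for any other value. *)
Definition gap (a : A) : R := if live a then pv a - qv a else 0.
Definition weight (a : A) : R := mean (conf a).
Definition inv_var (a : A) : R := (qv a * (1 - qv a))^-1.

Lemma pprob_cond (i : 'I_n) z : (z < 2 ^ d)%N ->
  pprob d G Q eps gamma (2 ^ d) i z = cond_param G Q i (decode_config G i z).
Proof.
move=> zl; rewrite /pprob addnC addn2 /= divnMDl ?expn_gt0 // divn_small // addn0.
by rewrite valK modnMDl modn_small.
Qed.

Lemma qvE a : qv a = par_prob psi a.1 (decode_config G a.1 a.2).
Proof. by rewrite /qv pprob_cond ?cond_paramE. Qed.

Lemma qv_bounds a : c <= qv a <= 1 - c.
Proof. by rewrite qvE; exact: psi_bounds. Qed.

Lemma conf01 a x : conf a x = 0 \/ conf a x = 1.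
Proof. by rewrite /conf; case: (_ == _); [right | left]. Qed.

Lemma conf_pcode a x : conf a x != 0 -> pcode G a.1 x = a.2 :> nat.
Proof. by rewrite /conf pnatr_eq0 eqb0 negbK => /eqP. Qed.

Lemma conf_live a x : conf a x != 0 -> live a.
Proof. by move/conf_pcode => e; rewrite /live -e pcode_lt_deg. Qed.

Lemma par_prob_decode (ph : 'I_n -> bits n -> R) (PP : bits n -> R) i x : factors G PP ph ->
  par_prob ph i (decode_config G i (pcode G i x)) = par_prob ph i x.
Proof.
by move=> f; apply: (par_prob_dep f (pa_irr topo i)) => j jG; rewrite decode_pcode.
Qed.

Lemma conf_pv a x : conf a x != 0 -> pv a = par_prob phi a.1 x.
Proof. by move/conf_pcode => e; rewrite /pv -e (par_prob_decode _ _ facP). Qed.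

Lemma conf_qv a x : conf a x != 0 -> qv a = par_prob psi a.1 x.
Proof. by move/conf_pcode => e; rewrite qvE -e (par_prob_decode _ _ facQ). Qed.

Lemma conf_dep a : dep (before s (s a.1)) (conf a).
Proof.
move=> x y xy; rewrite /conf (_ : pcode G a.1 x = pcode G a.1 y) //.
apply/eqP; rewrite pcode_eq; apply/forallP => j; apply/implyP => jG.
by rewrite xy // inE topo.
Qed.

Lemma noiseE a x : noise a x = conf a x * ((x a.1)%:R - par_prob phi a.1 x).
Proof.
rewrite /noise; have [->|h] := eqVneq (conf a x) 0; first by rewrite !mul0r.
by rewrite (conf_pv h).
Qed.

Lemma mean_noise a : mean (noise a) = 0.
Proof.
rewrite -(martingale topo facP (@conf_dep a)); apply: eq_mean => x; exact: noiseE.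
Qed.

Lemma noise_dep a (b : A) : (s a.1 < s b.1)%N -> dep (before s (s b.1)) (noise a).
Proof.
move=> ab x y xy; rewrite /noise (conf_dep (a := a) (y := y)) ?xy //.
  by rewrite inE.
by move=> k; rewrite inE => ka; apply: xy; rewrite inE; apply: ltn_trans ab.
Qed.

(** Two configurations of one node exclude each other; for two nodes, the noise of the earlier one
    is a function of the past of the later one, to which the martingale identity applies. *)
Lemma mean_noise2 a b : a != b -> mean (fun x => noise a x * noise b x) = 0.
Proof.
have key a' b' : (s a'.1 < s b'.1)%N -> mean (fun x => noise a' x * noise b' x) = 0.
  move=> ab; have df := depM (noise_dep ab) (@conf_dep b').
  rewrite -(martingale topo facP df); apply: eq_mean => x.
  by rewrite (noiseE b') mulrA.
move=> ab; have [e|ne] := eqVneq a.1 b.1; last first.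
  have : s a.1 != s b.1 by rewrite (inj_eq perm_inj).
  rewrite -val_eqE /= neq_ltn => /orP[h|h]; first exact: key.
  by rewrite -(key _ _ h); apply: eq_mean => x; rewrite mulrC.
rewrite -(mean_cst (pmf_sum1 P) 0); apply: eq_mean => x.
rewrite /noise mulrACA (_ : conf a x * conf b x = 0) ?mul0r //.
rewrite /conf -natrM mulnb -e; case: eqP => // ->; case: eqP => // /val_inj e2.
by case/eqP: ab; case: a b e e2 => [a1 a2] [b1 b2] /= -> ->.
Qed.

Lemma mean_noise_sq a : mean (fun x => noise a x * noise a x) = weight a * (pv a * (1 - pv a)).
Proof.
rewrite (@eq_mean _ _ P _ (fun x => (1 - 2 * pv a) * noise a x + conf a x * (pv a * (1 - pv a)))).
  by rewrite meanD meanZ mean_noise mulr0 add0r meanZr.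
by move=> x; rewrite /noise; case: (conf01 a x) => ->; case: (x a.1) => /=; ring.
Qed.

Lemma pv01 a : 0 <= pv a <= 1.
Proof. by rewrite (par_prob_ge0 facP) (par_prob_le1 facP). Qed.

Definition divergence : R := \sum_a weight a * (inv_var a * gap a ^+ 2).

Lemma qq_gt0 a : 0 < qv a * (1 - qv a).
Proof.
have c0 := c_gt0; have /andP[? ?] := qv_bounds a.
by rewrite mulr_gt0 //; lra.
Qed.

Lemma inv_var_gt0 a : 0 < inv_var a.
Proof. by rewrite invr_gt0 qq_gt0. Qed.

Lemma weight_ge0 a : 0 <= weight a.
Proof. by apply: mean_ge0 => x; [exact: pmf_ge0 | case: (conf01 a x) => ->; rewrite ?lexx ?ler01]. Qed.

Lemma weight_dead a : ~~ live a -> weight a = 0.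
Proof.
move=> nl; rewrite -(mean_cst (pmf_sum1 P) 0); apply: eq_mean => x.
by apply/eqP; apply: contraNT nl; exact: conf_live.
Qed.

Lemma l1_divergence : l1 P Q ^+ 2 <= 4 * divergence.
Proof.
apply: le_trans (l1_sq_le_chi topo facP facQ psi_open) _.
rewrite ler_pM2l // le_eqVlt; apply/orP; left; apply/eqP.
transitivity (mean (fun x => \sum_a conf a x * (inv_var a * gap a ^+ 2))); last first.
  by rewrite mean_sum; apply: eq_bigr => a _; rewrite meanZr.
apply: eq_bigr => x _; congr (_ * _).
rewrite -(pair_big xpredT xpredT (fun i z => conf (i, z) x * (inv_var (i, z) * gap (i, z) ^+ 2))) /=.
apply: eq_bigr => i _.
have pl : (pcode G i x < 2 ^ d)%N by apply: leq_trans (pcode_lt_deg G i x) (exp_deg_le i).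
rewrite (bigD1 (Ordinal pl)) //= big1 ?addr0 => [|z zne]; last first.
  rewrite /conf /= (_ : (pcode G i x == z) = false) ?mul0r //.
  by apply/negbTE; apply: contraNneq zne => e; apply/eqP/val_inj; rewrite /= e.
set a := (i, Ordinal pl); have c1 : conf a x = 1 by rewrite /conf eqxx.
have cn : conf a x != 0 by rewrite c1 oner_eq0.
by rewrite c1 mul1r /gap (conf_live cn) /inv_var (conf_pv cn) (conf_qv cn) mulrC.
Qed.

Section UPhase.
Variables (m T0 : nat) (f : nat -> nat -> nat).
Hypothesis m_gt0 : (1 < m)%N.
Hypothesis T0_gt0 : (0 < T0)%N.
Hypothesis f_good : forall a, live a ->
  (T0 <= f a.1 a.2)%N /\ m%:R * weight a / 2 <= (f a.1 a.2)%:R <= 2 * (m%:R * weight a).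

Definition wgt (a : A) : R := count_weight d G Q eps gamma (2 ^ d) m f a.1 a.2.

Lemma wgt_ge0 a : 0 <= wgt a.
Proof. by rewrite divr_ge0 // mulr_ge0 // ltW ?qq_gt0. Qed.

(** The count is within a factor 2 of [m * weight a]; this makes the mean of the statistic
    comparable to [divergence]. *)
Lemma wgt_weight a : live a ->
  inv_var a / 2 <= wgt a * weight a <= 2 * inv_var a.
Proof.
move=> la; have [h1 /andP[h2 h3]] := f_good la.
have f0 : 0 < (f a.1 a.2)%:R :> R by rewrite ltr0n; apply: leq_trans h1.
have -> : wgt a * weight a = (m%:R * weight a / (f a.1 a.2)%:R) * inv_var a.
  rewrite /wgt /count_weight /inv_var -/(qv a); field.
  have c0 := c_gt0; have /andP[? ?] := qv_bounds a; rewrite !gt_eqF //; lra.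
have iv := inv_var_gt0 a; set r := m%:R * _ / _.
have r1 : 1/2 <= r by rewrite ler_pdivlMr //; lra.
have r2 : r <= 2 by rewrite ler_pdivrMr //; lra.
by apply/andP; split; nra.
Qed.

(** A configuration with an accurate count of at least [T0] has probability at least [T0 / (2 * m)],
    the source of the parameter [t]. *)
Lemma weight_T0 a : live a -> 1 <= (2 * m%:R / T0%:R) * weight a.
Proof.
move=> la; have [h1 /andP[_ h3]] := f_good la.
have t0 : 0 < T0%:R :> R by rewrite ltr0n.
rewrite mulrAC ler_pdivlMr // mul1r -mulrA; apply: le_trans h3.
by rewrite ler_nat.
Qed.

Let gfun (a : A) (x : bits n) : R := noise a x + gap a * conf a x.
Let mu (a : A) : R := gap a * weight a.

Lemma gvalE (a : A) x : gval d G Q eps gamma (2 ^ d) a.1 a.2 x = gfun a x.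
Proof.
rewrite /gval -/(conf a x) -/(qv a) nbitE /gfun /noise.
have [->|h] := eqVneq (conf a x) 0; first by rewrite !mul0r mulr0 addr0.
by rewrite /gap (conf_live h); ring.
Qed.

Lemma tester_ustatE w :
  tester_ustat d G Q eps gamma (2 ^ d) m (count_weight d G Q eps gamma (2 ^ d) m f) w =
  ustat wgt gfun m w.
Proof.
apply: eq_bigr => t _.
rewrite (pair_big xpredT xpredT (fun (i : 'I_n) (z : 'I_(2 ^ d)) => _)) /=.
apply: eq_bigr => a _; rewrite gvalE; congr (_ * (_ * _)).
by apply: eq_bigr => u _; rewrite gvalE.
Qed.

Lemma ustat_variance_bound : let N : R := #|{: A}|%:R in
  let r := 2 / c in let t := 2 * m%:R / T0%:R in let V := divergence in
  is_true (Ex P [ffun=> false] m (fun w => (ustat wgt gfun m w -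
      m%:R * (m%:R - 1) / 2 * \sum_a wgt a * mu a ^+ 2) ^+ 2) <=
  m%:R ^+ 2 * (32 * N + 48 * (r * (t * V)) + 16 * (t * V) ^+ 2) +
  2 * m%:R ^+ 3 * (4 * (r * V) + 8 * (t * V ^+ 2))).
Proof.
move=> N r t V; have c0 := c_gt0; have sum1 := pmf_sum1 P; have ge0 := @pmf_ge0 _ _ P.
have r0 : 0 <= r by rewrite divr_ge0 // ltW.
have t0 : 0 <= t by rewrite divr_ge0 // mulr_ge0.
pose v a := weight a * (pv a * (1 - pv a)).
have iv_r a : inv_var a <= r.
  rewrite /r /inv_var -div1r ler_pdivrMr ?qq_gt0 // mulrAC ler_pdivlMr // mul1r.
  exact: le_double_var (qv_bounds a).
have wv1 a : wgt a * v a <= 2 * inv_var a * (pv a * (1 - pv a)).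
  rewrite /v mulrA; have /andP[p0 p1] := pv01 a.
  apply: ler_wpM2r; first by rewrite mulr_ge0 // subr_ge0.
  have [la|nl] := boolP (live a); first by have /andP[] := wgt_weight la.
  by rewrite weight_dead // mulr0 mulr_ge0 // ltW ?inv_var_gt0.
have qq a := qq_gt0 a.
have ivq a : inv_var a * (qv a * (1 - qv a)) = 1 by rewrite mulVf // gt_eqF.
have wv_le a : wgt a * v a <= 2 + 2 * (`|gap a| * inv_var a).
  have [la|nl] := boolP (live a); last first.
    rewrite /v weight_dead // mul0r mulr0 addr_ge0 // mulr_ge0 // mulr_ge0 //.
    by rewrite ltW ?inv_var_gt0.
  apply: le_trans (wv1 a) _; have /andP[q1 q2] := qv_bounds a.
  have -> : 2 + 2 * (`|gap a| * inv_var a) = 2 * inv_var a * (qv a * (1 - qv a) + `|gap a|).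
    by rewrite mulrDr -[2 * inv_var a * (_ * _)]mulrA ivq; ring.
  rewrite ler_pM2l ?mulr_gt0 ?inv_var_gt0 // /gap la.
  by apply: var_diff_le; [exact: pv01 | apply/andP; split; lra].
have wv_r a : wgt a * v a <= r.
  apply: le_trans (wv1 a) _; apply: le_trans (iv_r a).
  have -> : 2 * inv_var a * (pv a * (1 - pv a)) = inv_var a * (2 * (pv a * (1 - pv a))) by ring.
  rewrite ler_piMr ?(ltW (inv_var_gt0 a)) //.
  by have := var_le (pv a); lra.
have wpi a : wgt a * weight a * gap a ^+ 2 <= 2 * (inv_var a * gap a ^+ 2).
  have [la|nl] := boolP (live a); last by rewrite /gap (negbTE nl) expr0n !mulr0.
  by rewrite mulrA; apply: ler_wpM2r; [exact: sqr_ge0 | have /andP[] := wgt_weight la].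
have chi_pi a : inv_var a * gap a ^+ 2 <= t * (weight a * (inv_var a * gap a ^+ 2)).
  have [la|nl] := boolP (live a); last by rewrite /gap (negbTE nl) expr0n !mulr0.
  rewrite [leRHS]mulrA ler_peMl ?weight_T0 //.
  by rewrite mulr_ge0 ?sqr_ge0 // (ltW (inv_var_gt0 a)).
have iv0 a : 0 <= inv_var a by rewrite ltW ?inv_var_gt0.
have gmu a : mean (gfun a) = mu a.
  by rewrite /gfun meanD meanZ mean_noise add0r.
apply: le_trans (ustat_variance [ffun=> false] ge0 sum1 m wgt_ge0 gmu) _; apply: lerD.
  apply: ler_wpM2l; first exact: sqr_ge0.
  by apply: (cov_form_bound ge0 sum1 (pi := weight) (v := v) (chi := inv_var)) => //;
    [exact: wgt_ge0 | exact: conf01 | exact: mean_noise | exact: mean_noise2 | exact: mean_noise_sq].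
apply: ler_wpM2l; first by rewrite mulr_ge0 // exprn_ge0.
by apply: (linear_bound ge0 sum1 (pi := weight) (v := v) (chi := inv_var)) => //;
    [exact: wgt_ge0 | exact: conf01 | exact: mean_noise2 | exact: mean_noise_sq].
Qed.

Lemma mu_lower : divergence / 2 <= \sum_a wgt a * mu a ^+ 2.
Proof.
rewrite /divergence mulr_suml; apply: ler_sum => a _; rewrite /mu.
have [la|nl] := boolP (live a); last by rewrite /gap (negbTE nl) !(mul0r, expr0n, mulr0).
have /andP[h _] := wgt_weight la.
rewrite [leRHS](_ : _ = (wgt a * weight a) * (gap a ^+ 2 * weight a)); last by ring.
rewrite [leLHS](_ : _ = (inv_var a / 2) * (gap a ^+ 2 * weight a)); last by ring.
by apply: ler_wpM2r => //; rewrite mulr_ge0 ?sqr_ge0 ?weight_ge0.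
Qed.

End UPhase.
End KnownStructure.

(** The verdict is a function of the samples, so for a sample tape with verdict [b] all [2 ^ t] coin
    tapes count and their weights sum to 1. *)
Lemma verdict_prob_ge (R : realType) n (A : prog) (st : state R) (P : distr R n) m t b
    (V : (nat -> bits n) -> bool) :
  (forall xs rs, exists2 st1, exec xs rs A st st1 & verdict st1 = V xs) ->
  Ex P [ffun=> false] m (fun w => (V w == b)%:R) <= verdict_prob A st P m t b.
Proof.
move=> h; rewrite Ex_tape; apply: ler_sum => xs _.
have p0 : 0 <= \prod_(k < m) P (xs k) by apply: prodr_ge0 => k _; exact: pmf_ge0.
case: eqP => [Vb|_]; last by rewrite mulr0 sumr_ge0 // => rs _; rewrite divr_ge0 // exprn_ge0.
rewrite mulr1 [leRHS](eq_bigl xpredT) => [|rs]; last first.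
  by apply/asboolP; have [st1 e v] := h (tape [ffun=> false] xs) (tape false rs);
     exists st1 => //; rewrite v.
by rewrite sumr_const card_ffun card_bool card_ord -[leRHS]mulr_natr natrX divfK ?lexx ?expf_neq0 ?pnatr_eq0 //.
Qed.

Section Phases.
Variables (R : realType) (X : finType) (P : X -> R) (x0 : X).
Hypothesis P_ge0 : forall x, 0 <= P x.
Hypothesis P_sum1 : \sum_x P x = 1.
Local Notation Ex := (Ex P x0).
Implicit Types (w : nat -> X).

Lemma Ex_le_cst m (f : (nat -> X) -> R) r : (forall w, f w <= r) -> Ex m f <= r.
Proof. by move=> h; rewrite -(Ex_cst x0 P_sum1 m r); apply: le_Ex. Qed.

Lemma ExN m (b : pred (nat -> X)) :
  Ex m (fun w => (b w)%:R) = 1 - Ex m (fun w => (~~ b w)%:R).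
Proof.
apply/eqP; rewrite -subr_eq0 opprB addrA -ExD subr_eq0; apply/eqP.
apply: etrans (Ex_cst x0 P_sum1 m 1); by apply: eq_Ex => w; case: (b w); rewrite /= ?addr0 ?add0r.
Qed.

Lemma Ex_union m (I : finType) (D : pred (nat -> X)) (B : I -> pred (nat -> X)) (r : R) :
  (forall w, D w -> exists i, B i w) ->
  (forall i, Ex m (fun w => (B i w)%:R) <= r) -> Ex m (fun w => (D w)%:R) <= #|I|%:R * r.
Proof.
move=> DB h; apply: le_trans (le_Ex x0 P_ge0 m (g := fun w => \sum_i (B i w)%:R) _) _ => [w|].
  have [/DB[i Bi]|_] := boolP (D w); last by apply: sumr_ge0.
  by rewrite (bigD1 i) //= Bi lerDl sumr_ge0.
rewrite Ex_sum mulr_natl -sumr_const; exact: ler_sum.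
Qed.

Lemma chebyshev m (f : (nat -> X) -> R) (D : pred (nat -> X)) (mu a v : R) : 0 < a ->
  Ex m (fun w => (f w - mu) ^+ 2) <= v -> (forall w, D w -> a <= `|f w - mu|) ->
  Ex m (fun w => (D w)%:R) <= v / a ^+ 2.
Proof.
move=> a0 hv hD; rewrite ler_pdivlMr ?exprn_gt0 // mulrC -ExZ.
apply: le_trans hv; apply: le_Ex => // w; have [Dw|_] := boolP (D w).
  by rewrite mulr1 -[leRHS]real_normK ?num_real // lerXn2r ?nnegrE ?normr_ge0 ?(ltW a0) ?hD.
by rewrite mulr0 sqr_ge0.
Qed.

(** The weights of the third batch are functions of the second. Its error [E w1] is therefore
    bounded with [w1] fixed, outside the bad event [B]. *)
Lemma Ex_phases a b e (A B : pred (nat -> X)) (D : pred (nat -> X))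
    (E : (nat -> X) -> pred (nat -> X)) (ra rb re : R) :
  0 <= re ->
  (forall w w1 w2, D (cat a w (cat b w1 w2)) -> [|| A w, B w1 | E w1 w2]) ->
  Ex a (fun w => (A w)%:R) <= ra -> Ex b (fun w => (B w)%:R) <= rb ->
  (forall w1, ~~ B w1 -> Ex e (fun w2 => (E w1 w2)%:R) <= re) ->
  Ex (a + (b + e)) (fun w => (D w)%:R) <= ra + rb + re.
Proof.
move=> re0 hD hA hB hE; rewrite Ex_cat.
have key w : Ex (b + e) (fun w' => (D (cat a w w'))%:R) <= (A w)%:R + (rb + re).
  rewrite Ex_cat; apply: le_trans (_ : Ex b (fun w1 => ((A w)%:R + (B w1)%:R) + re) <= _).
    apply: le_Ex => // w1; have [Bw|nB] := boolP (B w1).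
      apply: Ex_le_cst => w2; apply: le_trans (_ : 1 <= _); first by case: (D _).
      by rewrite /= addrAC lerDr addr_ge0.
    rewrite addr0; apply: le_trans (_ : Ex e (fun w2 => (A w)%:R + (E w1 w2)%:R) <= _).
      apply: le_Ex => // w2; have [/hD|_] := boolP (D _); last by rewrite addr_ge0.
      by rewrite (negbTE nB) /= => /orP[->|->]; rewrite ?lerDl ?lerDr.
    by rewrite ExD Ex_cst // lerD2l hE.
  by rewrite ExD (ExD _ _ b (fun=> (A w)%:R)) !Ex_cst // addrA lerD2r lerD2l.
apply: le_trans (le_Ex x0 P_ge0 a key) _.
by rewrite ExD Ex_cst // addrA lerD2r lerD2r.
Qed.

End Phases.

Lemma verdict_prob_two_thirds (R : realType) n (A : prog) (st : state R) (P : distr R n) m t b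
    (V D : (nat -> bits n) -> bool) :
  (forall xs rs, exists2 st1, exec xs rs A st st1 & verdict st1 = V xs) ->
  (forall w, V w != b -> D w) -> Ex P [ffun=> false] m (fun w => (D w)%:R) <= 1 / 3 ->
  2 / 3 <= verdict_prob A st P m t b.
Proof.
move=> hV hD h; apply: le_trans (verdict_prob_ge P m t b hV).
rewrite (ExN [ffun=> false] (pmf_sum1 P) m (fun w => V w == b)).
have : Ex P [ffun=> false] m (fun w => (V w != b)%:R) <= 1 / 3.
  apply: le_trans h; apply: le_Ex => [x|w]; first exact: pmf_ge0.
  by rewrite ler_nat; case: eqP (hD w) => //= _ ->.
lra.
Qed.

Section Verdict.
Variables (R : realType) (n d : nat) (G : dag n) (Q : distr R n) (eps gamma : R).
Variables (m0 m1 T0 : nat).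
Local Notation cnt := (config_count G m1).
Local Notation tuples_ok w := (all (tuple_ok d G gamma (2 ^ d) m0 w) (iota 0 (n ^ (d + 2)))).
Local Notation hits f := (hit_total n (2 ^ d) T0 f == nconfigs G).
Local Notation small f w := (64 * tester_ustat d G Q eps gamma (2 ^ d) m1
   (count_weight d G Q eps gamma (2 ^ d) m1 f) w <= m1%:R * m1%:R * (eps * eps)).

Definition accepts (w : nat -> bits n) : bool :=
  [&& tuples_ok w, hits (cnt (fun t => w (m0 + t)%N)) &
      small (cnt (fun t => w (m0 + t)%N)) (fun t => w (m0 + m1 + t)%N)].

Lemma cat_lt (X : finType) a (w w' : nat -> X) k : (k < a)%N -> cat a w w' k = w k.
Proof. by rewrite /cat => ->. Qed.

Lemma cat_ge (X : finType) a (w w' : nat -> X) k : cat a w w' (a + k) = w' k.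
Proof. by rewrite /cat ltnNge leq_addr /= addKn. Qed.

Lemma eq_tstat p2 (w w' : nat -> bits n) dg : (forall k, (k < m0)%N -> w k = w' k) ->
  tstat R d p2 m0 w dg = tstat R d p2 m0 w' dg.
Proof.
by move=> e; rewrite /tstat; apply: eq_bigr => z _; congr det_ratio;
   congr (_ %:R); apply: eq_bigr => k _; rewrite e.
Qed.

Lemma eq_config_count (w w' : nat -> bits n) : (forall k, (k < m1)%N -> w k = w' k) ->
  cnt w = cnt w'.
Proof.
move=> e; apply/funext => i; apply/funext => z; apply: eq_bigr => k _; by rewrite e.
Qed.

Lemma accepts_cat w w1 w2 : accepts (cat m0 w (cat m1 w1 w2)) =
  [&& tuples_ok w, hits (cnt w1) & small (cnt w1) w2].
Proof.
rewrite /accepts (@eq_config_count _ w1) => [|k km]; last by rewrite cat_ge cat_lt.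
congr [&& _, _ & _].
  apply: eq_all => v; rewrite /tuple_ok (@eq_tstat _ _ w) // => k km; exact: cat_lt.
rewrite (_ : (fun t => _) = w2) //; apply/funext => t.
by rewrite -addnA !cat_ge.
Qed.

End Verdict.

(** Here [h] stands for [1 / T0]. After division by [m ^+ 2] everything is compared with
    [(m * V) ^+ 2 / 2560], where [2560 = 10 * 16 ^ 2]; the numerical hypotheses make each term a
    small fraction of it. *)
Lemma ustat_error_le (R : realType) (m V N c h : R) : 0 < m -> 0 < V -> 0 < c ->
  2 ^+ 36 * N <= (m * V) ^+ 2 -> 2 ^+ 18 <= m * V * c -> 0 <= h -> 2 ^+ 20 * h <= 1 ->
  (m ^+ 2 * (32 * N + 48 * (2 / c * (2 * m * h * V)) + 16 * (2 * m * h * V) ^+ 2) +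
   2 * m ^+ 3 * (4 * (2 / c * V) + 8 * (2 * m * h * V ^+ 2))) / (m ^+ 2 * V / 16) ^+ 2 <= 1 / 10.
Proof.
move=> m0 V0 c0 hN hc h0 h1.
have d0 : 0 < (m ^+ 2 * V / 16) ^+ 2 by rewrite exprn_gt0 // divr_gt0 // mulr_gt0 // exprn_gt0.
rewrite ler_pdivrMr //; set y := m * V in hN hc *; set u := c^-1.
have y0 : 0 < y by rewrite mulr_gt0.
have u0 : 0 < u by rewrite invr_gt0.
have uy : 2 ^+ 18 * u <= y by rewrite /u -ler_pdivlMr ?invr_gt0 // invrK.
have f1 : 2 ^+ 18 * (u * y) <= y ^+ 2 by rewrite mulrA expr2 ler_pM2r.
have f2 : h * y ^+ 2 * 2 ^+ 20 <= y ^+ 2 by rewrite mulrAC [h * _]mulrC ler_piMl // exprn_ge0 // ltW.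
have hs : h <= 2 ^- 20 by rewrite -[leRHS]mul1r ler_pdivlMr ?exprn_gt0 // mulrC.
have f3 : h * (u * y) <= 2 ^- 20 * (u * y) by rewrite ler_wpM2r // mulr_ge0 // ltW.
have f4 : h * (h * y ^+ 2) <= 2 ^- 20 * (h * y ^+ 2) by rewrite ler_wpM2r // mulr_ge0 // exprn_ge0 // ltW.
rewrite [leLHS](_ : _ = m ^+ 2 * (32 * N + 192 * (h * (u * y)) + 64 * (h * (h * y ^+ 2)) +
    16 * (u * y) + 32 * (h * y ^+ 2))); last by rewrite /y /u; ring.
rewrite [leRHS](_ : _ = m ^+ 2 * (y ^+ 2 / 2560)); last by rewrite /y; field.
rewrite ler_pM2l ?exprn_gt0 //.
have y2 : 0 < y ^+ 2 by rewrite exprn_gt0.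
lra.
Qed.

(** * Error of each batch and of the whole tester *)

Section ErrorProbabilities.
Variables (R : realType) (n d : nat) (G : dag n) (s : {perm 'I_n}).
Variables (Q : distr R n) (psi : 'I_n -> bits n -> R) (eps gamma c C : R).
Variables (m0 m1 T0 : nat).
Hypothesis n1 : (1 < n)%N.
Hypothesis topo : topological G s.
Hypothesis facQ : factors G Q psi.
Hypothesis degG : (degree G <= d)%N.
Hypothesis c_gt0 : 0 < c.
Hypothesis bal : balanced G Q c C.
Hypothesis gamma_gt0 : 0 < gamma.
Hypothesis nondeg : nondegenerate G Q d gamma.
Hypothesis eps_gt0 : 0 < eps.
Local Notation configs := ('I_n * 'I_(2 ^ d))%type.
Hypothesis m0_gt0 : nedge G -> (0 < m0)%N.
Hypothesis m0_large : nedge G -> (n ^ (d + 2))%N%:R *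
  (2 ^+ (4 * 2 ^ d) * expR (- (m0%:R * gamma ^+ 2 / 256))) <= 1 / 10 :> R.
Hypothesis T0_large : #|{: configs}|%:R * (2 * expR (- (T0%:R / 64))) <= 1 / 10 :> R.
Hypothesis T0_ge : 2 ^+ 20 <= T0%:R :> R.
Hypothesis m1_hits : forall i a, 2 * T0%:R <= m1%:R * Pr Q (par_config G i a).
Hypothesis m1_cells : 2 ^+ 40 * #|{: configs}|%:R <= (m1%:R * eps ^+ 2) ^+ 2.
Hypothesis m1_c : 2 ^+ 20 <= m1%:R * eps ^+ 2 * c.
Hypothesis m1_gt1 : (1 < m1)%N.
Local Notation Ex P := (Ex P [ffun=> false]).
Local Notation tuples_ok w := (all (tuple_ok d G gamma (2 ^ d) m0 w) (iota 0 (n ^ (d + 2)))).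
Local Notation cnt := (config_count G m1).
Local Notation hits f := (hit_total n (2 ^ d) T0 f == nconfigs G).
Local Notation small f w := (64 * tester_ustat d G Q eps gamma (2 ^ d) m1
   (count_weight d G Q eps gamma (2 ^ d) m1 f) w <= m1%:R * m1%:R * (eps * eps)).

Lemma T0_gt0 : (0 < T0)%N.
Proof. by have := T0_ge; case: T0 => //; rewrite leNgt exprn_gt0. Qed.

Lemma linked_nedge T i j : linked G T i j -> nedge G.
Proof.
move=> h; apply/nedgeP.
by case: h => [h|[k _ /andP[h _]]|[k _ /andP[h _]]|[k _ /andP[h _]]];
   [exists j, i | exists k, i | exists k, i | exists i, k].
Qed.

Lemma digit_ltn v r : (digit n v r < n)%N.
Proof. by rewrite ltn_pmod // ltnW. Qed.

Section OneTuple.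
Variables (v : nat) (i j : 'I_n).
Hypothesis v0 : digit n v 0 = i.
Hypothesis v1 : digit n v 1 = j.
Local Notation T := (tset n d (digit n v)).
Local Notation acc P := (accurate d n1 (digit n v) i j P gamma m0).

Lemma tuple_far : linked G T i j -> i != j -> far_from_indep gamma Q i j T.
Proof. by move=> lk ij; apply: nondeg lk => //; [exact: tset_card | exact: tset_i | exact: tset_j]. Qed.

Lemma tuple_gamma : linked G T i j -> i != j -> 0 <= gamma <= 2.
Proof.
move=> lk ij; rewrite ltW //=.
exact: (far_gamma_le n1 v0 v1 (digit_ltn v) (Q_pos topo facQ c_gt0 bal) ij (tuple_far lk ij)).
Qed.

Lemma tuple_bad_prob : nedge G ->
  Ex Q m0 (fun w => (~~ tuple_ok d G gamma (2 ^ d) m0 w v)%:R) <=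
  2 ^+ (4 * 2 ^ d) * expR (- (m0%:R * gamma ^+ 2 / 256)).
Proof.
move=> ne; have [/andP[/(nlinkedP d G v0 v1) lk ij]|nb] :=
    boolP (nlinked d G (digit n v) && (i != j)).
  apply: le_trans (@accurate_prob R n d n1 (digit n v) i j Q gamma m0 (tuple_gamma lk ij) (m0_gt0 ne)).
  apply: le_Ex => [x|w]; first exact: pmf_ge0.
  rewrite ler_nat; have [aw|_] := boolP (acc Q w); last by case: (tuple_ok _ _ _ _ _ _ _).
  rewrite /tuple_ok negbK.
  by rewrite (accurate_far v0 v1 (digit_ltn v) (Q_pos topo facQ c_gt0 bal) ij aw (tuple_far lk ij)) !andbF.
apply: le_trans (_ : 0 <= _); last by rewrite mulr_ge0 ?exp.expR_ge0 // exprn_ge0.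
apply: Ex_le_cst => [||w]; [exact: pmf_ge0 | exact: pmf_sum1 |].
by rewrite /tuple_ok v0 v1 negbK andbA (negbTE nb).
Qed.

Lemma tuple_indep_prob (P : distr R n) : linked G T i j -> i != j -> cond_indep P i j T ->
  Ex P m0 (fun w => (tuple_ok d G gamma (2 ^ d) m0 w v)%:R) <=
  2 ^+ (4 * 2 ^ d) * expR (- (m0%:R * gamma ^+ 2 / 256)).
Proof.
move=> lk ij ci.
apply: le_trans (@accurate_prob R n d n1 (digit n v) i j P gamma m0 (tuple_gamma lk ij) (m0_gt0 (linked_nedge lk))).
apply: le_Ex => [x|w]; first exact: pmf_ge0.
rewrite ler_nat; have [aw|_] := boolP (acc P w); last by case: (tuple_ok _ _ _ _ _ _ _).
have := accurate_indep v0 v1 (digit_ltn v) aw ci; rewrite ltNge /tuple_ok => ->.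
by rewrite andbT v0 v1 ij (introT (nlinkedP d G v0 v1) lk).
Qed.

End OneTuple.

Lemma tuples_bad_prob : Ex Q m0 (fun w => (~~ tuples_ok w)%:R) <= 1 / 10.
Proof.
have [ne|nn] := boolP (nedge G).
  apply: le_trans (m0_large ne); rewrite -[X in X%:R * _](card_ord (n ^ (d + 2))).
  apply: (@Ex_union R _ Q [ffun=> false] (@pmf_ge0 _ _ Q) m0 _ (fun w => ~~ tuples_ok w)
    (fun (v : 'I_(n ^ (d + 2))) w => ~~ tuple_ok d G gamma (2 ^ d) m0 w v)).
    by move=> w /allPn[v]; rewrite mem_iota => /= vl bad; exists (Ordinal vl).
  by move=> v; apply: (@tuple_bad_prob v (Ordinal (digit_ltn v 0)) (Ordinal (digit_ltn v 1))).
apply: le_trans (_ : 0 <= _); last by lra.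
apply: Ex_le_cst => [||w]; [exact: pmf_ge0 | exact: pmf_sum1 |].
rewrite (_ : tuples_ok w) //; apply/allP => v _; rewrite /tuple_ok.
have [/(@nlinkedP _ _ _ _ (Ordinal (digit_ltn v 0)) (Ordinal (digit_ltn v 1)) erefl erefl)/linked_nedge|//] :=
  boolP (nlinked d G (digit n v)).
by rewrite (negbTE nn).
Qed.

(** The single tuple that encodes [i], [j] and [T] already rejects with high probability. *)
Lemma structure_bad_prob (P : distr R n) (i j : 'I_n) (T : {set 'I_n}) :
  i != j -> (#|T| <= d)%N -> i \notin T -> j \notin T -> linked G T i j -> cond_indep P i j T ->
  Ex P m0 (fun w => (tuples_ok w)%:R) <= 1 / 10.
Proof.
move=> ij Td iT jT lk ci; have [v vl [v0 v1 vT]] := tuple_onto n1 Td iT jT.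
apply: le_trans (m0_large (linked_nedge lk)).
apply: le_trans (_ : Ex P m0 (fun w => (tuple_ok d G gamma (2 ^ d) m0 w v)%:R) <= _).
  apply: le_Ex => [x|w]; first exact: pmf_ge0.
  by rewrite ler_nat; case: allP => // /(_ v) ->; rewrite // mem_iota.
rewrite -vT in lk ci; apply: le_trans (tuple_indep_prob v0 v1 lk ij ci) _.
by rewrite ler_peMl ?mulr_ge0 ?exp.expR_ge0 ?exprn_ge0 // (ler_nat R 1) expn_gt0 ltnW.
Qed.

Lemma config_count_dead w (i : 'I_n) z : (2 ^ #|G i| <= z)%N -> cnt w i z = 0%N.
Proof.
move=> zl; apply: big1 => k _; apply/eqP; rewrite eqb0.
by apply: contraTneq zl => <-; rewrite -ltnNge pcode_lt_deg.
Qed.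

Section Counts.
Variable P : distr R n.
Local Notation weight := (weight G P).
Implicit Types (a : configs) (f : nat -> nat -> nat).

Definition within f a : bool :=
  (m1%:R * weight a / 2 <= (f a.1 a.2)%:R) && ((f a.1 a.2)%:R <= 2 * (m1%:R * weight a)).

Definition good f : bool :=
  [forall a : configs, live G a ==> ((T0 <= f a.1 a.2)%N && within f a)].

Lemma goodP f : reflect (forall a, live G a -> (T0 <= f a.1 a.2)%N /\ within f a) (good f).
Proof.
apply: (iffP forallP) => [h a la|h a]; first by apply/andP; have /implyP := h a; exact.
by apply/implyP => /h/andP.
Qed.

(** When all counts reach the threshold, the first alternative of [chernoff_count] is excluded, so
    inaccurate counts are unlikely under any [P]. *)
Lemma not_good_prob :
  Ex P m1 (fun w => (hits (cnt w) && ~~ good (cnt w))%:R) <= 1 / 10.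
Proof.
apply: le_trans T0_large.
apply: (@Ex_union R _ P [ffun=> false] (@pmf_ge0 _ _ P) m1 configs
   (fun w => hits (cnt w) && ~~ good (cnt w))
   (fun a w => ~~ (((cnt w a.1 a.2)%:R < T0%:R :> R) || within (cnt w) a))).
  move=> w /andP[/(hit_totalP T0_gt0 (exp_deg_le degG) (config_count_dead w)) h /forallPn[a]].
  rewrite negb_imply => /andP[la]; rewrite h //= => nw.
  by exists a; rewrite /= negb_or nw andbT -leNgt ler_nat h.
move=> a; exact: (@chernoff_count R _ P [ffun=> false] (@pmf_ge0 _ _ P) (pmf_sum1 P) m1
  (fun x => pcode G a.1 x == a.2 :> nat) T0%:R (weight a) _ erefl).
Qed.

End Counts.

Lemma weightE (a : configs) : live G a ->
  exists x, weight G Q a = Pr Q (par_config G a.1 x).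
Proof.
move=> /pcode_onto[x ex]; exists x; rewrite /weight /mean /Pr [RHS]big_mkcond /=.
apply: eq_bigr => y _; rewrite inE /conf -ex pcode_eq.
by case: ifP => _; rewrite ?mulr1 ?mulr0.
Qed.

(** Under [Q] the expected count of a live entry is at least [2 * T0], so an accurate count also
    reaches [T0]. *)
Lemma null_good_prob : Ex Q m1 (fun w => (~~ good Q (cnt w))%:R) <= 1 / 10.
Proof.
apply: le_trans T0_large.
have T0p := T0_ge.
apply: (@Ex_union R _ Q [ffun=> false] (@pmf_ge0 _ _ Q) m1 configs (fun w => ~~ good Q (cnt w))
   (fun a w => live G a && ~~ within Q (cnt w) a)).
  move=> w /forallPn[a]; rewrite negb_imply => /andP[la nw]; exists a; rewrite la /=.
  apply: contra nw => wi; rewrite wi andbT -(ler_nat R).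
  have [x ex] := weightE la; have := m1_hits a.1 x; rewrite -ex => h.
  by case/andP: wi => wi _; apply: le_trans wi; lra.
move=> a; have [la|_] := boolP (live G a); last first.
  apply: Ex_le_cst => [||w]; [exact: pmf_ge0 | exact: pmf_sum1 |].
  by rewrite mulr_ge0 // exp.expR_ge0.
have [x ex] := weightE la; have := m1_hits a.1 x; rewrite -ex => h.
apply: (@chernoff_within R _ Q [ffun=> false] (@pmf_ge0 _ _ Q) (pmf_sum1 Q) m1
  (fun x => pcode G a.1 x == a.2 :> nat) T0%:R (weight G Q a) _ erefl) => //.
lra.
Qed.

Lemma m1_gt0 : 0 < m1%:R :> R.
Proof. by rewrite ltr0n ltnW. Qed.

(** All gaps vanish, so the divergence is 0 and only the term in the number of table entries remains
    in the variance. *)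
Lemma null_ustat_prob f : good Q f ->
  Ex Q m1 (fun w => (~~ small f w)%:R) <= 1 / 10.
Proof.
move=> /goodP gf; have m0' := m1_gt0.
have gap0 a : gap (d := d) G Q psi eps gamma a = 0.
  by rewrite /gap; case: ifP => // _; rewrite (qvE eps gamma topo facQ c_gt0 bal) subrr.
have div0 : divergence d G Q Q psi eps gamma = 0.
  by rewrite /divergence big1 // => a _; rewrite gap0 expr0n !mulr0.
have e2 : 0 < eps ^+ 2 by rewrite exprn_gt0.
apply: le_trans (chebyshev (a := m1%:R ^+ 2 * eps ^+ 2 / 64) (@pmf_ge0 _ _ Q) _
  (ustat_variance_bound eps gamma topo facQ facQ c_gt0 bal T0_gt0 gf) _) _.
- by rewrite divr_gt0 // mulr_gt0 // exprn_gt0.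
- move=> w; rewrite (tester_ustatE _ _ _ psi) -ltNge => h.
  rewrite big1 ?mulr0 ?subr0 => [|a _]; last by rewrite gap0 mul0r expr0n mulr0.
  by apply: le_trans (ler_norm _); lra.
rewrite div0 !(mulr0, expr0n) /= !(mulr0, addr0) ler_pdivrMr; last first.
  by rewrite exprn_gt0 // divr_gt0 // mulr_gt0 // exprn_gt0.
have h := m1_cells; have mm : 0 < m1%:R ^+ 2 :> R by rewrite exprn_gt0.
rewrite [leRHS](_ : _ = m1%:R ^+ 2 * ((m1%:R * eps ^+ 2) ^+ 2 / (10 * 64 ^+ 2))); last by field.
rewrite ler_pM2l //; have := sqr_ge0 (m1%:R * eps ^+ 2); lra.
Qed.

(** The mean is at least [m1 ^ 2 * V / 8], and the threshold at most [m1 ^ 2 * V / 16] because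
    [eps ^ 2 <= 4 * V]. Acceptance is thus a deviation of at least [m1 ^ 2 * V / 16]. *)
Lemma far_ustat_prob (P : distr R n) phi f : factors G P phi -> eps < l1 P Q -> good P f ->
  Ex P m1 (fun w => (small f w)%:R) <= 1 / 10.
Proof.
move=> facP far /goodP gf; have m0' := m1_gt0.
have e2 : 0 < eps ^+ 2 by rewrite exprn_gt0.
set V := divergence d G P Q phi eps gamma.
have hV : eps ^+ 2 <= 4 * V.
  apply: le_trans (l1_divergence eps gamma topo facP facQ degG c_gt0 bal).
  by rewrite lerXn2r // ?nnegrE ltW // (lt_trans _ far).
have V0 : 0 < V by lra.
set mu := m1%:R * (m1%:R - 1) / 2 * \sum_(a : configs)
  (wgt G Q eps gamma m1 f a * (gap G Q phi eps gamma a * weight G P a) ^+ 2).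
have mu_ge : m1%:R ^+ 2 * V / 8 <= mu.
  have mu1 := mu_lower phi eps gamma topo facQ c_gt0 bal T0_gt0 gf; rewrite -/V in mu1.
  have m2 : 2 <= m1%:R :> R by rewrite (ler_nat R 2).
  rewrite [leLHS](_ : _ = (m1%:R ^+ 2 / 4) * (V / 2)); last by field.
  apply: ler_pM => //; [by rewrite divr_ge0 // exprn_ge0 // ltW | lra |].
  have : 0 <= m1%:R * (m1%:R - 2) :> R by rewrite mulr_ge0 ?subr_ge0 // ltW.
  lra.
apply: le_trans (chebyshev (a := m1%:R ^+ 2 * V / 16) (@pmf_ge0 _ _ P) _
  (ustat_variance_bound eps gamma topo facP facQ c_gt0 bal T0_gt0 gf) _) _.
- by rewrite divr_gt0 // mulr_gt0 // exprn_gt0.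
- move=> w; rewrite (tester_ustatE _ _ _ phi) -/mu => h; rewrite distrC.
  apply: le_trans (ler_norm _).
  have : m1%:R * m1%:R * (eps * eps) <= m1%:R ^+ 2 * (4 * V).
    by rewrite -!expr2 ler_wpM2l // exprn_ge0 // ltW.
  lra.
have t0 : 0 < T0%:R :> R by apply: lt_le_trans T0_ge; rewrite exprn_gt0.
have hmV : m1%:R * eps ^+ 2 <= 4 * (m1%:R * V).
  by rewrite [leRHS]mulrCA ler_pM2l.
rewrite -/V; apply: ustat_error_le => //.
- have h := m1_cells; have : (m1%:R * eps ^+ 2) ^+ 2 <= (4 * (m1%:R * V)) ^+ 2.
    by rewrite lerXn2r // ?nnegrE ?mulr_ge0 // ltW.
  lra.
- have h := m1_c; have : m1%:R * eps ^+ 2 * c <= 4 * (m1%:R * V) * c by rewrite ler_pM2r.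
  lra.
- by rewrite invr_ge0 ltW.
by rewrite ler_pdivrMr // mul1r.
Qed.

Local Notation accepts := (accepts d G Q eps gamma m0 m1 T0).
Local Notation total := (m0 + (m1 + m1))%N.

Lemma null_reject_prob : Ex Q total (fun w => (~~ accepts w)%:R) <= 1 / 3.
Proof.
apply: le_trans (Ex_phases (@pmf_ge0 _ _ Q) (pmf_sum1 Q)
  (E := fun w1 w2 => ~~ small (cnt w1) w2) (re := 1 / 10) _ _ tuples_bad_prob null_good_prob _) _.
- by rewrite divr_ge0.
- move=> w w1 w2; rewrite accepts_cat !negb_and => /or3P[->|h|->]; rewrite ?orbT //.
  apply/or3P/Or32; apply: contra h => /goodP h.
  apply/(hit_totalP T0_gt0 (exp_deg_le degG) (config_count_dead w1)) => i z zl.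
  have zd : (z < 2 ^ d)%N by apply: leq_trans zl (exp_deg_le degG i).
  by have [] := h (i, Ordinal zd) zl.
- by move=> w1 /negPn /null_ustat_prob.
lra.
Qed.

(** Either [P] satisfies an independence that [G] forbids, and the structure batch rejects, or [P]
    factors over [G], and the other two batches reject. *)
Lemma far_accept_prob (P : distr R n) (T : dag n) :
  bayes_net T P -> (degree T <= d)%N -> (#|skeleton T| <= #|skeleton G|)%N -> eps < l1 P Q ->
  Ex P total (fun w => (accepts w)%:R) <= 1 / 3.
Proof.
move=> netP degT skT far.
have [[i [j [A [ij Ad iA jA [lk ci]]]]]|none] := pselect (exists (i j : 'I_n) (A : {set 'I_n}),
    [/\ i != j, (#|A| <= d)%N, i \notin A, j \notin A & linked G A i j /\ cond_indep P i j A]).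
  apply: le_trans (Ex_phases (@pmf_ge0 _ _ P) (pmf_sum1 P) (A := fun w => tuples_ok w)
    (B := fun=> false) (E := fun _ _ => false) (rb := 0) (re := 0) _ _
    (structure_bad_prob ij Ad iA jA lk ci) _ _) _ => //.
  - by move=> w w1 w2; rewrite accepts_cat => /andP[->].
  - by rewrite Ex_cst //; exact: pmf_sum1.
  - by move=> w1 _; rewrite Ex_cst //; exact: pmf_sum1.
  lra.
have [phi facP] : exists phi, factors G P phi.
  apply: (structure_factors netP degT skT) => [|i j A ij Ad iA jA lk ci]; first by exists s.
  by apply: none; exists i, j, A.
apply: le_trans (Ex_phases (@pmf_ge0 _ _ P) (pmf_sum1 P) (A := fun=> false)
  (B := fun w => hits (cnt w) && ~~ good P (cnt w))
  (E := fun w1 w2 => hits (cnt w1) && small (cnt w1) w2) (ra := 0) (re := 1 / 10) _ _ _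
  (not_good_prob P) _) _ => //.
- by rewrite divr_ge0.
- move=> w w1 w2; rewrite accepts_cat => /and3P[_ -> ->] /=.
  by case: (good _ _).
- by rewrite Ex_cst //; exact: pmf_sum1.
- move=> w1; rewrite negb_and negbK => /orP[/negbTE -> /=|/far_ustat_prob h].
    by rewrite Ex_cst ?divr_ge0 //; exact: pmf_sum1.
  apply: le_trans (h _ facP far); apply: le_Ex => [x|w2]; first exact: pmf_ge0.
  by rewrite ler_nat; case: (_ == _).
lra.
Qed.

End ErrorProbabilities.

(** * Sample and time bounds *)

Local Close Scope ring_scope.

Lemma test_body_cost n d p2 nt lg m0 m1 T0 : 1 < n -> 0 < p2 -> n * n <= nt ->
  static_cost n test_body (params n d p2 nt lg m0 m1 T0) <=
  1024 * (nt * (m0 * d.+1) + nt * (n + p2 + d.+1) + m1 * (n * n)).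
Proof.
move=> n1 p0 nn.
have e1 : m0 * n <= nt * m0 by nia.
have e2 : n * p2 <= nt * p2 by nia.
have e3 : m1 * n <= m1 * (n * n) by nia.
have e4 : 0 < nt by nia.
have e5 : m1 <= m1 * n by nia.
have e6 : m0 <= nt * m0 by nia.
have e7 : n <= nt by nia.
rewrite /static_cost /= !mulnDr !mulnDl !mulnDr.
lia.
Qed.

Section TesterSpec.
Variables (R : realType) (n d : nat) (G : dag n) (Q : distr R n) (eps gamma c C : R).
Hypothesis n1 : 1 < n.
Hypothesis eps_gt0 : (0 < eps)%R.
Hypothesis gamma_gt0 : (0 < gamma)%R.
Hypothesis degG : degree G <= d.
Local Notation m0 := (size0 d G gamma 2).
Local Notation m1 := (size1 n d eps 4).
Local Notation T0 := (threshold n d 2).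

Definition time_bound : nat :=
  2 ^ 24 * (n ^ (d + 2) * (m0 * d.+1) + n ^ (d + 2) * (n + 2 ^ d + d.+1) + m1 * (n * n)).

Lemma log_up_le : log_up n <= n.
Proof.
have [_] := @leastP (fun k => n <= 2 ^ k) (ex_intro _ n (ltnW (ltn_expl n (isT : 1 < 2)))).
by apply; apply: ltnW; apply: ltn_expl.
Qed.

Lemma tester_cost : 7 + 3 * (n + n + d) + (setup_cost d G eps gamma 2 4 2 +
  static_cost n test_body (tester_params d G eps gamma 2 4 2)) <= time_bound.
Proof.
have lg := log_up_le; have p0 : 0 < 2 ^ d by rewrite expn_gt0.
have nn : n * n <= n ^ (d + 2) by rewrite addnC expnD leq_pmulr // expn_gt0 ltnW.
have h := @test_body_cost n d (2 ^ d) (n ^ (d + 2)) (log_up n) m0 m1 T0 n1 p0 nn.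
rewrite /time_bound /setup_cost /threshold -/(tester_params d G eps gamma 2 4 2) in h *.
move: h; set k := static_cost _ _ _; set nt := n ^ (d + 2) in nn *; set p2 := 2 ^ d in p0 *.
move: (m0) (m1) => a b h.
have e1 : n <= nt by nia.
have e2 : a <= nt * (a * d.+1) by nia.
have e3 : b <= b * (n * n) by nia.
have e4 : nt + n + p2 + d.+1 <= nt * (n + p2 + d.+1) by nia.
have e5 : n * (10 + 6 * n) <= 16 * nt by nia.
have -> : 1024 ^ 2 = 2 ^ 20 by rewrite -[1024]/(2 ^ 10) -expnM.
have -> : 2 ^ 24 = 2 ^ 20 * 16 by rewrite -[16]/(2 ^ 4) -expnD.
have e6 : 1024 <= 2 ^ 20 by rewrite -[1024]/(2 ^ 10) leq_exp2l.
move: h e2 e3 e4 e5 e6; set u := nt * (a * d.+1); set v := nt * (n + p2 + d.+1).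
set z := b * (n * n); move: (2 ^ 20) => K h e2 e3 e4 e5 e6.
have e7 : K * (d + log_up n + 1) <= K * v by rewrite leq_mul2l; apply/orP; right; lia.
have e8 : 1024 * (u + v + z) <= K * (u + v + z) by rewrite leq_mul2r e6 orbT.
have e9 : 1024 <= K by [].
have e10 : 3 * d + 3 * (d + 2) + 3 * n + 2 * p2 + 2 * nt + 2 * log_up n + 4 * n + 16 * nt +
  2 * a + 2 * b + 40 + 7 + 3 * (n + n + d) <= 1024 * (u + v + z) by lia.
have -> : K * 16 * (u + v + z) = 16 * (K * (u + v + z)) by rewrite mulnAC mulnC mulnA.
have e11 : K * v <= K * (u + v + z) by rewrite leq_mul2l; apply/orP; right; lia.
lia.
Qed.

Lemma tester_exec xs rs : exists2 st1,
  exec xs rs (machine (tester 2 4 2) 12) (input d G Q eps gamma) st1 &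
  [/\ verdict st1 = accepts d G Q eps gamma m0 m1 T0 xs, drawn st1 = m0 + (m1 + m1) &
      clock st1 <= time_bound].
Proof.
have [S [[ter dn cst] cx arrz rarrz [s0 nc]]] :=
  @tester_runs R n d G Q eps gamma xs n1 2 4 2 eps_gt0 gamma_gt0.
have [st [ex vd dr cl]] := machine_run rs n1 (tester_wf 2 4 2) (isT : 0 < 12 < 16) ter.
have pl i x : i < n -> pcode G i x < 2 ^ d.
  move=> iN; apply: leq_trans (exp_deg_le degG (Ordinal iN)).
  exact: (pcode_lt_deg G (Ordinal iN)).
have [v s] := @test_body_spec R n d G Q eps gamma xs n1 (2 ^ d) (n ^ (d + 2)) (log_up n) m0 m1 T0
  erefl pl S xs (fun t => xs (m0 + t)) (fun t => xs (m0 + m1 + t)) cx arrz rarrz s0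
  (fun t => erefl) (fun t => erefl) (fun t => erefl).
exists st => //; split.
- by rewrite vd dn v nc.
- by rewrite dr dn s addnA.
by rewrite cl; apply: leq_trans tester_cost; rewrite leq_add2l.
Qed.

End TesterSpec.

Local Open Scope ring_scope.

Section Exponentials.
Variable R : realType.
Implicit Types x y : R.

Lemma expRN_le x : 0 <= x -> expR (- x) <= (1 + x)^-1.
Proof.
move=> x0; rewrite exp.expRN lef_pV2 ?posrE ?exp.expR_gt0 ?ltr_wpDr //.
by have := exp.expR_ge1Dx x.
Qed.

Lemma expRN99_le : expR (- 99) <= 1 / 100 :> R.
Proof.
apply: le_trans (expRN_le _) _ => //.
have -> : 1 + 99 = 100 :> R by lra.
by rewrite div1r.
Qed.

Lemma exp2_le (k : nat) : 2 ^+ k <= expR k%:R :> R.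
Proof.
rewrite -[k%:R]mulr1 mulrC exp.expRM_natr lerXn2r ?nnegrE ?exp.expR_ge0 //.
by have := exp.expR_ge1Dx (1 : R); lra.
Qed.

(** Since [exp (1/2) <= (7/5) ^ 2 < 2]. *)
Lemma ln2_ge : 1/2 <= ln 2 :> R.
Proof.
rewrite -[leLHS]exp.expRK exp.ler_ln ?posrE ?exp.expR_gt0 //.
have -> : 1/2 = 1/4 + 1/4 :> R by lra.
have : expR (1/4) <= 1 + 1/4 + (1/4) ^+ 2 :> R.
  by apply: expR_quad; rewrite ger0_norm //; lra.
have e0 := exp.expR_ge0 (1/4 : R); rewrite exp.expRD => h.
have : expR (1/4) * expR (1/4) <= 7/5 * (7/5) :> R by apply: ler_pM => //; lra.
lra.
Qed.

End Exponentials.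

(** * The chosen sample sizes meet the numerical requirements and the stated bounds *)

Section Sizes.
Variables (R : realType) (n d : nat) (G : dag n) (eps gamma : R).
Hypothesis n1 : (1 < n)%N.
Hypothesis eps_gt0 : 0 < eps.
Hypothesis eps_le1 : eps <= 1.
Hypothesis gamma_gt0 : 0 < gamma.
Local Notation lg := (log_up n).
Local Notation m0 := (size0 d G gamma 2).
Local Notation m1 := (size1 n d eps 4).
Local Notation T0 := (threshold n d 2).
Local Notation root := (Num.sqrt n%:R : R).
Local Notation scale := (2 `^ (d%:R / 2) * root : R).
Local Notation budget := ((2 ^ d)%N%:R + d%:R * lg%:R : R).

Lemma pow1024 : 1024 = 2 ^+ 10 :> R.
Proof. by rewrite -natrX. Qed.

Lemma n_gt0 : 0 < n%:R :> R.
Proof. by rewrite ltr0n ltnW. Qed.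

Lemma ln_ge0 : 0 <= ln n%:R :> R.
Proof. by rewrite exp.ln_ge0 // (ler_nat R 1) ltnW. Qed.

Lemma root_ge1 : 1 <= root.
Proof. by rewrite -[leLHS]sqrtr1 ler_wsqrtr // (ler_nat R 1) ltnW. Qed.

Lemma root_sq : root ^+ 2 = n%:R.
Proof. by rewrite sqr_sqrtr // ltW ?n_gt0. Qed.

Lemma log_upP : (n <= 2 ^ lg)%N /\ forall k, (n <= 2 ^ k)%N -> (lg <= k)%N.
Proof. by apply: (@leastP (fun k => n <= 2 ^ k)%N); exists n; apply: ltnW; apply: ltn_expl. Qed.

Lemma log_up_ln : lg%:R <= 1 + 2 * ln n%:R :> R.
Proof.
have l0 := ln_ge0; have [_ lgM] := log_upP.
case E : lg => [|k]; first lra.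
have : (2 ^ k < n)%N by rewrite ltnNge; apply/negP => /lgM; rewrite E ltnn.
move/ltnW; rewrite -(ler_nat R) natrX => h.
have : ln (2 ^+ k) <= ln n%:R :> R by rewrite exp.ler_ln ?posrE ?exprn_gt0 ?n_gt0.
rewrite exp.lnXn // -[ln 2 *+ k]mulr_natl => h2.
have : k%:R * (1/2) <= k%:R * ln 2 :> R by rewrite ler_wpM2l // ln2_ge.
rewrite -[k.+1%:R]natr1; lra.
Qed.

Lemma scale_sq : scale ^+ 2 = n%:R * (2 ^ d)%N%:R.
Proof.
rewrite exprMn root_sq -exp.powR_mulrn ?exp.powR_ge0 // -exp.powRrM divfK ?pnatr_eq0 //.
by rewrite exp.powR_mulrn // mulrC natrX.
Qed.

Lemma scale_ge : root <= scale.
Proof.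
have r1 := root_ge1; rewrite ler_peMl //; first lra.
by rewrite -[leLHS](exp.powRr0 2) exp.ler_powR // ?divr_ge0 //; lra.
Qed.

Lemma scale_le : scale <= n%:R * (2 ^ d)%N%:R.
Proof.
rewrite -scale_sq expr2 ler_peMl //; have := scale_ge; have := root_ge1; lra.
Qed.

Lemma eps2_gt0 : 0 < eps ^+ 2.
Proof. by rewrite exprn_gt0. Qed.

(** Square roots are taken in the condition that defines [size1]; the upper bound holds because the
    predecessor of [m1] fails that condition and [eps ^ 2 <= 1]. *)
Lemma size1P : 2 ^+ 20 * scale <= m1%:R * eps ^+ 2 /\ m1%:R * eps ^+ 2 <= 2 ^+ 20 * scale + 1.
Proof.
have s1 := scale_ge; have r1 := root_ge1.
have e2 := eps2_gt0.
pose p (k : nat) := 1024 ^+ 4 * (n%:R * (2 ^ d)%N%:R) <= k%:R * k%:R * (eps * eps * (eps * eps)).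
have pE k : p k = (2 ^+ 20 * scale <= k%:R * eps ^+ 2).
  have A0 : 0 <= 2 ^+ 20 * scale by rewrite mulr_ge0 ?exprn_ge0 //; lra.
  have B0 : 0 <= k%:R * eps ^+ 2 by rewrite mulr_ge0 // ltW.
  rewrite /p -scale_sq -[RHS](@ler_pXn2r _ 2) ?nnegrE ?A0 ?B0 //.
  congr (_ <= _); last by ring.
  rewrite [RHS]exprMn -[in RHS]exprM; congr (_ * _); by rewrite pow1024 -exprM.
have [] : p m1 /\ forall k, p k -> (m1 <= k)%N.
  apply: (@leastP p); have [k hk] := archi_ex (2 ^+ 20 * scale) e2.
  by exists k; rewrite pE.
rewrite pE => h1 h2; split=> //; case E : m1 => [|k].
  by rewrite mul0r addr_ge0 // mulr_ge0 ?exprn_ge0 //; lra.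
have : ~~ p k by apply/negP => /h2; rewrite E ltnn.
rewrite pE -ltNge -[k.+1%:R]natr1 mulrDl mul1r => h.
have : eps ^+ 2 <= 1 by rewrite exprn_ile1 // ltW.
lra.
Qed.

Lemma budget_ge1 : 1 <= budget.
Proof. by rewrite ler_wpDr ?mulr_ge0 // (ler_nat R 1) expn_gt0. Qed.

Lemma size0P : (nedge G -> 2 ^+ 20 * budget <= m0%:R * gamma ^+ 2) /\
  m0%:R <= 1 + 2 ^+ 20 * budget / gamma ^+ 2.
Proof.
have g2 : 0 < gamma ^+ 2 by rewrite exprn_gt0.
have b1 := budget_ge1.
pose p (k : nat) := (nedge G)%:R * (1024 ^+ 2 * budget) <= k%:R * (gamma * gamma).
have -> : 2 ^+ 20 = 1024 ^+ 2 :> R.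
  by rewrite pow1024 -exprM.
have [h1 h2] : p m0 /\ forall k, p k -> (m0 <= k)%N.
  by apply: (@leastP p); apply: archi_ex; rewrite mulr_gt0.
split=> [ne|]; first by move: h1; rewrite /p ne mul1r -expr2.
case E : m0 => [|k].
  by rewrite addr_ge0 // divr_ge0 ?(ltW g2) // mulr_ge0 ?exprn_ge0 //; lra.
have : ~~ p k by apply/negP => /h2; rewrite E ltnn.
rewrite /p -ltNge -expr2 => /ltW h.
rewrite -[k.+1%:R]natr1 [leLHS]addrC lerD2l ler_pdivlMr //; apply: le_trans h _; rewrite ler_piMl ?mulr_ge0 ?exprn_ge0 //; first lra.
by case: (nedge G).
Qed.

Lemma thresholdE : T0%:R = 2 ^+ 20 * (d%:R + lg%:R + 1) :> R.
Proof.
rewrite /threshold natrM !natrD natrX; congr (_ * _).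
by rewrite pow1024 -exprM.
Qed.

Lemma union_configs_small :
  #|{: 'I_n * 'I_(2 ^ d)}|%:R * (2 * expR (- (T0%:R / 64))) <= 1 / 10 :> R.
Proof.
rewrite card_prod !card_ord thresholdE.
have [lgP _] := log_upP.
have h : (n * 2 ^ d)%N%:R <= expR (d%:R + lg%:R) :> R.
  apply: le_trans (_ : (2 ^ (lg + d))%N%:R <= _).
    by rewrite ler_nat expnD leq_mul2r lgP orbT.
  by rewrite natrX -natrD addnC exp2_le.
set u := d%:R + lg%:R in h *; have u0 : 0 <= u by rewrite addr_ge0.
have e1 : expR u * expR (- (2 ^+ 20 * (u + 1) / 64)) <= 1 / 100 :> R.
  rewrite -exp.expRD; apply: le_trans (_ : expR (- 99) <= _); last exact: expRN99_le.
  by rewrite exp.ler_expR; lra.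
have e0 := exp.expR_ge0 (- (2 ^+ 20 * (u + 1) / 64)).
rewrite mulrCA; apply: le_trans (_ : 2 * (1 / 100) <= _); last lra.
by rewrite ler_pM2l //; apply: le_trans e1; rewrite ler_wpM2r.
Qed.

Lemma size0_gt0 : nedge G -> (0 < m0)%N.
Proof.
move=> ne; have [/(_ ne) h _] := size0P; rewrite lt0n; apply/eqP => m00.
have b1 := budget_ge1; have : 0 < 2 ^+ 20 * budget by rewrite mulr_gt0 ?exprn_gt0 //; lra.
by rewrite m00 mul0r in h; rewrite ltNge h.
Qed.

(** The factors of the union bound total at most [exp (4 * budget)]; here [d + 2 <= 4 * d] uses that
    [d] is positive. The batch size contributes [2 ^ 20 / 256] times the budget to the negative
    exponent. *)
Lemma union_tuples_small : (0 < d)%N -> nedge G ->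
  (n ^ (d + 2))%N%:R * (2 ^+ (4 * 2 ^ d) * expR (- (m0%:R * gamma ^+ 2 / 256))) <= 1 / 10 :> R.
Proof.
move=> d0 ne; have [/(_ ne) hm _] := size0P; have b1 := budget_ge1.
have [lgP _] := log_upP.
have h : (n ^ (d + 2))%N%:R * 2 ^+ (4 * 2 ^ d) <= expR (4 * budget).
  apply: le_trans (_ : 2 ^+ (lg * (d + 2) + 4 * 2 ^ d) <= _).
    rewrite exprD ler_wpM2r ?exprn_ge0 // -natrX ler_nat expnM leq_exp2r ?addn2 //.
  apply: le_trans (exp2_le R _) _; rewrite exp.ler_expR.
  have -> : 4 * budget = (4 * (2 ^ d + d * lg))%N%:R by rewrite natrM natrD natrM.
  rewrite ler_nat; nia.
rewrite mulrA; apply: le_trans (_ : expR (4 * budget) * expR (- (m0%:R * gamma ^+ 2 / 256)) <= _).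
  by rewrite ler_wpM2r ?exp.expR_ge0.
rewrite -exp.expRD; apply: le_trans (_ : expR (- 99) <= _); first by rewrite exp.ler_expR; lra.
by apply: le_trans (expRN99_le R) _; lra.
Qed.

Lemma size1_cells : 2 ^+ 40 * #|{: 'I_n * 'I_(2 ^ d)}|%:R <= (m1%:R * eps ^+ 2) ^+ 2.
Proof.
have [h _] := size1P; have s1 := scale_ge; have r1 := root_ge1.
rewrite card_prod !card_ord natrM -scale_sq.
have -> : 2 ^+ 40 * scale ^+ 2 = (2 ^+ 20 * scale) ^+ 2 by rewrite [RHS]exprMn -[in RHS]exprM.
have A0 : 0 <= 2 ^+ 20 * scale by rewrite mulr_ge0 ?exprn_ge0 //; lra.
by rewrite lerXn2r // ?nnegrE // mulr_ge0 // ltW ?eps2_gt0.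
Qed.

Lemma size1_root : 2 ^+ 20 * root <= m1%:R * eps ^+ 2.
Proof.
have [h _] := size1P; apply: le_trans h.
by rewrite ler_pM2l ?exprn_gt0 // scale_ge.
Qed.

Lemma size1_gt1 : (1 < m1)%N.
Proof.
rewrite -(ltr_nat R); have h := size1_root; have r1 := root_ge1.
have : m1%:R * eps ^+ 2 <= m1%:R by rewrite ler_piMr // exprn_ile1 // ltW.
lra.
Qed.

Lemma size1_c c : 16 * (1 + ln n%:R) * (1 / root) <= c -> 2 ^+ 20 <= m1%:R * eps ^+ 2 * c.
Proof.
move=> hc; have h := size1_root; have r1 := root_ge1; have l0 := ln_ge0.
have r0 : 0 < root by lra.
apply: le_trans (_ : 2 ^+ 20 * root * (16 * (1 + ln n%:R) * (1 / root)) <= _).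
  have -> : 2 ^+ 20 * root * (16 * (1 + ln n%:R) * (1 / root)) = 2 ^+ 20 * (16 * (1 + ln n%:R)).
    by field; rewrite gt_eqF.
  by rewrite ler_peMr ?exprn_ge0 //; lra.
apply: ler_pM => //; first by rewrite mulr_ge0 ?exprn_ge0 // ltW.
by rewrite !mulr_ge0 ?invr_ge0 // ?ltW //; lra.
Qed.

(** A positive [d] lets the product [d * (1 + ln n)] absorb the sum [d + log n + 1] of the
    threshold. *)
Lemma size1_hits C : (0 < d)%N ->
  16 * (1 + ln n%:R) * (d%:R * eps ^+ 2 / root) <= C -> 2 * T0%:R <= m1%:R * C.
Proof.
move=> d0 hC; have h := size1_root; have r1 := root_ge1; have l0 := ln_ge0.
have e2 := eps2_gt0; have r0 : 0 < root by lra.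
have d1 : 1 <= d%:R :> R by rewrite (ler_nat R 1).
have lgl := log_up_ln; rewrite thresholdE.
apply: le_trans (_ : m1%:R * (16 * (1 + ln n%:R) * (d%:R * eps ^+ 2 / root)) <= _); last first.
  by rewrite ler_wpM2l.
have -> : m1%:R * (16 * (1 + ln n%:R) * (d%:R * eps ^+ 2 / root)) =
          (m1%:R * eps ^+ 2 / root) * (16 * ((1 + ln n%:R) * d%:R)) by field; rewrite gt_eqF.
have hh : 2 ^+ 20 <= m1%:R * eps ^+ 2 / root by rewrite ler_pdivlMr.
have dl : 0 <= (d%:R - 1) * ln n%:R :> R by rewrite mulr_ge0 // subr_ge0.
apply: le_trans (_ : 2 ^+ 20 * (16 * ((1 + ln n%:R) * d%:R)) <= _); first lra.
by rewrite ler_wpM2r // !mulr_ge0 //; lra.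
Qed.

(** With [d = 0] the bound on [C] says only [0 <= C], but every parental configuration is the sure
    event; and [c <= 1/2] forces [n] to be so large that [m1] itself is at least twice the
    threshold. *)
Lemma size1_hits0 c : d = 0%N -> 16 * (1 + ln n%:R) * (1 / root) <= c -> c <= 1/2 ->
  2 * T0%:R <= m1%:R :> R.
Proof.
move=> d0 hc c2; have h := size1_root; have r1 := root_ge1; have l0 := ln_ge0.
have : m1%:R * eps ^+ 2 <= m1%:R by rewrite ler_piMr // exprn_ile1 // ltW.
have : 16 * (1 + ln n%:R) <= 1/2 * root.
  by rewrite -ler_pdivrMr; [rewrite -[X in X <= _]mulr1 mulrAC -mulrA in hc *; lra | lra].
have d00 : d%:R = 0 :> R by rewrite d0.
by have := log_up_ln; rewrite thresholdE d00; lra.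
Qed.

Lemma sample_bound : (m0 + (m1 + m1))%N%:R <=
  2 ^+ 30 * (scale / eps ^+ 2 + (2 ^+ d + d%:R * ln n%:R) / gamma ^+ 2).
Proof.
have [_ h0] := size0P; have [_ h1] := size1P; have lgl := log_up_ln.
have e2 := eps2_gt0; have g2 : 0 < gamma ^+ 2 by rewrite exprn_gt0.
have s1 := scale_ge; have r1 := root_ge1; have l0 := ln_ge0.
have y1 : 1 <= scale by lra.
have e21 : eps ^+ 2 <= 1 by rewrite exprn_ile1 // ltW.
have f1 : m1%:R <= (2 ^+ 20 + 1) * (scale / eps ^+ 2).
  by rewrite mulrA ler_pdivlMr //; lra.
have f2 : 1 <= scale / eps ^+ 2 by rewrite ler_pdivlMr // mul1r; lra.
have dd : d%:R <= 2 ^+ d :> R by rewrite -natrX ler_nat ltnW // ltn_expl.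
have f3 : budget / gamma ^+ 2 <= 2 * ((2 ^+ d + d%:R * ln n%:R) / gamma ^+ 2).
  rewrite mulrA ler_pM2r ?invr_gt0 // natrX.
  have : d%:R * lg%:R <= d%:R * (1 + 2 * ln n%:R) :> R by rewrite ler_wpM2l.
  lra.
have f4 : 0 <= (2 ^+ d + d%:R * ln n%:R) / gamma ^+ 2.
  by rewrite divr_ge0 ?(ltW g2) // addr_ge0 ?exprn_ge0 // mulr_ge0.
rewrite !natrD; rewrite -mulrA in h0; lra.
Qed.

(** Factors exponential in [d] and the numerical constant are absorbed in the base:
    [(2 ^ 30) ^ d >= (2 ^ d) ^ 2] and [(2 ^ 30) ^ 3 >= 2 ^ 50]. *)
Lemma time_bound_le : (time_bound d G eps gamma)%:R <=
  (2 ^+ 30 * n%:R) ^+ (d + 3) * (1 / gamma ^+ 2 + 1 / eps ^+ 2).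
Proof.
have [_ h0] := size0P; have [_ h1] := size1P.
have e2 := eps2_gt0; have g2 : 0 < gamma ^+ 2 by rewrite exprn_gt0.
have s1 := scale_ge; have r1 := root_ge1.
have e21 : eps ^+ 2 <= 1 by rewrite exprn_ile1 // ltW.
have nn : 1 <= n%:R :> R by rewrite (ler_nat R 1) ltnW.
set D : R := 2 ^+ d; have D1 : 1 <= D by rewrite exprn_ege1 // (ler_nat R 1).
have d1 : d.+1%:R <= D by rewrite /D -natrX ler_nat ltn_expl.
set g := (gamma ^+ 2)^-1; set e := (eps ^+ 2)^-1.
have g0 : 0 < g by rewrite invr_gt0.
have e1 : 1 <= e by rewrite invf_ge1.
have hb : budget <= 2 * (D * n%:R).
  have lgn : lg%:R <= n%:R :> R by rewrite ler_nat log_up_le.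
  have : d%:R * lg%:R <= D * n%:R by apply: ler_pM => //; apply: le_trans d1; rewrite ler_nat.
  have : D <= D * n%:R by rewrite ler_peMr //; lra.
  rewrite natrX -/D; lra.
have f0 : m0%:R <= 1 + 2 ^+ 21 * (D * n%:R * g).
  apply: le_trans h0 _; rewrite lerD2l -/g.
  have : budget * g <= 2 * (D * n%:R) * g by rewrite ler_pM2r.
  rewrite -mulrA; lra.
have f1 : m1%:R <= 2 ^+ 21 * (D * n%:R * e).
  have : scale <= D * n%:R by rewrite [D * _]mulrC /D -natrX scale_le.
  rewrite -[m1%:R](mulfK (lt0r_neq0 e2)) -/e => h.
  rewrite !mulrA ler_pM2r; last by lra.
  lra.
set N2 : R := n%:R ^+ (d + 2).
have N20 : 0 < N2 by rewrite exprn_gt0; lra.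
have n2 : n%:R ^+ 2 <= N2 by rewrite ler_weXn2l // leq_addl.
have q1 : N2 * (m0%:R * d.+1%:R) <= N2 * (1 + 2 ^+ 21 * (D * n%:R * g)) * D.
  by rewrite -mulrA ler_pM2l //; apply: ler_pM.
have q2 : N2 * (n%:R + D + d.+1%:R) <= N2 * (3 * (D * n%:R)).
  rewrite ler_pM2l //.
  have : 0 <= (D - 1) * (n%:R - 1) by rewrite mulr_ge0 // subr_ge0.
  have : 2 <= n%:R :> R by rewrite (ler_nat R 2).
  nra.
have q3 : m1%:R * (n%:R * n%:R) <= 2 ^+ 21 * (D * n%:R * e) * N2.
  by apply: ler_pM => //; rewrite ?mulr_ge0 // -expr2.
have tot : (time_bound d G eps gamma)%:R <= 2 ^+ 24 *
    (N2 * (1 + 2 ^+ 21 * (D * n%:R * g)) * D + N2 * (3 * (D * n%:R)) + 2 ^+ 21 * (D * n%:R * e) * N2).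
  rewrite /time_bound natrM !natrD natrX !natrM ler_pM2l ?exprn_gt0 // !natrX !natrD natrX -/N2 -/D.
  lra.
apply: le_trans tot _.
set W := N2 * n%:R * D ^+ 2.
have W0 : 0 <= W by rewrite !mulr_ge0 ?exprn_ge0 // ?ltW //; lra.
have De : 1 <= D * e by rewrite mulr_ege1.
have w1 : N2 * D <= W * e.
  have -> : W * e = N2 * D * (n%:R * (D * e)) by rewrite /W; ring.
  by rewrite ler_peMr ?mulr_ege1 // mulr_ge0 ?ltW //; lra.
have w2 : N2 * (D * n%:R) <= W * e.
  have -> : W * e = N2 * (D * n%:R) * (D * e) by rewrite /W; ring.
  by rewrite ler_peMr // !mulr_ge0 //; lra.
have w3 : D * n%:R * e * N2 <= W * e.
  have -> : W * e = D * n%:R * e * N2 * D by rewrite /W; ring.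
  by rewrite ler_peMr // !mulr_ge0 //; lra.
apply: le_trans (_ : 2 ^+ 50 * W * (g + e) <= _).
  have -> : N2 * (1 + 2 ^+ 21 * (D * n%:R * g)) * D = N2 * D + 2 ^+ 21 * (W * g).
    by rewrite /W; ring.
  have : 0 <= W * g by rewrite mulr_ge0 // ltW.
  have : 0 <= W * e by rewrite mulr_ge0 //; lra.
  lra.
rewrite !div1r -/g -/e ler_pM2r; last by lra.
rewrite exprMn; have -> : n%:R ^+ (d + 3) = N2 * n%:R :> R by rewrite -exprSr addnS.
have -> : 2 ^+ 50 * W = 2 ^+ 50 * D ^+ 2 * (N2 * n%:R) by rewrite /W; ring.
rewrite ler_wpM2r ?mulr_ge0 ?(ltW N20) // mulrC exprD.
have D0 : 0 <= D by lra.
apply: ler_pM; rewrite ?exprn_ge0 //.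
  have -> : (2 ^+ 30) ^+ d = D ^+ 30 by rewrite /D -!exprM mulnC.
  by rewrite ler_weXn2l.
by rewrite -exprM ler_weXn2l // (ler_nat R 1).
Qed.

End Sizes.

Theorem theorem6p11 (R : realType) :
  exists (A : prog) (K M : R) (k : nat), [/\ 0 < K, 0 < M &
  forall (n d : nat) (S : dag n) (Q : distr R n) (c C gamma eps : R),
    (0 < n)%N ->
    bayes_net S Q -> (degree S <= d)%N ->
    balanced S Q c C ->
    K * (1 + ln n%:R) ^+ k * (1 / Num.sqrt n%:R) <= c ->
    K * (1 + ln n%:R) ^+ k * (d%:R * eps ^+ 2 / Num.sqrt n%:R) <= C ->
    0 < gamma -> nondegenerate S Q d gamma ->
    0 < eps <= 1 ->
    exists m t : nat,
      [/\ m%:R <= M * (2 `^ (d%:R / 2) * Num.sqrt n%:R / eps ^+ 2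
                       + (2 ^+ d + d%:R * ln n%:R) / gamma ^+ 2),
          t%:R <= (M * n%:R) ^+ (d + 3) * (1 / gamma ^+ 2 + 1 / eps ^+ 2),
          halts_within n A (input d S Q eps gamma) m t &
          forall P : distr R n,
            (exists T : dag n, [/\ bayes_net T P, (degree T <= d)%N &
                                   (#|skeleton T| <= #|skeleton S|)%N]) ->
            (P =1 Q -> 2 / 3 <= verdict_prob A (input d S Q eps gamma) P m t true) /\
            (eps < l1 P Q ->
               2 / 3 <= verdict_prob A (input d S Q eps gamma) P m t false)]].
Proof.
(* The logarithmic factors hidden in the bounds on [c] and [C] are a single [1 + ln n] with constant
   16; array 12 holds the verdict. *)
exists (machine (tester 2 4 2) 12), 16, (2 ^+ 30), 1%N; split=> //; first by rewrite exprn_gt0.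
move=> n d S Q c C gamma eps n0 netQ degS bal hc hC g0 nondeg /andP[e0 e1].
rewrite expr1 in hc hC.
have ln0 : 0 <= ln n%:R :> R by rewrite exp.ln_ge0 // (ler_nat R 1).
have c2 := c_le_half bal n0.
have root0 : 0 < Num.sqrt n%:R :> R by rewrite sqrtr_gt0 ltr0n.
have c0 : 0 < c.
  by apply: lt_le_trans hc; rewrite mulr_gt0 ?divr_gt0 // mulr_gt0 // ltr_pwDl.
(* For [n = 1] the hypothesis would give [c >= 16], against [c <= 1/2]. *)
have n1 : (1 < n)%N.
  rewrite ltn_neqAle n0 andbT; apply/eqP => n1; move: hc.
  by rewrite -n1 exp.ln1 sqrtr1; lra.
have [s topo [psi facQ]] := bayes_net_factors netQ.
have edge_d : nedge S -> (0 < d)%N.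
  move/nedgeP => [i [j jS]]; apply: leq_trans degS.
  by apply: leq_trans (leq_bigmax (F := fun i => #|parents S i|) i); apply/card_gt0P; exists j.
have hits i a : 2 * (threshold n d 2)%:R <= (size1 n d eps 4)%:R * Pr Q (par_config S i a).
  have [_ hP] := bal i a; have [d0|d0] := posnP d.
    have -> : Pr Q (par_config S i a) = 1.
      rewrite -[RHS](pmf_sum1 Q); apply: eq_bigl => y; rewrite inE; apply/forallP => j.
      apply/implyP => jS; move: (deg_le degS i); rewrite d0 leqn0 cards_eq0 => /eqP e.
      by rewrite -[parents S i]/(S i) e inE in jS.
    by rewrite mulr1; apply: (size1_hits0 n1 e0 e1 d0 hc c2).
  by apply: le_trans (size1_hits n1 e0 e1 d0 hC) _; rewrite ler_wpM2l.
have T0_ge : 2 ^+ 20 <= (threshold n d 2)%:R :> R.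
  by rewrite thresholdE ler_peMr ?exprn_ge0 // lerDr addr_ge0.
have tuples ne := union_tuples_small n1 e0 e1 g0 (edge_d ne) ne.
pose m := (size0 d S gamma 2 + (size1 n d eps 4 + size1 n d eps 4))%N.
have ex xs rs := tester_exec Q n1 e0 g0 degS xs rs.
have exv xs rs : exists2 st1, exec xs rs (machine (tester 2 4 2) 12) (input d S Q eps gamma) st1 &
    verdict st1 = accepts d S Q eps gamma (size0 d S gamma 2) (size1 n d eps 4) (threshold n d 2) xs.
  by have [st1 h [v _ _]] := ex xs rs; exists st1.
exists m, (time_bound d S eps gamma); split.
- exact: sample_bound.
- exact: time_bound_le.
- by move=> xs rs; have [st1 h [_ dr cl]] := ex xs rs; exists st1 => //; rewrite dr leqnn.
move=> P [T [netT degT skT]]; split=> [PQ|far].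
  have -> : P = Q.
    case: (P) (Q) PQ => [p p0 p1] [q q0 q1] /= /funext pq; subst q.
    by congr Distr; exact: Prop_irrelevance.
  apply: verdict_prob_two_thirds exv _ (null_reject_prob n1 topo facQ degS c0 bal g0 nondeg e0
    (size0_gt0 d g0) tuples (union_configs_small R n d) T0_ge hits (size1_cells d n1 e0 e1)
    (size1_gt1 d n1 e0 e1)) => w.
  by rewrite eqb_id.
apply: verdict_prob_two_thirds exv _ (far_accept_prob n1 topo facQ degS c0 bal g0 nondeg e0
  (size0_gt0 d g0) tuples (union_configs_small R n d) T0_ge (size1_cells d n1 e0 e1)
  (size1_c d n1 e0 e1 hc) (size1_gt1 d n1 e0 e1) netT degT skT far) => w.
by rewrite eqbF_neg negbK.
Qed.
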